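(* Let $V=\mathbb{C}^{n_1}\otimes\cdots\otimes\mathbb{C}^{n_p}$, let $X\subseteq V$ be the cone over the variety of rank-one tensors and $X^*$ its dual variety, and let $\mathrm{DL}_2=\mathrm{DL}_{X\cap X^*}$. Then: (a) $X\subseteq\mathrm{DL}_2$; (b) any $T\in\mathrm{DL}_2$ has border rank less than or equal to $2$; (c) $\mathrm{DL}_2$ contains all rank at most $2$ weakly orthogonally decomposable tensors.
   Context: $X\subseteq V$ is the variety of tensors of the form $x_1\otimes\cdots\otimes x_p$ (rank at most one). Fix inner products $\langle\cdot,\cdot\rangle_i$ on $\mathbb{R}^{n_i}$, extended to complex bilinear forms on $\mathbb{C}^{n_i}$. The Bombieri-Weyl form on $V$ is the bilinear form determined by $\langle x_1\otimes\cdots\otimes x_p,\,y_1\otimes\cdots\otimes y_p\rangle_{BW}=\prod_{i}\langle x_i,y_i\rangle_i$ and linearity. Orthogonality ($\perp$) is with respect to these bilinear forms. For a variety $Y\subseteq V$ let $Y_{reg}$ be its set of regular points and, for $x\in Y_{reg}$, let $N_xY=(T_xY)^\perp$. The conormal variety is $\operatorname{Con}(Y)=\overline{\{(x,y)\in V\times V\mid x\in Y_{reg},\ y\in N_xY\}}$, and the dual variety is $Y^*=\overline{\pi_2(\operatorname{Con}(Y))}\subseteq V$. The joint ED correspondence $\mathcal{E}_{X^*,X}$ is the closure of $\{(y,x,T)\mid (y,x)\in\operatorname{Con}(X^* ),\ T=x+y\}\subseteq V\times V\times V$, with $\pi_3$ the projection to the last factor. For a subvariety $A\subseteq X^*$ its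 data locus is $\mathrm{DL}_A=\overline{\pi_3(\mathcal{E}_{X^*,X}\cap(A\times V\times V))}$. A tensor has border rank at most $r$ if it is a limit of tensors of rank at most $r$. A tensor $T\in V$ is weakly orthogonally decomposable if $T=\sum_{i=1}^m x_1^i\otimes\cdots\otimes x_p^i$ with all $x_j^i\in\mathbb{C}^{n_j}$ nonzero and $x_j^k\perp x_j^l$ for all $k\ne l$ and all $1\le j\le p$ (isotropic vectors allowed). ''Weakly orthogonally decomposable of rank at most $r$'' means that $T$ admits such a decomposition with $m\le r$ terms. *)

(* Defs.v *)
From HB Require Import structures.
From mathcomp Require Import all_boot all_order all_algebra.
From mathcomp Require Import boolp classical_sets reals topology normedtype
  sequences.
From mathcomp Require Import complex ring.
(* the notations of mpoly clash with those of mathcomp-analysis *)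
From mathcomp Require Import -(notations) mpoly.

Set Implicit Arguments.
Unset Strict Implicit.
Unset Printing Implicit Defensive.

Import Order.TTheory GRing.Theory Num.Theory.
Import numFieldNormedType.Exports.
Local Open Scope classical_set_scope.
Local Open Scope ring_scope.

Section AffineVarieties.
Variables (K : fieldType) (W : vectType K).

(* The polynomial functions on W are the polynomials in the coordinates on
   [vbasis fullv]; another basis would give the same functions. *)
Definition polyfun := mpoly (\dim {:W}) K.

Definition peval (P : polyfun) (w : W) : K :=
  meval (fun k => coord (vbasis {:W}) k w) P.

Definition pdiff (P : polyfun) (x v : W) : K :=
  \sum_(k < \dim {:W})
    peval (mderiv k P) x * coord (vbasis {:W}) k v.

Definition vanishing_ideal (A : set W) : set polyfun :=
  [set P | forall w, A w -> peval P w = 0].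

Definition zclosure (A : set W) : set W :=
  [set w | forall P, vanishing_ideal A P -> peval P w = 0].

Definition zclosed (A : set W) : Prop := zclosure A = A.

Definition zirreducible (Z : set W) : Prop :=
  Z !=set0 /\ forall A B : set W, zclosed A -> zclosed B ->
    Z `<=` A `|` B -> Z `<=` A \/ Z `<=` B.

Definition alg_independent_on (Z : set W) (d : nat) (f : 'I_d -> polyfun) :
    Prop :=
  forall Q : mpoly d K,
    (forall z, Z z -> meval (fun j => peval (f j) z) Q = 0) -> Q = 0.

(* For Z irreducible and closed, d is the transcendence degree over K of the
   function field of Z, which is the definition of the dimension of Z. *)
Definition has_dim (Z : set W) (d : nat) : Prop :=
  (exists f : 'I_d -> polyfun, alg_independent_on Z f) /\
  ~ (exists f : 'I_d.+1 -> polyfun, alg_independent_on Z f).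

(* The largest dimension of an irreducible closed subset of Y through x. *)
Definition has_local_dim (Y : set W) (x : W) (d : nat) : Prop :=
  (exists Z, [/\ zclosed Z, zirreducible Z, Z `<=` Y, Z x & has_dim Z d]) /\
  (forall Z e, zclosed Z -> zirreducible Z -> Z `<=` Y -> Z x ->
     has_dim Z e -> (e <= d)%N).

Definition tangent_space (Y : set W) (x : W) : set W :=
  [set v | forall P, vanishing_ideal Y P -> pdiff P x v = 0].

(* The Zariski tangent space has the dimension of Y at x. *)
Definition regular_point (Y : set W) : set W :=
  [set x | Y x /\ exists U : {vspace W},
     (forall v, v \in U <-> tangent_space Y x v) /\
     has_local_dim Y x (\dim U)].

End AffineVarieties.

Section Duality.
Variables (K : fieldType) (W : vectType K) (form : W -> W -> K).

Definition normal_space (Y : set W) (x : W) : set W :=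
  [set y | forall v, tangent_space Y x v -> form v y = 0].

Definition conormal (Y : set W) : set (W * W) :=
  zclosure [set u : W * W | regular_point Y u.1 /\ normal_space Y u.1 u.2].

Definition dual_variety (Y : set W) : set W := zclosure (snd @` conormal Y).

(* E_{X^*,X}; the points of W * W * W are the triples (y, x, T). *)
Definition joint_ED (X : set W) : set (W * W * W) :=
  zclosure [set u : W * W * W |
    conormal (dual_variety X) u.1 /\ u.2 = u.1.2 + u.1.1].

Definition data_locus (X A : set W) : set W :=
  zclosure (snd @` (joint_ED X `&` (A `*` setT `*` setT))).

End Duality.

Section Tensors.
Variables (R : realType) (p : nat) (n : 'I_p -> nat).
Local Notation C := R[i].

Definition multi_index := {dffun forall i : 'I_p, 'I_(n i)}.

(* The entry type is C^o (convertible to C) because that alias carries both the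
   vector space structure and the topology of C. *)
Definition tensor : Type := {ffun multi_index -> C^o}.

Definition pure (x : forall i, 'rV[C]_(n i)) : tensor :=
  [ffun a : multi_index => (\prod_i x i 0 (a i) : C^o)].

Definition rank_one_cone : set tensor := range pure.

Definition rank_le (r : nat) : set tensor :=
  [set T | exists x : 'I_r -> forall i, 'rV[C]_(n i),
     T = \sum_(k < r) pure (x k)].

(* Entrywise convergence is convergence in the Euclidean topology. *)
Definition border_rank_le (r : nat) : set tensor :=
  [set T | exists S : nat -> tensor,
     (forall k, rank_le r (S k)) /\
     forall a : multi_index, S k a @[k --> \oo] --> T a].

Section Forms.
Variable g : forall i : 'I_p, {dot 'rV[R]_(n i) for idfun}.

(* The complex bilinear (not sesquilinear) extension of g i. *)
Definition complexify (i : 'I_p) (x y : 'rV[C]_(n i)) : C :=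
  let re := map_mx (@complex.Re R) (n := n i) in
  let im := map_mx (@complex.Im R) (n := n i) in
  ((g i (re x) (re y) - g i (im x) (im y)) +i*
   (g i (re x) (im y) + g i (im x) (re y)))%C.

Definition bombieri_weyl (S T : tensor) : C :=
  \sum_(a : multi_index) \sum_(b : multi_index)
    S a * T b * \prod_i complexify (delta_mx 0 (a i)) (delta_mx 0 (b i)).

Definition DL2 : set tensor :=
  data_locus bombieri_weyl rank_one_cone
    (rank_one_cone `&` dual_variety bombieri_weyl rank_one_cone).

Definition weakly_odeco_le (r : nat) : set tensor :=
  [set T | exists m (x : 'I_m -> forall i, 'rV[C]_(n i)),
     [/\ (m <= r)%N,
         forall k i, x k i != 0,
         forall k l, k != l -> forall i, complexify (x k i) (x l i) = 0
       & T = \sum_(k < m) pure (x k)]].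

End Forms.
End Tensors.

Lemma big_dffun_distr (I : finType) (T : I -> finType) (A : comPzSemiRingType)
    (F : forall i, T i -> A) :
  \sum_(a : {dffun forall i, T i}) \prod_i F i (a i) = \prod_i \sum_j F i j.
Proof.
rewrite (reindex (@dffun_of_fprod I T)) /=; last first.
  exact/onW_bij/dffun_of_fprod_bij.
pose G i := [ffun j : T i => F i j].
transitivity (\sum_(t : fprod T) \prod_(i in I) G i (t i)).
  by apply: eq_bigr => t _; apply: eq_bigr => i _; rewrite !ffunE.
rewrite big_fprod -(bigA_distr_big_dep (fun i => tagged_with T i)
  (fun i u => untag 0 (G i) u)).
apply: eq_bigr => i _; rewrite -(big_tag (fun i => G i)).
by apply: eq_bigr => j _; rewrite ffunE.
Qed.

(* bombieri_weyl is bilinear by its shape; bombieri_weyl_pure below shows that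
   it has the values on pure tensors that characterize the Bombieri-Weyl form *)
Section BombieriWeyl.
Variables (R : realType) (p : nat) (n : 'I_p -> nat).
Variable g : forall i : 'I_p, {dot 'rV[R]_(n i) for idfun}.
Local Notation C := R[i].
Local Notation complexify := (complexify g).
Local Notation bombieri_weyl := (bombieri_weyl g).

Lemma map_mx_ReZ k (c : C) (x : 'rV[C]_k) : map_mx (@complex.Re R) (c *: x) =
  complex.Re c *: map_mx (@complex.Re R) x +
  (- complex.Im c) *: map_mx (@complex.Im R) x.
Proof.
apply/rowP=> j; rewrite !mxE.
by case: c (x 0 j) => a b [u v] /=; rewrite ?mulNr.
Qed.

Lemma map_mx_ImZ k (c : C) (x : 'rV[C]_k) : map_mx (@complex.Im R) (c *: x) =
  complex.Re c *: map_mx (@complex.Im R) x +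
  complex.Im c *: map_mx (@complex.Re R) x.
Proof.
apply/rowP=> j; rewrite !mxE.
by case: c (x 0 j) => a b [u v] /=; rewrite ?mulNr.
Qed.

Lemma map_mx_ReD k (x y : 'rV[C]_k) : map_mx (@complex.Re R) (x + y) =
  map_mx (@complex.Re R) x + map_mx (@complex.Re R) y.
Proof.
by apply/rowP=> j; rewrite !mxE; case: (x 0 j) (y 0 j) => a b [u v].
Qed.

Lemma map_mx_ImD k (x y : 'rV[C]_k) : map_mx (@complex.Im R) (x + y) =
  map_mx (@complex.Im R) x + map_mx (@complex.Im R) y.
Proof.
by apply/rowP=> j; rewrite !mxE; case: (x 0 j) (y 0 j) => a b [u v].
Qed.

Lemma complexifyC i x y : complexify (i := i) x y = complexify y x.
Proof.
have gC u v : g i u v = g i v u by rewrite hermC expr0 mul1r.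
rewrite /complexify /= addrC ![g i _ (map_mx _ x)]gC.
by congr (_ +i* _)%C; rewrite addrC.
Qed.

Lemma complexifyP i (c : C) x1 x2 y :
  complexify (i := i) (c *: x1 + x2) y =
   c * complexify x1 y + complexify x2 y.
Proof.
rewrite /complexify /= !map_mx_ReD !map_mx_ImD !map_mx_ReZ !map_mx_ImZ.
rewrite !(linearDl,linearZl_LR) /=.
case: c => a b; simpc; congr (_ +i* _)%C.
all: by rewrite /=; ring.
Qed.

Lemma complexifyE i (x y : 'rV[C]_(n i)) : complexify x y =
  \sum_k \sum_l x 0 k * y 0 l *
    complexify (delta_mx 0 k : 'rV_(n i)) (delta_mx 0 l : 'rV_(n i)).
Proof.
have suml (I : finType) (F : I -> C) (v : I -> 'rV_(n i)) w :
    complexify (\sum_j F j *: v j) w = \sum_j F j * complexify (v j) w.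
  apply: (big_ind2 (fun a b => complexify a w = b)) => [|a b c d <- <-|j _].
  - have := complexifyP 1 (0 : 'rV_(n i)) 0 w.
    by rewrite scaler0 addr0 mul1r => /(canLR (addrK _)); rewrite subrr.
  - by rewrite -[a]scale1r complexifyP mul1r scale1r.
  - have := complexifyP (F j) (v j) 0 w; rewrite addr0 => ->.
    have := complexifyP 1 (0 : 'rV_(n i)) 0 w.
    rewrite scaler0 addr0 mul1r => /(canLR (addrK _)); rewrite subrr => <-.
    by rewrite addr0.
rewrite {1}[x]row_sum_delta suml; apply: eq_bigr => k _.
rewrite complexifyC {1}[y]row_sum_delta suml mulr_sumr; apply: eq_bigr => l _.
by rewrite mulrA complexifyC.
Qed.

Lemma bombieri_weyl_pure (x y : forall i, 'rV[C]_(n i)) :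
  bombieri_weyl (pure x) (pure y) = \prod_i complexify (x i) (y i).
Proof.
under [LHS]eq_bigr => a _ do
  under eq_bigr => b _ do rewrite !ffunE -!big_split /=.
under [RHS]eq_bigr do rewrite complexifyE.
rewrite -(big_dffun_distr (fun i k => \sum_l x i 0 k * y i 0 l *
  complexify (delta_mx 0 k : 'rV_(n i)) (delta_mx 0 l : 'rV_(n i)))).
apply: eq_bigr => a _.
exact: (big_dffun_distr (fun i l => x i 0 (a i) * y i 0 l *
  complexify (delta_mx 0 (a i) : 'rV_(n i)) (delta_mx 0 l : 'rV_(n i)))).
Qed.

End BombieriWeyl.

(* Main.v *)
Require Import Defs.
From HB Require Import structures.
From mathcomp Require Import all_boot all_order all_algebra.
From mathcomp Require Import boolp classical_sets reals topology normedtype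
  sequences.
From mathcomp Require Import complex ring.
From mathcomp Require Import -(notations) mpoly.

Set Implicit Arguments.
Unset Strict Implicit.
Unset Printing Implicit Defensive.

Import Order.TTheory GRing.Theory Num.Theory.
Import numFieldNormedType.Exports.
Local Open Scope classical_set_scope.
Local Open Scope ring_scope.

(** Let X be the cone of rank one tensors and Y its dual variety.  The joint ED
    correspondence consists of the triples (y, x, x + y) with (y, x) in the
    conormal variety of Y, so the data locus of the common points of X and Y is
    the closure of the set of the sums x + y with (y, x) in Con(Y) and y in both
    X and Y.  Biduality says that Con(Y) is Con(X) with the factors exchanged;
    two consequences of it are enough, and each has a direct proof for X.

    The exchanged Con(X) lies in Con(Y) ([conormal_dual]).  The conormal variety
    of X is the closure of the image of an explicit polynomial map
    u -> (x(u), y(u)), of which the second component parametrizes Y.  For generic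
    u the point y(u) of Y is regular and the tangent space of Y there is the image
    of the differential of y ([generic_smoothness]), which is orthogonal to the
    point of tangency x(u).  Part (a) is the case y = 0.  For part (c), let x + y
    be a weakly orthogonally decomposable sum of two rank one tensors in at least
    two factors: a tangent vector of X at x is a sum of pure tensors that agree
    with x in all factors but one, and each of them is orthogonal to y because of
    any other factor.  Hence (x, y) is in
    Con(X).  With a single factor every tensor has rank at most one.

    If (y, x) is in Con(Y), then x has rank at most one
    ([conormal_dual_rank_one]).  A vector normal to Y at y is the gradient at y of
    an equation P of Y.  As X is closed and the gradient of P depends polynomially
    on y, the point y may be assumed to be generic, hence to be a normal vector of
    X at some point x0 with a Hessian (a second fundamental form) of maximal rank.
    The gradient is orthogonal to all velocities of y(u); this forces it to be
    tangent to X at x0 and to lie in the kernel of that Hessian.  Where the rank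
    of a linear family of symmetric forms is maximal, the kernel is isotropic for
    the whole family ([kernel_isotropic]); for the Hessians of X, an isotropic
    vector has at most one component off x0 ([isotropic_support]), which means
    that the tangent vector has rank one.

    So the data locus lies in the Zariski closure of the tensors of rank at most
    two, and (b) amounts to the fact that this closure consists of limits of such
    tensors ([zclosure_rank_le2_border]).  On the closure, the 3 by 3 minors of
    all the flattenings vanish.  If moreover the 2 by 2 minors in any two slots
    vanish, then the tensor has rank one ([two_slot_minors_pure]).  Otherwise a
    nonzero minor, used as a pivot, writes the tensor as a row, times a product of
    2 by 2 matrices, one for each of the other slots, times a column
    ([tensor_train]).  These matrices commute, so they all belong to the algebra
    generated by one matrix Z of trace zero.  If Z is diagonalizable, its two
    eigenvalues give the two rank one terms; if not, then Z is a limit of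
    diagonalizable matrices.

    Regular points are defined by transcendence degrees, so the first step needs
    some dimension theory: N + 1 polynomials in N variables are algebraically
    dependent ([alg_dependent_mpoly]), and differentiating algebraic relations
    compares a transcendence basis with the tangent space
    ([transcendence_basis_diff]). *)

(** * Polynomials along a line *)

Section MPolyEval.
Variable K : numFieldType.

Lemma mpoly_alg_ind n (Q : mpoly n K -> Prop) :
    (forall c, Q (mpolyC n c)) -> (forall i, Q (mpolyX K (mnm1 i))) ->
    (forall p q, Q p -> Q q -> Q (p + q)) ->
    (forall p q, Q p -> Q q -> Q (p * q)) ->
  forall p, Q p.
Proof.
move=> QC QX QD QM; apply: mpolyind => [|c m p _ _ Qp].
  by rewrite -mpolyC0; apply: (QC).
apply: (QD) Qp; rewrite -mul_mpolyC; apply: (QM); first exact: (QC).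
rewrite mpolyXE_id; apply: (big_ind Q) => [||i _].
- by rewrite -mpolyC1; apply: (QC).
- exact: (QM).
- elim: (m i) => [|k IHk]; first by rewrite expr0 -mpolyC1; apply: QC.
  by rewrite exprS; apply: QM.
Qed.

(** The chain rule along a polynomial curve.  It is the only link between formal
    partial derivatives and values: all further derivatives are taken in one
    variable. *)
Lemma meval_curve n (P : mpoly n K) (c : 'I_n -> {poly K}) :
  exists p : {poly K}, forall t,
    p.[t] = meval (fun k => (c k).[t]) P /\
    p^`().[t] = \sum_k meval (fun k => (c k).[t]) (mderiv k P) * (c k)^`().[t].
Proof.
elim/mpoly_alg_ind: P => [a|i|P Q [p Hp] [q Hq]|P Q [p Hp] [q Hq]].
- exists a%:P => t; rewrite hornerC mevalC derivC horner0 big1 // => k _.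
  by rewrite mderivC meval0 mul0r.
- exists (c i) => t; rewrite mevalXU (bigD1 i) //= mderivX big1 ?addr0 => [|k ki].
    rewrite mnmE eqxx scale1r; split=> //.
    suff ->: mnm_sub (mnm1 i) (mnm1 i) = @mnm0 n by rewrite mpolyX0 meval1 mul1r.
    by apply/mnmP => j; rewrite mnmE mnm0E subnn.
  by rewrite mderivX mnmE eq_sym (negPf ki) scale0r meval0 mul0r.
- exists (p + q) => t; rewrite hornerD derivD hornerD mevalD.
  rewrite (Hp t).1 (Hp t).2 (Hq t).1 (Hq t).2 -big_split; split=> //=.
  by apply: eq_bigr => k _; rewrite mderivD mevalD mulrDl.
- exists (p * q) => t; rewrite hornerM derivM hornerD !hornerM mevalM.
  rewrite (Hp t).1 (Hp t).2 (Hq t).1 (Hq t).2; split=> //.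
  rewrite mulr_suml mulr_sumr -big_split /=; apply: eq_bigr => k _.
  by rewrite mderivM mevalD !mevalM; ring.
Qed.

Lemma poly_eq0_all (p : {poly K}) : (forall t, p.[t] = 0) -> p = 0.
Proof.
move=> p0; apply/eqP; apply: contraT => nzp.
have := max_poly_roots nzp (rs := [seq i%:R | i <- iota 0 (size p)]).
rewrite size_map size_iota ltnn => -> //.
  by apply/allP => x _; rewrite /root p0.
by rewrite map_inj_uniq ?iota_uniq // => i j /eqP; rewrite eqr_nat => /eqP.
Qed.

Lemma poly_eq_all (p q : {poly K}) : (forall t, p.[t] = q.[t]) -> p = q.
Proof.
move=> pq; apply/eqP; rewrite -subr_eq0; apply/eqP/poly_eq0_all => t.
by rewrite hornerD hornerN pq subrr.
Qed.

(** Differentiating along the coordinate axes brings every coefficient down to a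
    constant term, up to a nonzero integer factor. *)
Lemma meval_eq0 n (P : mpoly n K) : (forall v, meval v P = 0) -> P = 0.
Proof.
suff H : forall d m (P : mpoly n K), mdeg m = d -> (forall v, meval v P = 0) ->
    mcoeff m P = 0.
  by move=> P0; apply/mpolyP => m; rewrite mcoeff0 (H _ _ _ erefl P0).
elim=> [|d IHd] m {}P.
  move/eqP; rewrite mdeg_eq0 => /eqP -> P0; rewrite -[RHS](P0 (fun=> 0)).
  rewrite mevalE (eq_bigr (fun m => if m == @mnm0 n then mcoeff (@mnm0 n) P else 0)).
    rewrite -big_mkcond /=; case: (boolP (@mnm0 n \in msupp P)) => [P0in|P0n].
      by rewrite -big_filter filter_pred1_uniq ?msupp_uniq // big_seq1.
    rewrite (memN_msupp_eq0 P0n) big1_seq // => i /andP[/eqP -> iP].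
  move=> i _; case: eqP => [->|/eqP ni0].
    by rewrite big1 ?mulr1 // => k _; rewrite mnm0E expr0.
  have [k ki] : exists k, i k != 0%N.
    apply/existsP; rewrite -negb_forall; apply: contra ni0 => /forallP h.
    by apply/eqP/mnmP => k; rewrite mnm0E; apply/eqP/h.
  by rewrite (bigD1 k) //= expr0n (negPf ki) mul0r mulr0.
move=> dm P0; have [k km] : exists k, m k != 0%N.
  apply/existsP; rewrite -negb_forall; apply/negP => /forallP h.
  suff m0 : m = @mnm0 n by rewrite m0 mdeg0 in dm.
  by apply/mnmP => k; rewrite mnm0E; apply/eqP/h.
have mE : m = mnm_add (mnm_sub m (mnm1 k)) (mnm1 k).
  apply/mnmP => j; rewrite !mnmE; case: (eqVneq k j) => [<-|_].
    by rewrite subnK // lt0n.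
  by rewrite subn0 addn0.
have : mcoeff (mnm_sub m (mnm1 k)) (mderiv k P) = 0.
  apply: IHd.
    have := congr1 (@mdeg n) mE; rewrite mdegD mdeg1 dm addn1.
    by case.
  move=> v; have [p Hp] := meval_curve P (fun j => (v j)%:P + (j == k)%:R *: 'X).
  have p0 : p = 0 by apply: poly_eq0_all => t; rewrite (Hp t).1 P0.
  have [_] := Hp 0; rewrite p0 deriv0 horner0 (bigD1 k) //= big1 => [|j jk].
    rewrite addr0 eqxx scale1r derivD derivC add0r derivX hornerC mulr1 => ->.
    by apply: meval_eq => j; rewrite hornerD hornerZ hornerC hornerX mulr0 addr0.
  by rewrite (negPf jk) scale0r addr0 derivC horner0 mulr0.
rewrite mcoeff_mderiv -mE => /eqP; rewrite mulrn_eq0 /= => /eqP.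
by [].
Qed.

End MPolyEval.
Section PolynomialMaps.
Variable K : numFieldType.
Implicit Types U W : vectType K.

Local Notation basis W := (vbasis (fullv : {vspace W})).

Lemma coord_sum W (w : W) : w = \sum_k coord (basis W) k w *: (basis W)`_k.
Proof. exact: coord_vbasis (memvf w). Qed.

Lemma coord_basisE W (w : W) (c : 'I_(\dim {:W}) -> K) :
  w = \sum_k c k *: (basis W)`_k -> forall k, coord (basis W) k w = c k.
Proof.
by move=> -> k; rewrite coord_sum_free // (basis_free (vbasisP _)).
Qed.

Definition polynomial_fun W (f : W -> K) : Prop :=
  exists P : polyfun W, forall w, f w = peval P w.

Lemma polynomial_peval W (P : polyfun W) : polynomial_fun (peval P).
Proof. by exists P. Qed.

Lemma polynomial_ext W (f g : W -> K) :
  f =1 g -> polynomial_fun f -> polynomial_fun g.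
Proof. by move=> fg [P fP]; exists P => w; rewrite -fg. Qed.

Lemma polynomial_cst W (c : K) : polynomial_fun (fun _ : W => c).
Proof. by exists (mpolyC _ c) => w; rewrite /peval mevalC. Qed.

Lemma polynomialD W (f g : W -> K) :
  polynomial_fun f -> polynomial_fun g -> polynomial_fun (fun w => f w + g w).
Proof.
by move=> [P fP] [Q gQ]; exists (P + Q) => w; rewrite /peval mevalD fP gQ.
Qed.

Lemma polynomialM W (f g : W -> K) :
  polynomial_fun f -> polynomial_fun g -> polynomial_fun (fun w => f w * g w).
Proof.
by move=> [P fP] [Q gQ]; exists (P * Q) => w; rewrite /peval mevalM fP gQ.
Qed.

Lemma polynomialN W (f : W -> K) :
  polynomial_fun f -> polynomial_fun (fun w => - f w).
Proof. by move=> [P fP]; exists (- P) => w; rewrite /peval mevalN fP. Qed.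

Lemma polynomialB W (f g : W -> K) :
  polynomial_fun f -> polynomial_fun g -> polynomial_fun (fun w => f w - g w).
Proof. by move=> Pf Pg; apply: polynomialD => //; apply: polynomialN. Qed.

Lemma polynomial_sum W (I : Type) (r : seq I) (p : pred I) (F : I -> W -> K) :
  (forall i, p i -> polynomial_fun (F i)) ->
  polynomial_fun (fun w => \sum_(i <- r | p i) F i w).
Proof.
move=> PF; elim: r => [|i r IHr].
  by apply: polynomial_ext (polynomial_cst W 0) => w; rewrite big_nil.
case pi: (p i).
  by apply: polynomial_ext (polynomialD (PF i pi) IHr) => w; rewrite big_cons pi.
by apply: polynomial_ext IHr => w; rewrite big_cons pi.
Qed.

Lemma polynomial_prod W (I : Type) (r : seq I) (p : pred I) (F : I -> W -> K) :
  (forall i, p i -> polynomial_fun (F i)) ->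
  polynomial_fun (fun w => \prod_(i <- r | p i) F i w).
Proof.
move=> PF; elim: r => [|i r IHr].
  by apply: polynomial_ext (polynomial_cst W 1) => w; rewrite big_nil.
case pi: (p i).
  by apply: polynomial_ext (polynomialM (PF i pi) IHr) => w; rewrite big_cons pi.
by apply: polynomial_ext IHr => w; rewrite big_cons pi.
Qed.

Lemma polynomial_coord W k : polynomial_fun (coord (basis W) k).
Proof. by exists (mpolyX K (mnm1 k)) => w; rewrite /peval mevalXU. Qed.

Lemma polynomial_linear W (f : W -> K) :
  (forall c x y, f (c *: x + y) = c * f x + f y) -> polynomial_fun f.
Proof.
move=> flin; have f0 : f 0 = 0.
  by have := flin 1 0 0; rewrite scaler0 addr0 mul1r => /(canLR (addrK _));
    rewrite subrr => <-.
apply: (@polynomial_ext _ (fun w => \sum_k coord (basis W) k w * f (basis W)`_k)).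
  move=> w; rewrite [in RHS](coord_sum w).
  elim/big_rec2: _ => [|k y1 y2 _ ->]; first by rewrite f0.
  by rewrite flin.
apply: polynomial_sum => k _; apply: polynomialM (polynomial_cst _ _).
exact: polynomial_coord.
Qed.

Lemma polynomial_det W m (M : W -> 'M[K]_m) :
  (forall i j, polynomial_fun (fun w => M w i j)) ->
  polynomial_fun (fun w => \det (M w)).
Proof.
move=> PM; rewrite /determinant; apply: polynomial_sum => s _.
by apply: polynomialM (polynomial_cst _ _) _; apply: polynomial_prod.
Qed.

Definition polynomial_map U W (psi : U -> W) : Prop :=
  forall k, polynomial_fun (fun u => coord (basis W) k (psi u)).

Lemma polynomial_comp U W (psi : U -> W) (f : W -> K) :
  polynomial_map psi -> polynomial_fun f -> polynomial_fun (f \o psi).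
Proof.
move=> Ppsi [P fP]; apply: (@polynomial_ext _ (fun u => peval P (psi u))).
  by move=> u; rewrite /= fP.
rewrite /peval; elim/mpoly_alg_ind: P {fP} => [c|i|P Q|P Q].
- by apply: polynomial_ext (polynomial_cst _ c) => u; rewrite mevalC.
- by apply: polynomial_ext (Ppsi i) => u; rewrite mevalXU.
- by move=> HP HQ; apply: polynomial_ext (polynomialD HP HQ) => u; rewrite mevalD.
- by move=> HP HQ; apply: polynomial_ext (polynomialM HP HQ) => u; rewrite mevalM.
Qed.

Lemma polynomial_map_comp U W W' (psi : U -> W) (phi : W -> W') :
  polynomial_map psi -> polynomial_map phi -> polynomial_map (phi \o psi).
Proof. by move=> Ppsi Pphi k; apply: polynomial_comp (Pphi k). Qed.

Lemma polynomial_map_id U : polynomial_map (@id U).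
Proof. by move=> k; apply: polynomial_coord. Qed.

Lemma polynomial_map_linear U W (f : U -> W) : linear f -> polynomial_map f.
Proof.
by move=> flin k; apply: polynomial_linear => c x y; rewrite flin linearP.
Qed.

(** Being polynomial may be tested in the coefficients on any finite family of
    vectors, such as the unit vectors of a space of finite functions. *)
Lemma polynomial_map_span U W (I : finType) (c : I -> U -> K) (b : I -> W) :
  (forall i, polynomial_fun (c i)) ->
  polynomial_map (fun u => \sum_i c i u *: b i).
Proof.
move=> Pc k; apply: (@polynomial_ext _ (fun u =>
  \sum_i c i u * coord (basis W) k (b i))).
  move=> u; rewrite linear_sum; apply: eq_bigr => i _.
  by rewrite linearZ.
by apply: polynomial_sum => i _; apply: polynomialM (polynomial_cst _ _).
Qed.

Lemma polynomial_map_ffun U (I : finType) (psi : U -> {ffun I -> K^o}) :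
  (forall i, polynomial_fun (fun u => psi u i : K)) -> polynomial_map psi.
Proof.
move=> Ppsi k; have := polynomial_map_span
  (fun i => [ffun j => (j == i)%:R] : {ffun I -> K^o}) Ppsi k.
apply: polynomial_ext => u; congr coord; apply/ffunP => j.
rewrite sum_ffunE (bigD1 j) //= big1 => [|i ij].
  by rewrite !ffunE eqxx addr0 [_ *: _]mulr1.
by rewrite !ffunE eq_sym (negPf ij) [_ *: _]mulr0.
Qed.

Lemma polynomial_map_pair U W1 W2 (f : U -> W1) (g : U -> W2) :
  polynomial_map f -> polynomial_map g ->
  polynomial_map (fun u => (f u, g u) : W1 * W2).
Proof.
move=> Pf Pg k.
apply: (@polynomial_ext _ (fun u => coord (basis _) k (f u, 0 : W2) +
   coord (basis _) k (0 : W1, g u))).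
  by move=> u; rewrite -linearD; congr coord; congr pair; rewrite /= ?addr0 ?add0r.
apply: polynomialD.
  apply: (polynomial_comp (f := fun w => coord (basis _) k (w, 0 : W2)) Pf).
  apply: polynomial_linear => c x y; rewrite -[RHS]linearP; congr coord.
  by congr pair; rewrite /= scaler0 addr0.
apply: (polynomial_comp (f := fun w => coord (basis _) k (0 : W1, w)) Pg).
apply: polynomial_linear => c x y; rewrite -[RHS]linearP; congr coord.
by congr pair; rewrite /= scaler0 addr0.
Qed.

(** ** Derivatives *)

(** Derivatives are taken of functions that are known to be polynomial, without
    a chosen expression: d is then determined by the values of f. *)
Definition has_dpath (f : K -> K) (d : K) : Prop :=
  exists p : {poly K}, (forall t, f t = p.[t]) /\ p^`().[0] = d.

Lemma has_dpath_ext f g d : f =1 g -> has_dpath f d -> has_dpath g d.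
Proof. by move=> fg [p [fp pairing]]; exists p; split=> // t; rewrite -fg. Qed.

Lemma has_dpath_uniq f d e : has_dpath f d -> has_dpath f e -> d = e.
Proof.
move=> [p [fp <-]] [q [fq <-]]; suff -> : p = q by [].
by apply: poly_eq_all => t; rewrite -fp fq.
Qed.

Lemma has_dpath_affine a b : has_dpath (fun t => a + t * b) b.
Proof.
exists (a%:P + b *: 'X); split=> [t|].
  by rewrite hornerD hornerC hornerZ hornerX mulrC.
by rewrite derivD derivC add0r derivZ derivX hornerZ hornerC mulr1.
Qed.

Definition has_dcurve W (gamma : K -> W) (w : W) : Prop :=
  forall k, has_dpath (fun t => coord (basis W) k (gamma t)) (coord (basis W) k w).

Lemma has_dcurve_line W (u v : W) : has_dcurve (fun t => u + t *: v) v.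
Proof.
move=> k; apply: has_dpath_ext (has_dpath_affine (coord (basis W) k u) _) => t.
by rewrite linearD linearZ.
Qed.

Lemma has_dpath_curve W (gamma : K -> W) w (P : polyfun W) :
  has_dcurve gamma w ->
  has_dpath (fun t => peval P (gamma t)) (pdiff P (gamma 0) w).
Proof.
move=> /choice[c Hc]; have [p Hp] := meval_curve P c; exists p; split=> [t|].
  by rewrite (Hp t).1; apply: meval_eq => k; rewrite (Hc k).1.
rewrite (Hp 0).2; apply: eq_bigr => k _; rewrite (Hc k).2; congr (_ * _).
by apply: meval_eq => j; rewrite (Hc j).1.
Qed.

Lemma has_dpath_line W (u v : W) (P : polyfun W) :
  has_dpath (fun t => peval P (u + t *: v)) (pdiff P u v).
Proof.
by have := has_dpath_curve P (has_dcurve_line u v); rewrite scale0r addr0.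
Qed.

Lemma pdiffP W (P : polyfun W) (u : W) c v w :
  pdiff P u (c *: v + w) = c * pdiff P u v + pdiff P u w.
Proof.
rewrite /pdiff mulr_sumr -big_split; apply: eq_bigr => k _ /=.
by rewrite linearP mulrDr mulrCA.
Qed.

Lemma pdiffD W (P Q : polyfun W) (u v : W) :
  pdiff (P + Q) u v = pdiff P u v + pdiff Q u v.
Proof.
rewrite /pdiff -big_split; apply: eq_bigr => k _ /=.
by rewrite mderivD /peval mevalD mulrDl.
Qed.

Lemma pdiffZ W c (P : polyfun W) (u v : W) :
  pdiff (c *: P) u v = c * pdiff P u v.
Proof.
rewrite /pdiff mulr_sumr; apply: eq_bigr => k _.
by rewrite mderivZ /peval mevalZ mulrA.
Qed.

Lemma pdiff0 W (u v : W) : pdiff (0 : polyfun W) u v = 0.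
Proof. by rewrite -[0](scale0r (0 : polyfun W)) pdiffZ mul0r. Qed.

Lemma pdiff_eq0 W (P : polyfun W) (u v : W) :
  (forall t, peval P (u + t *: v) = 0) -> pdiff P u v = 0.
Proof.
move=> P0; apply: has_dpath_uniq (has_dpath_line u v P) _.
by exists 0; rewrite deriv0 horner0; split=> // t; rewrite P0 horner0.
Qed.

Lemma polynomial_pdiff W (P : polyfun W) (v : W) :
  polynomial_fun (fun u => pdiff P u v).
Proof.
apply: polynomial_sum => k _; apply: polynomialM (polynomial_cst _ _).
exact: polynomial_peval.
Qed.

Lemma polynomial_diff U W (psi : U -> W) : polynomial_map psi ->
  exists D : U -> 'Hom(U, W),
    forall u v, has_dcurve (fun t => psi (u + t *: v)) (D u v).
Proof.
move=> /choice[P HP].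
have Dlin u : linear (fun v => \sum_k pdiff (P k) u v *: (basis W)`_k).
  move=> c v w; rewrite scaler_sumr -big_split; apply: eq_bigr => k _ /=.
  by rewrite pdiffP scalerDl scalerA.
pose D u : {linear U -> W} := HB.pack_for {linear U -> W}
  (fun v => \sum_k pdiff (P k) u v *: (basis W)`_k)
  (GRing.isLinear.Build _ _ _ _ _ (Dlin u)).
exists (fun u => linfun (D u)) => u v k.
apply: has_dpath_ext (fun t => esym (HP k (u + t *: v))) _.
by rewrite lfunE /= (coord_basisE (erefl _)); apply: has_dpath_line.
Qed.

End PolynomialMaps.
(** * Zariski closure *)

Section ZariskiClosure.
Variable K : numFieldType.
Implicit Types U W : vectType K.

Lemma zclosure_sub W (A : set W) : A `<=` zclosure A.
Proof. by move=> w Aw P; apply. Qed.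

Lemma zclosure_mono W (A B : set W) : A `<=` B -> zclosure A `<=` zclosure B.
Proof. by move=> AB w Aw P PB; apply: Aw => v /AB; apply: PB. Qed.

Lemma zclosure_fun W (A : set W) (f : W -> K) : polynomial_fun f ->
  (forall w, A w -> f w = 0) -> forall w, zclosure A w -> f w = 0.
Proof.
by move=> [P fP] f0 w Aw; rewrite fP; apply: Aw => v Av; rewrite -fP f0.
Qed.

Lemma zclosure_map U W (psi : U -> W) (A : set U) (B : set W) :
  polynomial_map psi -> (forall u, A u -> zclosure B (psi u)) ->
  forall u, zclosure A u -> zclosure B (psi u).
Proof.
move=> Ppsi AB u Au P PB.
have := zclosure_fun (polynomial_comp Ppsi (polynomial_peval P)) _ Au; apply.
by move=> v /AB; apply.
Qed.

Lemma zclosureK W (A : set W) : zclosure (zclosure A) = zclosure A.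
Proof.
apply/seteqP; split; last exact: zclosure_sub.
by apply: (zclosure_map (@polynomial_map_id K W)).
Qed.

Lemma polynomial_line U (f : U -> K) (u v : U) : polynomial_fun f ->
  exists p : {poly K}, forall t, f (u + t *: v) = p.[t].
Proof.
move=> [P fP]; have [p [Hp _]] := has_dpath_line u v P.
by exists p => t; rewrite fP.
Qed.

(** Two nonempty open sets meet: on the line joining a point of one to a point
    of the other, both polynomials are nonzero. *)
Lemma generic_meet U (f g : U -> K) u v :
  polynomial_fun f -> polynomial_fun g -> f u != 0 -> g v != 0 ->
  exists w, f w * g w != 0.
Proof.
move=> Pf Pg fu gv; apply: contrapT => fg0.
have [p Hp] := polynomial_line u (v - u) Pf.
have [q Hq] := polynomial_line u (v - u) Pg.
have : p * q = 0.
  apply: poly_eq0_all => t; rewrite hornerM -Hp -Hq.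
  by apply/eqP; apply: contraT => h; case: fg0; exists (u + t *: (v - u)).
move/eqP; rewrite mulf_eq0 => /orP[] /eqP p0.
  by move: fu; rewrite -[u]addr0 -(scale0r (v - u)) Hp p0 horner0 eqxx.
by move: gv; rewrite -(subrK u v) addrC -[v - u]scale1r Hq p0 horner0 eqxx.
Qed.

Lemma generic_prod U (I : finType) (f : I -> U -> K) :
  (forall i, polynomial_fun (f i)) -> (forall i, exists u, f i u != 0) ->
  exists u, forall i, f i u != 0.
Proof.
move=> Pf fn0.
suff [u Hu] : exists u, \prod_i f i u != 0.
  by exists u => i; move: Hu; rewrite (bigD1 i) //= mulf_eq0 negb_or => /andP[].
elim: (index_enum I) => [|i r [v Hv]].
  by exists 0; rewrite big_nil oner_eq0.
have [u Hu] := fn0 i.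
have Pr : polynomial_fun (fun w => \prod_(j <- r) f j w).
  by apply: polynomial_prod => j _; apply: Pf.
by have [w Hw] := generic_meet (Pf i) Pr Hu Hv; exists w; rewrite big_cons.
Qed.

(** A closed condition that holds at the generic parameter holds everywhere. *)
Lemma generic_closure U W (phi : U -> W) (q : U -> K) (C : set W) u0 :
  polynomial_map phi -> polynomial_fun q -> q u0 != 0 ->
  (forall u, q u != 0 -> zclosure C (phi u)) -> forall u, zclosure C (phi u).
Proof.
move=> Pphi Pq q0 qC u P PC; apply/eqP; apply: contraT => Pu.
have [w] := generic_meet Pq (polynomial_comp Pphi (polynomial_peval P)) q0 Pu.
by rewrite mulf_eq0 negb_or => /andP[/qC/(_ P PC) /= -> /eqP].
Qed.

Lemma zclosed_closure W (A : set W) : zclosed (zclosure A).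
Proof. exact: zclosureK. Qed.

(** The parameter space is irreducible by [generic_meet]. *)
Lemma zirreducible_range U W (psi : U -> W) : polynomial_map psi ->
  zirreducible (zclosure (range psi)).
Proof.
move=> Ppsi; split=> [|A B zA zB sub].
  by exists (psi 0); apply: zclosure_sub; exists 0.
apply: contrapT => /not_orP[nA nB].
have out C : zclosed C -> ~ zclosure (range psi) `<=` C ->
    exists P u, vanishing_ideal C P /\ peval P (psi u) != 0.
  move=> zC; apply: contra_notP => H w wY; rewrite -zC => P PC; apply: wY.
  move=> _ [u _ <-]; apply/eqP; apply: contraT => Pu.
  by case: H; exists P, u.
have [P [u [PA Pu]]] := out A zA nA; have [Q [v [QB Qv]]] := out B zB nB.
have [w] := generic_meet (polynomial_comp Ppsi (polynomial_peval P))
  (polynomial_comp Ppsi (polynomial_peval Q)) Pu Qv.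
rewrite /= mulf_eq0 negb_or => /andP[Pw Qw].
have [/PA/eqP|/QB/eqP] : (A `|` B) (psi w).
- by apply: sub; apply: zclosure_sub; exists w.
- by rewrite (negPf Pw).
- by rewrite (negPf Qw).
Qed.

End ZariskiClosure.

(** * Algebraic independence *)

(** ** A polynomial ring in N variables has transcendence degree N *)

Section Counting.
Variables (K : numFieldType) (N : nat).
Implicit Types (g : ('I_N -> K) -> K) (v : 'I_N -> K).

Definition set_var v k t : 'I_N -> K := fun j => if j == k then t else v j.

(** The degree is bounded in each variable separately; this is what decides about
    vanishing on a grid. *)
Definition degree_le d g : Prop :=
  forall v k, exists p : {poly K}, (size p <= d.+1)%N /\
    forall t, g (set_var v k t) = p.[t].

Lemma degree_le_cst d c : degree_le d (fun=> c).
Proof.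
move=> v k; exists c%:P; split=> [|t]; last by rewrite hornerC.
by apply: leq_trans (size_polyC_leq1 _) _.
Qed.

Lemma degree_le_mono d e g : (d <= e)%N -> degree_le d g -> degree_le e g.
Proof.
move=> de gd v k; have [p [sp Hp]] := gd v k; exists p; split=> //.
exact: leq_trans sp _.
Qed.

Lemma degree_leD d g h :
  degree_le d g -> degree_le d h -> degree_le d (fun v => g v + h v).
Proof.
move=> gd hd v k; have [p [sp Hp]] := gd v k; have [q [sq Hq]] := hd v k.
exists (p + q); split=> [|t]; last by rewrite hornerD Hp Hq.
by apply: leq_trans (size_polyD _ _) _; rewrite geq_max sp.
Qed.

Lemma degree_leM d e g h :
  degree_le d g -> degree_le e h -> degree_le (d + e) (fun v => g v * h v).
Proof.
move=> gd hd v k; have [p [sp Hp]] := gd v k; have [q [sq Hq]] := hd v k.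
exists (p * q); split=> [|t]; last by rewrite hornerM Hp Hq.
apply: leq_trans (size_polyMleq _ _) _.
by rewrite -subn1 leq_subLR; apply: leq_trans (leq_add sp sq) _;
  rewrite addSn addnS add1n.
Qed.

Lemma degree_le_ext d g h : g =1 h -> degree_le d g -> degree_le d h.
Proof.
move=> gh gd v k; have [p [sp Hp]] := gd v k; exists p; split=> // t.
by rewrite -gh.
Qed.

Lemma degree_le_sum (I : Type) (r : seq I) d (F : I -> ('I_N -> K) -> K) :
  (forall i, degree_le d (F i)) -> degree_le d (fun v => \sum_(i <- r) F i v).
Proof.
move=> Fd; elim: r => [|i r IHr].
  by apply: degree_le_ext (degree_le_cst _ 0) => v; rewrite big_nil.
by apply: degree_le_ext (degree_leD (Fd i) IHr) => v; rewrite big_cons.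
Qed.

Lemma degree_le_prod (I : Type) (r : seq I) d (F : I -> ('I_N -> K) -> K) :
  (forall i, degree_le d (F i)) ->
  degree_le (size r * d) (fun v => \prod_(i <- r) F i v).
Proof.
move=> Fd; elim: r => [|i r IHr].
  by apply: degree_le_ext (degree_le_cst _ 1) => v; rewrite big_nil.
by apply: degree_le_ext (degree_leM (Fd i) IHr) => v; rewrite big_cons.
Qed.

Lemma degree_leX d n g : degree_le d g -> degree_le (n * d) (fun v => g v ^+ n).
Proof.
move=> gd; elim: n => [|n IHn]; first exact: degree_le_cst.
by apply: degree_le_ext (degree_leM gd IHn) => v; rewrite exprS.
Qed.

Lemma degree_le_meval (P : mpoly N K) : exists d, degree_le d (fun v => meval v P).
Proof.
elim/mpoly_alg_ind: P => [c|i|P Q [d Pd] [e Qe]|P Q [d Pd] [e Qe]].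
- by exists 0; apply: degree_le_ext (degree_le_cst _ c) => v; rewrite mevalC.
- exists 1%N => v k; exists (if i == k then 'X else (v i)%:P); split=> [|t].
    case: ifP => _; first by rewrite size_polyX.
    exact: leq_trans (size_polyC_leq1 _) _.
  by rewrite mevalXU /set_var; case: ifP => _; rewrite ?hornerX ?hornerC.
- exists (maxn d e); apply: degree_le_ext (degree_leD
    (degree_le_mono (leq_maxl _ _) Pd) (degree_le_mono (leq_maxr _ _) Qe)) => v.
  by rewrite mevalD.
- by exists (d + e)%N; apply: degree_le_ext (degree_leM Pd Qe) => v; rewrite mevalM.
Qed.

(** The coordinates are freed from the grid one by one, by counting roots. *)
Lemma grid_eq0 d g : degree_le d g ->
  (forall a : {ffun 'I_N -> 'I_d.+1}, g (fun k => (a k)%:R) = 0) ->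
  forall v, g v = 0.
Proof.
move=> gd g0; suff H : forall m, (m <= N)%N -> forall v,
    (forall k : 'I_N, (m <= k)%N -> exists i : 'I_d.+1, v k = i%:R) -> g v = 0.
  by move=> v; apply: (H N) => // k; rewrite leqNgt ltn_ord.
elim=> [_ v vg|m IHm mN v vg].
  have /choice[a Ha] : forall k, exists i : 'I_d.+1, v k = i%:R by move=> k; apply: vg.
  rewrite -(g0 (finfun a)); congr g; apply: funext => k.
  by rewrite ffunE Ha.
have [p [sp Hp]] := gd v (Ordinal mN).
have vE : set_var v (Ordinal mN) (v (Ordinal mN)) = v.
  by apply: funext => k; rewrite /set_var; case: eqP => // ->.
suff p0 : p = 0 by rewrite -vE Hp p0 horner0.
apply/eqP; apply: contraT => nzp.
have := max_poly_roots nzp (rs := [seq i%:R | i <- iota 0 d.+1]).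
rewrite size_map size_iota ltnNge sp => H; apply: H; last first.
  by rewrite map_inj_uniq ?iota_uniq // => i j /eqP; rewrite eqr_nat => /eqP.
apply/allP => _ /mapP[i + ->]; rewrite mem_iota add0n => /= id.
apply/eqP; rewrite -Hp; apply: IHm => [|k mk]; first exact: ltnW.
rewrite /set_var; case: eqP => [_|/eqP kN]; first by exists (Ordinal id).
by apply: vg; rewrite ltn_neqAle mk andbT eq_sym; apply: contra kN.
Qed.

(** The monomials of degree less than k in each of m > N polynomials span, for k
    large, a space of dimension smaller than their number k ^ m: its elements
    have degree O(k) in each variable, so they are known from their values on a
    grid of O(k ^ N) points. *)
Lemma alg_dependent_mpoly m (f : 'I_m -> mpoly N K) : (N < m)%N ->
  exists2 Q : mpoly m K, Q != 0 &
    forall v, meval (fun j => meval v (f j)) Q = 0.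
Proof.
move=> Nm; have /choice[e He] := fun j => degree_le_meval (f j).
pose D := \max_j e j.
have HD j : degree_le D (fun v => meval v (f j)).
  by apply: degree_le_mono (He j); apply: leq_bigmax.
(* k exceeds (m D + 1) ^ N, so that (m k D + 1) ^ N <= (m D + 1) ^ N k ^ N is
   less than k ^ (N + 1) <= k ^ m *)
pose k := ((m * D).+1 ^ N).+1; pose d := (m * (k * D))%N.
pose mono (a : {ffun 'I_m -> 'I_k}) : multinom m :=
  Multinom (mktuple (fun j => a j : nat)).
pose val (a : {ffun 'I_m -> 'I_k}) v := \prod_j meval v (f j) ^+ a j.
have vald a : degree_le d (val a).
  rewrite /d -[m in (m * _)%N](size_enum_ord m) enumT.
  apply: degree_le_prod => j; apply: degree_le_mono (degree_leX _ (HD j)).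
  by rewrite leq_mul2r ltnW ?orbT.
pose A := {ffun 'I_m -> 'I_k}; pose G := {ffun 'I_N -> 'I_d.+1}.
pose M : 'M[K]_(#|A|, #|G|) := \matrix_(i, j)
  val (enum_val i) (fun l => ((enum_val j : G) l)%:R).
have card_lt : (#|G| < #|A|)%N.
  rewrite !card_ffun !card_ord; apply: (@leq_ltn_trans ((k * (m * D).+1) ^ N)).
    case: (N) => [|N']; rewrite ?expn0 // leq_exp2r //.
    by rewrite /d mulnCA mulnS addnC -addn1 leq_add2l.
  rewrite expnMn (@leq_trans (k ^ N.+1)) //; last by rewrite leq_pexp2l.
  by rewrite expnSr ltn_pmul2l // expn_gt0.
have kerM : kermx M != 0.
  rewrite -mxrank_eq0 mxrank_ker subn_eq0 -ltnNge.
  exact: leq_ltn_trans (rank_leq_col M) _.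
have [c /sub_kermxP cM cn0] := rowV0Pn kerM.
pose Q := \sum_i c 0 i *: mpolyX K (mono (enum_val i)).
have QE v : meval (fun j => meval v (f j)) Q =
    \sum_i c 0 i * val (enum_val i) v.
  rewrite /Q raddf_sum; apply: eq_bigr => i _; rewrite /= mevalZ mevalX.
  by congr (_ * _); apply: eq_bigr => j _; rewrite mnmE.
exists Q.
  have [i ci] : exists i, c 0 i != 0.
    apply/existsP; rewrite -negb_forall; apply: contra cn0 => /forallP c0.
    by apply/eqP/rowP => i; rewrite mxE; apply/eqP/c0.
  apply: contra ci => /eqP Q0; have := mcoeff0 K (mono (enum_val i)).
  rewrite -Q0 /Q raddf_sum (bigD1 i) //= mcoeffZ mcoeffX eqxx mulr1.
  rewrite big1 ?addr0 => [->//|j ji]; rewrite mcoeffZ mcoeffX.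
  case: eqP => [/mnmP mE|_]; rewrite ?mulr0 //; case/eqP: ji; apply: enum_val_inj.
  by apply/ffunP => l; apply: val_inj; have := mE l; rewrite !mnmE.
apply: (@grid_eq0 d) => [|a].
  apply: degree_le_ext (fun v => esym (QE v)) _; apply: degree_le_sum => i.
  exact: (degree_leM (degree_le_cst 0 (c 0 i)) (vald _)).
rewrite QE; transitivity ((c *m M) 0 (enum_rank (a : G))); last by rewrite cM mxE.
by rewrite mxE; apply: eq_bigr => i _; rewrite mxE enum_rankK.
Qed.

End Counting.
(** ** Transcendence bases and tangent spaces *)

Section TranscendenceBases.
Variable K : numFieldType.
Implicit Types U W : vectType K.

Definition adjoin (T : Type) d (f : 'I_d -> T) (g : T) : 'I_d.+1 -> T :=
  fun j => if unlift ord_max j is Some a then f a else g.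

Lemma adjoin_max T d (f : 'I_d -> T) g : adjoin f g ord_max = g.
Proof. by rewrite /adjoin unlift_none. Qed.

Lemma adjoin_lift T d (f : 'I_d -> T) g a : adjoin f g (lift ord_max a) = f a.
Proof. by rewrite /adjoin liftK. Qed.

Lemma adjoin_comp (T S : Type) (h : T -> S) d (f : 'I_d -> T) g :
  (fun j => h (adjoin f g j)) = adjoin (fun a => h (f a)) (h g).
Proof. by apply: funext => j; rewrite /adjoin; case: unliftP. Qed.

Lemma big_adjoin d (F : 'I_d.+1 -> K) :
  \sum_j F j = F ord_max + \sum_a F (lift ord_max a).
Proof.
rewrite big_ord_recr addrC; congr (_ + _); apply: eq_bigr => a _; congr F.
by apply: val_inj; rewrite /= /bump leqNgt ltn_ord.
Qed.

Lemma has_dpath_meval n (Q : mpoly n K) (c : 'I_n -> K -> K) d :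
  (forall j, has_dpath (c j) (d j)) ->
  has_dpath (fun t => meval (fun j => c j t) Q)
    (\sum_j meval (fun j => c j 0) (mderiv j Q) * d j).
Proof.
move=> /choice[p Hp]; have [q Hq] := meval_curve Q p; exists q; split=> [t|].
  by rewrite (Hq t).1; apply: meval_eq => j; rewrite (Hp j).1.
rewrite (Hq 0).2; apply: eq_bigr => j _; rewrite (Hp j).2; congr (_ * _).
by apply: meval_eq => i; rewrite (Hp i).1.
Qed.

Lemma poly_eq0_derivs (p : {poly K}) a : (forall s, (p^`(s)).[a] = 0) -> p = 0.
Proof.
move=> dp0; apply: poly_eq0_all => t.
have -> : t = a + (t - a) by rewrite addrC subrK.
rewrite nderiv_taylor; last exact: mulrC.
rewrite big1 // => i _; have := dp0 i; rewrite nderivn_def hornerMn => /eqP.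
by rewrite mulrn_eq0 -leqn0 leqNgt fact_gt0 => /eqP ->; rewrite mul0r.
Qed.

(** A relation Q satisfied by g over f can be chosen with a derivative in the
    last variable that does not vanish identically on Z: in the sequence of the
    iterated derivatives of Q in that variable take the last one before the first
    that does not vanish on Z.  If they all vanished, Taylor expansion would
    turn Q into a relation between the f alone. *)
Lemma separable_relation W (Z : set W) d (f : 'I_d -> polyfun W) g :
  alg_independent_on Z f -> ~ alg_independent_on Z (adjoin f g) ->
  exists Q : mpoly d.+1 K,
    (forall z, Z z -> meval (fun j => peval (adjoin f g j) z) Q = 0) /\
    exists2 z, Z z & meval (fun j => peval (adjoin f g j) z) (mderiv ord_max Q) != 0.
Proof.
move=> indf /existsNP[Q0 /not_implyP[Q0Z nz]]; apply: contrapT => noQ.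
have step Q : (forall z, Z z -> meval (fun j => peval (adjoin f g j) z) Q = 0) ->
    forall z, Z z -> meval (fun j => peval (adjoin f g j) z) (mderiv ord_max Q) = 0.
  move=> QZ z Zz; apply/eqP; apply: contraT => h; case: noQ.
  by exists Q; split=> //; exists z.
have iterZ s : forall z, Z z ->
    meval (fun j => peval (adjoin f g j) z) (iter s (mderiv ord_max) Q0) = 0.
  by elim: s => [//|s IHs] z Zz; apply: step.
have Q0line z t : Z z -> meval (adjoin (fun a => peval (f a) z) t) Q0 = 0.
  move=> Zz; pose c := adjoin (fun a => (peval (f a) z)%:P) 'X.
  have cE t' : (fun j => (c j).[t']) = adjoin (fun a => peval (f a) z) t'.
    rewrite /c (adjoin_comp (fun p : {poly K} => p.[t'])) hornerX.
    by congr adjoin; apply: funext => a; rewrite hornerC.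
  have dc j t' : (c j)^`().[t'] = (j == ord_max)%:R.
    case: (unliftP ord_max j) => [a ->|->]; rewrite /c ?adjoin_lift ?adjoin_max.
      by rewrite derivC horner0 eq_sym (negPf (neq_lift _ _)).
    by rewrite derivX hornerC eqxx.
  have [p Hp] : exists p : {poly K}, forall s t',
      (p^`(s)).[t'] = meval (fun j => (c j).[t']) (iter s (mderiv ord_max) Q0).
    have [p Hp] := meval_curve Q0 c; exists p => s.
    elim: s => [|s IHs] t'; first by rewrite (Hp t').1.
    have [q Hq] := meval_curve (iter s (mderiv ord_max) Q0) c.
    have -> : p^`(s.+1) = q^`().
      rewrite derivnS; congr deriv; apply: poly_eq_all => t2.
      by rewrite IHs (Hq t2).1.
    rewrite (Hq t').2 (bigD1 ord_max) //= dc eqxx mulr1 big1 ?addr0 // => j jm.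
    by rewrite dc (negPf jm) mulr0.
  have p0 : p = 0.
    apply: (@poly_eq0_derivs _ (peval g z)) => s; rewrite Hp cE -(iterZ s z Zz).
    by rewrite (adjoin_comp (fun P => peval P z)).
  by have := Hp 0 t; rewrite cE p0 linear0 horner0 => <-.
apply: nz; apply: meval_eq0 => v.
pose sub t : 'I_d.+1 -> mpoly d K :=
  adjoin (fun a => mpolyX K (mnm1 a)) (mpolyC d t).
have subE t w : meval w (comp_mpoly (mktuple (sub t)) Q0) = meval (adjoin w t) Q0.
  rewrite comp_mpoly_meval; apply: meval_eq => j; rewrite tnth_mktuple.
  by rewrite /sub /adjoin; case: unlift => [a|]; rewrite ?mevalXU ?mevalC.
have sub0 t : comp_mpoly (mktuple (sub t)) Q0 = 0.
  by apply: indf => z Zz; rewrite subE Q0line.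
have -> : v = adjoin (fun a => v (lift ord_max a)) (v ord_max).
  by apply: funext => j; rewrite /adjoin; case: unliftP => [a ->|->].
by rewrite -subE sub0 meval0.
Qed.

(** Differentiating a separable relation for each coordinate bounds the tangent
    space of Z by the number of elements of a transcendence basis f. *)
Lemma transcendence_basis_diff U W (psi : U -> W) d (f : 'I_d -> polyfun W) :
  let Z := zclosure (range psi) in polynomial_map psi ->
  alg_independent_on Z f -> (forall g, ~ alg_independent_on Z (adjoin f g)) ->
  exists q : U -> K, [/\ polynomial_fun q, exists u, q u != 0 &
    forall u, q u != 0 -> forall v, tangent_space Z (psi u) v ->
      (forall a, pdiff (f a) (psi u) v = 0) -> v = 0].
Proof.
move=> Z Ppsi indf maxf.
pose X k : polyfun W := mpolyX K (mnm1 k).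
have XE k w : peval (X k) w = coord (vbasis {:W}) k w by rewrite /peval mevalXU.
have /choice[Q HQ] : forall k, exists Q : mpoly d.+1 K,
    (forall z, Z z -> meval (fun j => peval (adjoin f (X k) j) z) Q = 0) /\
    exists2 z, Z z &
      meval (fun j => peval (adjoin f (X k) j) z) (mderiv ord_max Q) != 0.
  by move=> k; apply: separable_relation.
pose rel k (P : mpoly d.+1 K) : polyfun W := comp_mpoly (mktuple (adjoin f (X k))) P.
have relE k P w : peval (rel k P) w = meval (fun j => peval (adjoin f (X k) j) w) P.
  by rewrite /peval comp_mpoly_meval; apply: meval_eq => j; rewrite tnth_mktuple.
pose q k u := peval (rel k (mderiv ord_max (Q k))) (psi u).
have Pq k : polynomial_fun (q k).
  exact: (polynomial_comp Ppsi (polynomial_peval _)).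
have [u0 Hu0] : exists u, forall k, q k u != 0.
  apply: generic_prod => // k; have [_ [z Zz]] := HQ k; rewrite -relE => nz.
  apply: contrapT => q0; case/eqP: nz; apply: Zz => _ [u _ <-].
  by apply/eqP; apply: contraT => h; case: q0; exists u.
exists (fun u => \prod_k q k u); split.
- exact: polynomial_prod.
- by exists u0; apply/prodf_neq0 => k _; apply: Hu0.
move=> u /prodf_neq0 qu v Tv fv.
rewrite (coord_sum v) big1 // => k _; rewrite -[RHS](scale0r (vbasis {:W})`_k).
congr (_ *: _).
have relZ : vanishing_ideal Z (rel k (Q k)).
  by move=> z Zz; rewrite relE; apply: (HQ k).1.
have paths j := has_dpath_line (psi u) v (adjoin f (X k) j).
have := has_dpath_uniq (has_dpath_line (psi u) v (rel k (Q k)))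
  (has_dpath_ext (fun t => esym (relE k (Q k) _)) (has_dpath_meval (Q k) paths)).
rewrite (Tv _ relZ) big_adjoin adjoin_max big1 => [|a _]; last first.
  by rewrite adjoin_lift fv mulr0.
rewrite addr0 => /esym/eqP; rewrite mulf_eq0 => /orP[h|/eqP].
  have := qu k isT; rewrite /q relE => /eqP[]; apply/eqP.
  by move: h; rewrite scale0r addr0.
move=> <-; apply: has_dpath_uniq (has_dpath_line (psi u) v (X k)).
by have := has_dcurve_line (psi u) v k; apply: has_dpath_ext => t; rewrite XE.
Qed.

Lemma alg_independent0 W (Z : set W) (f : 'I_0 -> polyfun W) :
  Z !=set0 -> alg_independent_on Z f.
Proof.
move=> [z Zz] Q QZ; apply: meval_eq0 => v; rewrite -(QZ z Zz).
by apply: meval_eq => -[].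
Qed.

Lemma alg_independent_sub W (Y Z : set W) d (f : 'I_d -> polyfun W) :
  Z `<=` Y -> alg_independent_on Z f -> alg_independent_on Y f.
Proof. by move=> ZY indf Q QY; apply: indf => z /ZY; apply: QY. Qed.

Lemma alg_independent_bound U d (f : 'I_d -> polyfun U) :
  alg_independent_on [set: U] f -> (d <= \dim {:U})%N.
Proof.
move=> indf; rewrite leqNgt; apply/negP => /(alg_dependent_mpoly f)[Q nQ Q0].
by case/eqP: nQ; apply: indf => u _; apply: Q0.
Qed.

Lemma alg_independent_pullback U W (psi : U -> W) d (f : 'I_d -> polyfun W)
    (F : 'I_d -> polyfun U) :
  (forall a u, peval (F a) u = peval (f a) (psi u)) ->
  alg_independent_on (zclosure (range psi)) f -> alg_independent_on [set: U] F.
Proof.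
move=> FE indf Q Q0; apply: indf => w Zw.
have PQ : polynomial_fun (fun w => meval (fun a => peval (f a) w) Q).
  exists (comp_mpoly (mktuple f) Q) => v.
  by rewrite /peval comp_mpoly_meval; apply: meval_eq => j; rewrite tnth_mktuple.
apply: (zclosure_fun PQ) Zw => _ [u _ <-]; rewrite -(Q0 u) //.
by apply: meval_eq => a; rewrite FE.
Qed.

Lemma exists_max (P : nat -> Prop) b n0 : P n0 -> (forall n, P n -> (n <= b)%N) ->
  exists2 r, P r & forall n, P n -> (n <= r)%N.
Proof.
move=> P0 Pb; have exP : exists n, `[< P n >] by exists n0; apply/asboolP.
have leP n : `[< P n >] -> (n <= b)%N by move/asboolP; apply: Pb.
exists (ex_maxn exP leP); case: ex_maxnP => r /asboolP // _ rmax n Pn.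
by apply: rmax; apply/asboolP.
Qed.

Lemma exists_lfun U W (f : U -> W) : linear f -> exists h : 'Hom(U, W), h =1 f.
Proof.
move=> flin; pose h : {linear U -> W} :=
  HB.pack_for {linear U -> W} f (GRing.isLinear.Build _ _ _ _ _ flin).
by exists (linfun h) => u; rewrite lfunE.
Qed.

Lemma pdiffs_lfun W d (f : 'I_d -> polyfun W) (w : W) :
  exists h : 'Hom(W, 'rV[K]_d), forall v, h v = \row_a pdiff (f a) w v.
Proof.
by apply: exists_lfun => c x y; apply/rowP => a; rewrite !mxE pdiffP.
Qed.

(** Algebraically independent polynomials have independent differentials at a
    generic point: complete them to a transcendence basis; the differentials of
    the latter are injective, and there are at most [\dim {:U}] of them. *)
Lemma alg_independent_diff U d (F : 'I_d -> polyfun U) :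
  alg_independent_on [set: U] F ->
  exists q : U -> K, [/\ polynomial_fun q, exists u, q u != 0 &
    forall u, q u != 0 -> forall c : 'I_d -> K,
      exists v, forall a, pdiff (F a) u v = c a].
Proof.
move=> indF.
pose ext m := exists (F' : 'I_m -> polyfun U) (i : 'I_d -> 'I_m),
  [/\ alg_independent_on [set: U] F', injective i & forall a, F' (i a) = F a].
have [||m [F' [i [indF' inji F'i]]] mmax] := @exists_max ext (\dim {:U}) d.
- by exists F, id; split=> // a b.
- by move=> m [F' [i [/alg_independent_bound indb _ _]]].
have Tclo : zclosure (range (@id U)) = [set: U].
  by apply/seteqP; split=> // u _; apply: zclosure_sub; exists u.
have maxF' g : ~ alg_independent_on (zclosure (range (@id U))) (adjoin F' g).
  rewrite Tclo => indg; have := mmax m.+1; rewrite ltnn => H; suff: false by [].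
  apply: H; exists (adjoin F' g), (fun a => lift ord_max (i a)); split=> //.
    by move=> a b /lift_inj/inji.
  by move=> a; rewrite adjoin_lift.
have [|q [Pq qn0 Hq]] := transcendence_basis_diff
  (@polynomial_map_id K U) _ maxF'.
  by rewrite Tclo.
exists q; split=> // u qu c; have [h Hh] := pdiffs_lfun F' u.
have ker0 : lker h = 0%VS.
  apply/eqP; rewrite -subv0; apply/subvP => v; rewrite memv_ker memv0 Hh => /eqP hv.
  apply/eqP/(Hq u qu) => [P PZ|a].
    by apply: pdiff_eq0 => t; apply: PZ; rewrite Tclo.
  by have /rowP/(_ a) := hv; rewrite !mxE.
have full : limg h = fullv.
  apply/eqP; rewrite eqEdim subvf limg_dim_eq ?ker0 ?capv0 //.
  by rewrite dimvf /dim /= mul1n; apply: alg_independent_bound indF'.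
have : (\row_j \sum_(a | i a == j) c a : 'rV[K]_m) \in limg h by rewrite full memvf.
case/memv_imgP => v _ /rowP hv; exists v => a.
have := hv (i a); rewrite Hh !mxE F'i => <-.
by rewrite (bigD1 a) //= big1 ?addr0 // => b /andP[/eqP/inji ->]; rewrite eqxx.
Qed.

(** Generic smoothness of the closure Y of the image of psi.  Let f be a
    transcendence basis of the functions on Y.  At a generic point psi u, the
    differential of f is injective on the tangent space of Y, and that of f o psi
    is surjective; since the image of the differential of psi is contained in the
    tangent space, the two are equal, of dimension the number of the f. *)
Lemma generic_smoothness U W (psi : U -> W) (D : U -> 'Hom(U, W)) :
  polynomial_map psi ->
  (forall u v, has_dcurve (fun t => psi (u + t *: v)) (D u v)) ->
  exists q : U -> K, [/\ polynomial_fun q, exists u, q u != 0 &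
    forall u, q u != 0 -> regular_point (zclosure (range psi)) (psi u) /\
      forall w, tangent_space (zclosure (range psi)) (psi u) w ->
        exists v, w = D u v].
Proof.
move=> Ppsi HD; set Y := zclosure (range psi).
have pull d (f : 'I_d -> polyfun W) : exists F : 'I_d -> polyfun U,
    forall a u, peval (F a) u = peval (f a) (psi u).
  have /choice[F HF] : forall a, exists P : polyfun U,
    forall u, peval (f a) (psi u) = peval P u.
    by move=> a; apply: (polynomial_comp Ppsi (polynomial_peval (f a))).
  by exists F => a u; rewrite HF.
have Y0 : Y !=set0 by exists (psi 0); apply: zclosure_sub; exists 0.
pose indep r := exists f : 'I_r -> polyfun W, alg_independent_on Y f.
have [||r [f indf] rmax] := @exists_max indep (\dim {:U}) 0.
- exists (fun=> 0); exact: alg_independent0.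
- move=> m [f indf]; have [F HF] := pull m f.
  exact: alg_independent_bound (alg_independent_pullback HF indf).
have maxf g : ~ alg_independent_on Y (adjoin f g).
  by move=> indg; have := rmax r.+1; rewrite ltnn => H; suff: false by []; apply: H;
    exists (adjoin f g).
have [F HF] := pull r f.
have [q1 [Pq1 [u1 qu1] H1]] := transcendence_basis_diff Ppsi indf maxf.
have [q2 [Pq2 [u2 qu2] H2]] :=
  alg_independent_diff (alg_independent_pullback HF indf).
exists (fun u => q1 u * q2 u); split.
- exact: polynomialM.
- exact: generic_meet qu1 qu2.
move=> u; rewrite mulf_eq0 negb_or => /andP[qu_1 qu_2].
have {}H1 := H1 u qu_1; have {}H2 := H2 u qu_2.
have dF a v : pdiff (F a) u v = pdiff (f a) (psi u) (D u v).
  apply: has_dpath_uniq (has_dpath_line u v (F a)) _.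
  have := has_dpath_curve (f a) (HD u v); rewrite scale0r addr0.
  by apply: has_dpath_ext => t; rewrite HF.
have Dtan v : tangent_space Y (psi u) (D u v).
  move=> P PY; apply: has_dpath_uniq (_ : has_dpath (fun=> 0) _) _.
    have := has_dpath_curve P (HD u v); rewrite scale0r addr0.
    apply: has_dpath_ext => t; apply: PY; apply: zclosure_sub.
    by exists (u + t *: v).
  by exists 0; rewrite deriv0 horner0; split=> // t; rewrite horner0.
have tanD w : tangent_space Y (psi u) w -> exists v, w = D u v.
  move=> Tw; have [v Hv] := H2 (fun a => pdiff (f a) (psi u) w); exists v.
  apply/eqP; rewrite -subr_eq0; apply/eqP/H1 => [P PY|a].
    by rewrite addrC -scaleN1r pdiffP (Dtan v P PY) (Tw P PY) mulr0 addr0.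
  by rewrite addrC -scaleN1r pdiffP -dF Hv mulN1r addNr.
split; last exact: tanD.
split; first by apply: zclosure_sub; exists u.
exists (limg (D u)); split=> [w|].
  split=> [/memv_imgP[v _ ->]|/tanD[v ->]]; first exact: Dtan.
  by apply: memv_img; apply: memvf.
have -> : \dim (limg (D u)) = r.
  have [h Hh] := pdiffs_lfun f (psi u).
  have -> : \dim (limg (D u)) = \dim (h @: limg (D u)).
    apply/esym/limg_dim_eq/eqP; rewrite -subv0; apply/subvP => w.
    rewrite memv_cap memv_ker memv0 Hh => /andP[/memv_imgP[v _ ->] /eqP hv].
    apply/eqP/H1 => [|a]; first exact: Dtan.
    by have /rowP/(_ a) := hv; rewrite !mxE.
  have -> : (h @: limg (D u) = fullv)%VS.
    apply/eqP; rewrite eqEsubv subvf; apply/subvP => c _.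
    have [v Hv] := H2 (fun a => c 0 a).
    have -> : c = h (D u v) by rewrite Hh; apply/rowP => a; rewrite mxE -dF Hv.
    by rewrite !memv_img ?memvf.
  by rewrite dimvf /dim /= mul1n.
split.
  exists Y; split=> //.
  - exact: zclosed_closure.
  - exact: zirreducible_range.
  - by apply: zclosure_sub; exists u.
  - by split; [exists f | move=> [g /(fun h => rmax r.+1 (ex_intro _ g h))];
      rewrite ltnn].
move=> Z e _ _ ZY _ [[g indg] _]; apply: rmax; exists g.
exact: alg_independent_sub indg.
Qed.

End TranscendenceBases.
Lemma sum_ord2 (V : nmodType) (f : 'I_2 -> V) : \sum_t f t = f 0 + f 1.
Proof. by rewrite !big_ord_recl big_ord0 addr0; congr (_ + f _); apply: val_inj. Qed.

(** * Functions of several variables with flattenings of rank at most two *)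

Section Flattenings.
Variables (K : fieldType) (p : nat) (A : 'I_p -> Type).
Local Notation family := (forall i, A i).
Implicit Types (S E : pred 'I_p) (x y c d xi : family).

(** The entry of the flattening of a function F in the row of x and the column of
    y is F (mix S x y), if S is the set of slots of the rows. *)
Definition mix S x y : family := fun i => if S i then x i else y i.

Definition det3 (a b c d e f g h i : K) :=
  a * (e * i - f * h) - b * (d * i - f * g) + c * (d * h - e * g).

Definition flattening_rank_le2 (F : family -> K) : Prop :=
  forall S x0 x1 x2 y0 y1 y2, det3
    (F (mix S x0 y0)) (F (mix S x0 y1)) (F (mix S x0 y2))
    (F (mix S x1 y0)) (F (mix S x1 y1)) (F (mix S x1 y2))
    (F (mix S x2 y0)) (F (mix S x2 y1)) (F (mix S x2 y2)) = 0.

Variable F : family -> K.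
Hypothesis F3 : flattening_rank_le2 F.

(** A matrix of rank two is known from the two rows and the two columns of an
    invertible block, here normalized to be the identity. *)
Lemma flattening_interpolation S (R C : 'I_2 -> family) c d :
  (forall r s, F (mix S (R r) (C s)) = (r == s)%:R) ->
  F (mix S c d) = \sum_t F (mix S c (C t)) * F (mix S (R t) d).
Proof.
move=> RC; have := F3 S (R 0) (R 1) c (C 0) (C 1) d.
rewrite /det3 sum_ord2 !RC !eqxx /=; set x0 := F _; set x1 := F _; set z := F _.
by move=> h; apply/eqP; rewrite -subr_eq0 -h; apply/eqP; ring.
Qed.

Variables (o : family) (i j : 'I_p) (R C : 'I_2 -> family).
Hypothesis ij : i != j.

(** The block of the rows R 0, R 1 and the columns C 0, C 1 is the pivot.  The R
    differ from o in the slot i only and the C in the slot j only, so that the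
    block is the same in all flattenings that separate i from j. *)
Definition pivot r s E xi : family := fun k =>
  if k == i then R r k else if k == j then C s k else
  if E k then xi k else o k.

Hypothesis RC : forall r s xi, F (pivot r s pred0 xi) = (r == s)%:R.

Definition transfer E xi : 'M[K]_2 := \matrix_(r, s) F (pivot r s E xi).

Lemma transferE E E' x x' :
  (forall k, k != i -> k != j -> E k = E' k /\ (E k -> x k = x' k)) ->
  transfer E x = transfer E' x'.
Proof.
move=> EE; apply/matrixP => r s; rewrite !mxE; congr F.
apply: functional_extensionality_dep => k; rewrite /pivot.
case: eqP => // /eqP ki; case: eqP => // /eqP kj; have [<- xx] := EE k ki kj.
by case: ifP => // /xx.
Qed.

(** The interpolation formula for a flattening that separates i from j: the slots
    in E contribute a product of matrices. *)
Lemma transferU S E x : S i -> ~~ S j -> transfer E x =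
  transfer (fun k => E k && S k) x *m transfer (fun k => E k && ~~ S k) x.
Proof.
move=> iS jS.
have H u v u' v' B B' : mix S (pivot u v B x) (pivot u' v' B' x) =
    pivot u v' (fun k => if S k then B k else B' k) x.
  apply: functional_extensionality_dep => k; rewrite /mix /pivot.
  case: (eqVneq k i) => [->|ki]; first by rewrite iS.
  case: (eqVneq k j) => [->|kj]; first by rewrite (negPf jS).
  by case: ifP.
apply/matrixP => r s; rewrite !mxE.
have -> : pivot r s E x = mix S (pivot r 0 E x) (pivot 0 s E x).
  by rewrite H; congr pivot; apply: funext => k; rewrite if_same.
rewrite (@flattening_interpolation S (fun t => pivot t 0 pred0 x)
  (fun t => pivot 0 t pred0 x)) => [|u v]; last first.
  by rewrite H -(RC u v x); congr (F (pivot _ _ _ _)); apply: funext => k; case: ifP.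
apply: eq_bigr => t _; rewrite !mxE !H; congr (F (pivot _ _ _ _) * F (pivot _ _ _ _));
  by apply: funext => k; case: ifP; rewrite ?andbT ?andbF.
Qed.

Definition slot_matrix q (e : A q) : 'M[K]_2 := transfer (pred1 q) (dfwith o e).

Lemma slot_matrixE q x : transfer (pred1 q) x = slot_matrix (x q).
Proof.
by apply: transferE => k _ _; split=> // /eqP ->; rewrite dfwith_in.
Qed.

Lemma transfer_seq (s : seq 'I_p) x : uniq s -> i \notin s -> j \notin s ->
  transfer (fun k => k \in s) x = \prod_(q <- s) slot_matrix (x q).
Proof.
elim: s => [_ _ _|q s IHs /= /andP[qs us]].
  rewrite big_nil; apply/matrixP => r t; rewrite !mxE -(RC r t x).
  by congr (F (pivot _ _ _ _)); apply: funext => k; rewrite inE.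
rewrite !inE !negb_or => /andP[iq is_] /andP[jq js].
rewrite big_cons -IHs // -slot_matrixE.
rewrite (@transferU (fun k => (k == i) || (k == q))) ?eqxx //; last first.
  by rewrite negb_or eq_sym ij.
congr (_ *m _); apply: transferE => k ki kj; rewrite (negPf ki) /= inE;
  case: (eqVneq k q) => [->|kq] //=; rewrite ?andbF ?andbT ?(negPf qs) //.
Qed.

(** For two different slots the product is computed in either order by
    [transferU].  For a single slot q, the flattening that isolates q shows that
    1, slot_matrix e and slot_matrix f are linearly dependent, and the entries of
    the commutator are 3 by 3 minors of this triple. *)
Lemma slot_matrix_comm q r (e : A q) (f : A r) : q != i -> q != j -> r != i -> r != j ->
  comm_mx (slot_matrix e) (slot_matrix f).
Proof.
move=> qi qj ri rj; case: (eqVneq q r) => [qr|qr].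
  case: _ / qr f ri rj => f _ _.
  have minor (x0 x1 x2 : family) (r0 s0 r1 s1 r2 s2 : 'I_2) := F3 (pred1 q)
    x0 x1 x2 (pivot r0 s0 pred0 o) (pivot r1 s1 pred0 o) (pivot r2 s2 pred0 o).
  have mixE (g : A q) u v :
      F (mix (pred1 q) (dfwith o g) (pivot u v pred0 o)) = slot_matrix g u v.
    rewrite mxE; congr F; apply: functional_extensionality_dep => k.
    rewrite /mix /pivot /=; case: (eqVneq k q) => [->|//].
    by rewrite (negPf qi) (negPf qj).
  have mix1 u v : F (mix (pred1 q) o (pivot u v pred0 o)) = (u == v)%:R.
    rewrite -(RC u v o); congr F; apply: functional_extensionality_dep => k.
    rewrite /mix /pivot /=; case: (eqVneq k q) => [->|//].
    by rewrite (negPf qi) (negPf qj).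
  pose X := slot_matrix e; pose Y := slot_matrix f.
  have m1 := minor o (dfwith o e) (dfwith o f) 0 0 0 1 1 0.
  have m2 := minor o (dfwith o e) (dfwith o f) 0 0 0 1 1 1.
  have m3 := minor o (dfwith o e) (dfwith o f) 0 0 1 0 1 1.
  move: m1 m2 m3; rewrite !mixE !mix1 /= -/X -/Y /det3 => m1 m2 m3.
  apply/matrixP => u v; rewrite !mxE !sum_ord2 -/X -/Y.
  have ord2 (w : 'I_2) : w = 0 \/ w = 1.
    by case: w => [[|[|//]] ?]; [left|right]; apply: val_inj.
  apply/eqP; rewrite -subr_eq0.
  have [->|->] := ord2 u; have [->|->] := ord2 v; apply/eqP.
  - by rewrite -[RHS]m1; ring.
  - by rewrite -[RHS]m2; ring.
  - by rewrite -[RHS]oppr0 -[in RHS]m3; ring.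
  - by rewrite -[RHS]oppr0 -[in RHS]m1; ring.
pose x := dfwith (dfwith o e) f : family.
have xq : x q = e by rewrite /x dfwith_out 1?eq_sym // dfwith_in.
have xr : x r = f by rewrite /x dfwith_in.
have -> : slot_matrix e = slot_matrix (x q) by rewrite xq.
have -> : slot_matrix f = slot_matrix (x r) by rewrite xr.
have prod2 a b : a != b -> a != i -> a != j -> b != i -> b != j ->
    slot_matrix (x a) *m slot_matrix (x b) = transfer (fun k => k \in [:: a; b]) x.
  move=> ab ai aj bi bj; rewrite transfer_seq /= ?inE ?negb_or ?ab //.
  - by rewrite !big_cons big_nil mulr1.
  - by rewrite !(eq_sym i) ai.
  - by rewrite !(eq_sym j) aj.
rewrite /comm_mx !prod2 //; last by rewrite eq_sym.
by apply: transferE => k _ _; rewrite !inE orbC.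
Qed.

Definition left_end (x : family) : 'rV[K]_2 :=
  \row_s F (fun k => if k == i then x k else if k == j then C s k else o k).

Definition right_end (x : family) : 'cV[K]_2 :=
  \col_r F (fun k => if k == i then R r k else if k == j then x k else o k).

(** Two interpolations split off the slots i and j; the others are left between
    them. *)
Lemma tensor_train x :
  F x = (left_end x *m (\prod_(q | (q != i) && (q != j)) slot_matrix (x q)) *m
         right_end x) 0 0.
Proof.
have -> : \prod_(q | (q != i) && (q != j)) slot_matrix (x q) = transfer predT x.
  rewrite -big_filter -transfer_seq ?filter_uniq ?index_enum_uniq //.
  - apply: transferE => k ki kj; split=> //.
    by rewrite mem_filter ki kj mem_index_enum.
  - by rewrite mem_filter eqxx.
  - by rewrite mem_filter eqxx andbF.
pose xi r := pivot r 0 pred0 o; pose xj s := pivot 0 s pred0 o.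
pose xir r k := if k == i then R r k else x k.
have xE : x = mix (pred1 i) x x.
  by apply: functional_extensionality_dep => k; rewrite /mix if_same.
rewrite {1}xE (@flattening_interpolation (pred1 i) xi xj); last first.
  move=> r s; rewrite -(RC r s o); congr F.
  apply: functional_extensionality_dep => k; rewrite /mix /xi /xj /pivot /=.
  by case: eqP => // ->; rewrite (negPf ij).
rewrite -mulmxA [RHS]mxE; apply: eq_bigr => r _; congr (_ * _).
  rewrite mxE; congr F; apply: functional_extensionality_dep => k.
  by rewrite /mix /xj /pivot /=; case: eqP.
have -> : mix (pred1 i) (xi r) x = mix (predC1 j) (xir r) x.
  apply: functional_extensionality_dep => k; rewrite /mix /xi /xir /pivot /=.
  case: (eqVneq k i) => [->|ki]; first by rewrite ij.
  by case: eqP.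
rewrite (@flattening_interpolation (predC1 j) xi xj); last first.
  move=> u s; rewrite -(RC u s o); congr F.
  apply: functional_extensionality_dep => k; rewrite /mix /xi /xj /pivot /=.
  by case: (eqVneq k j) => [->|//] /=; rewrite eq_sym (negPf ij).
rewrite mxE; apply: eq_bigr => s _; congr (_ * _).
  rewrite mxE; congr F; apply: functional_extensionality_dep => k.
  rewrite /mix /xir /xj /pivot /=; case: (eqVneq k j) => [->|//] /=.
  by rewrite eq_sym (negPf ij).
rewrite mxE; congr F; apply: functional_extensionality_dep => k.
rewrite /mix /xi /pivot /=; case: (eqVneq k j) => [->|//] /=.
by rewrite eq_sym (negPf ij).
Qed.

End Flattenings.
(** * Two by two matrices *)

Section Matrices22.
Variable K : numFieldType.
Implicit Types Z P E : 'M[K]_2.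

Lemma ord2P (w : 'I_2) : w = 0 \/ w = 1.
Proof. by case: w => [[|[|//]] ?]; [left|right]; apply: val_inj. Qed.

Lemma matrix2P m (A B : 'M[K]_(2, m)) :
  (forall j, A 0 j = B 0 j) -> (forall j, A 1 j = B 1 j) -> A = B.
Proof. by move=> h0 h1; apply/matrixP => i j; have [->|->] := ord2P i. Qed.

Lemma matrix22P (A B : 'M[K]_2) : A 0 0 = B 0 0 -> A 0 1 = B 0 1 ->
  A 1 0 = B 1 0 -> A 1 1 = B 1 1 -> A = B.
Proof.
by move=> *; apply: matrix2P => j; have [->|->] := ord2P j.
Qed.

Lemma det22 (A : 'M[K]_2) : \det A = A 0 0 * A 1 1 - A 0 1 * A 1 0.
Proof.
rewrite (expand_det_row _ 0) sum_ord2 /cofactor !det_mx11 !mxE /=.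
rewrite (_ : lift 0 0 = 1); last exact: val_inj.
rewrite (_ : lift 1 0 = 0); last exact: val_inj.
by rewrite addn0 expr0 expr1 mul1r mulN1r mulrN.
Qed.

Lemma tr22 (A : 'M[K]_2) : \tr A = A 0 0 + A 1 1.
Proof. by rewrite /mxtrace sum_ord2. Qed.

Lemma scalar22 (a : K) : [/\ (a%:M : 'M[K]_2) 0 0 = a, (a%:M : 'M[K]_2) 0 1 = 0,
  (a%:M : 'M[K]_2) 1 0 = 0 & (a%:M : 'M[K]_2) 1 1 = a].
Proof. by rewrite !mxE /=. Qed.

Lemma singular22 P : \det P = 0 -> exists (u : 'cV[K]_2) (v : 'rV[K]_2), P = u *m v.
Proof.
rewrite det22 => dP; case: (eqVneq (P 0 0) 0) => [p00|p00].
  case: (eqVneq (P 0 1) 0) => [p01|p01].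
    exists (delta_mx 1 0), (row 1 P); apply: matrix2P => j;
      rewrite !mxE big_ord1 !mxE /= ?mul0r ?mul1r //.
    by have [->|->] := ord2P j.
  have p10 : P 1 0 = 0.
    by move: dP => /eqP; rewrite p00 mul0r sub0r oppr_eq0 mulf_eq0 (negPf p01) => /eqP.
  exists (col 1 P), (delta_mx 0 1); apply: matrix2P => j;
    rewrite !mxE big_ord1 !mxE /=; have [->|->] := ord2P j => /=;
    by rewrite ?mulr0 ?mulr1.
exists (col 0 P), (\row_j (P 0 j / P 0 0)); apply: matrix2P => j.
  by rewrite !mxE big_ord1 !mxE mulrCA mulfV // mulr1.
rewrite !mxE big_ord1 !mxE; have [->|->] := ord2P j.
  by rewrite mulfV // mulr1.
move/eqP: dP; rewrite subr_eq0 => /eqP dP.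
by rewrite mulrA [P 1 0 * _]mulrC -dP mulrAC mulfV // mul1r.
Qed.

Lemma traceless_sqr Z : \tr Z = 0 -> Z *m Z = (- \det Z)%:M.
Proof.
rewrite tr22 det22 => /eqP; rewrite addr_eq0 => /eqP z0.
have [s00 s01 s10 s11] := scalar22 (- (Z 0 0 * Z 1 1 - Z 0 1 * Z 1 0)).
by apply: matrix22P; rewrite ?s00 ?s01 ?s10 ?s11 mxE sum_ord2 z0; ring.
Qed.

(** A nonzero nilpotent matrix is moved along an elementary matrix placed
    opposite to a nonzero entry off its diagonal. *)
Lemma traceless_perturb Z : \tr Z = 0 -> Z != 0 ->
  exists2 E, \tr E = 0 & forall t, t != 0 -> \det (Z + t *: E) != 0.
Proof.
move=> trZ Z0; have detE E t : \det (Z + t *: E) =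
    (Z 0 0 + t * E 0 0) * (Z 1 1 + t * E 1 1) -
    (Z 0 1 + t * E 0 1) * (Z 1 0 + t * E 1 0) by rewrite det22 !mxE.
case: (eqVneq (\det Z) 0) => [dZ|dZ]; last first.
  by exists 0 => [|t _]; [rewrite raddf0 | rewrite scaler0 addr0].
move: dZ; rewrite det22 => dZ.
case: (eqVneq (Z 1 0) 0) => [z10|z10]; last first.
  exists (delta_mx 0 1) => [|t t0]; first by rewrite tr22 !mxE addr0.
  rewrite detE !mxE /= -[X in X != 0]subr0 -dZ.
  have -> : forall a b c d : K, (a + t * 0) * (b + t * 0) - (c + t * 1) * (d + t * 0)
    - (a * b - c * d) = - (t * d) by move=> *; ring.
  by rewrite dZ oppr_eq0 mulf_neq0.
case: (eqVneq (Z 0 1) 0) => [z01|z01]; last first.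
  exists (delta_mx 1 0) => [|t t0]; first by rewrite tr22 !mxE addr0.
  rewrite detE !mxE /= -[X in X != 0]subr0 -dZ.
  have -> : forall a b c d : K, (a + t * 0) * (b + t * 0) - (c + t * 0) * (d + t * 1)
    - (a * b - c * d) = - (t * c) by move=> *; ring.
  by rewrite dZ oppr_eq0 mulf_neq0.
case/eqP: Z0; move/eqP: trZ; rewrite tr22 addr_eq0 => /eqP z00.
move/eqP: dZ; rewrite z01 mul0r subr0 z00 mulNr oppr_eq0 mulf_eq0 orbb => /eqP z11.
by apply: matrix22P; rewrite !mxE // z00 z11 oppr0.
Qed.

Lemma comm22_span Z N : \tr Z = 0 -> Z != 0 -> comm_mx Z N ->
  exists a b, N = a%:M + b *: Z.
Proof.
rewrite tr22 => /eqP; rewrite addr_eq0 => /eqP z00 Z0 /matrixP ZN.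
have e i j := ZN i j.
move: (e 0 0) (e 0 1) (e 1 0); rewrite !mxE !sum_ord2 z00.
set x := N 0 0; set y := N 0 1; set z := N 1 0; set w := N 1 1.
set a := Z 1 1; set b := Z 0 1; set c := Z 1 0 => e00 e01 e10.
have two0 : 2 != 0 :> K by rewrite pnatr_eq0.
have span (s : K) : y = s * b -> z = s * c -> w - x = s * (2 * a) ->
    exists a b, N = a%:M + b *: Z.
  move=> h1 h2 h3; exists (x + s * a), s.
  have [s00 s01 s10 s11] := scalar22 (x + s * a).
  apply: matrix22P; rewrite [in RHS]mxE ?s00 ?s01 ?s10 ?s11 mxE ?add0r //.
    by rewrite z00 -/a -/x mulrN addrK.
  rewrite -/w -/a -addrA -mulrDr -mulr2n -mulr_natl -h3.
  by rewrite addrC subrK.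
have ebc : b * z = y * c.
  apply/eqP; rewrite -subr_eq0; apply/eqP.
  have -> : b * z - y * c = - a * x + b * z - (x * - a + y * c) by ring.
  by rewrite e00 subrr.
have eab : b * (w - x) = y * (2 * a).
  apply/eqP; rewrite -subr_eq0; apply/eqP.
  have -> : b * (w - x) - y * (2 * a) = - a * y + b * w - (x * b + y * a) by ring.
  by rewrite e01 subrr.
have eac : c * (w - x) = z * (2 * a).
  apply/eqP; rewrite -subr_eq0 -oppr_eq0; apply/eqP.
  have -> : - (c * (w - x) - z * (2 * a)) = c * x + a * z - (z * - a + w * c) by ring.
  by rewrite e10 subrr.
case: (eqVneq b 0) => [b0|b0]; last first.
  apply: (span (y / b)); first by rewrite divfK.
    by rewrite mulrAC -ebc mulrAC mulfV // mul1r.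
  by rewrite mulrAC -eab mulrAC mulfV // mul1r.
case: (eqVneq c 0) => [c0|c0]; last first.
  apply: (span (z / c)); last by rewrite mulrAC -eac mulrAC mulfV // mul1r.
    by apply: (mulIf c0); rewrite -ebc b0 mulr0 !mul0r.
  by rewrite divfK.
have a0 : a != 0.
  apply: contra Z0 => /eqP a0; apply/eqP; apply: matrix22P;
    by rewrite ?z00 -?/a -?/b -?/c ?a0 ?b0 ?c0 mxE ?oppr0.
have a2 : 2 * a != 0 by rewrite mulf_neq0.
have y0 : y = 0.
  by move/eqP: eab; rewrite b0 mul0r eq_sym mulf_eq0 (negPf a2) orbF => /eqP.
have z0 : z = 0.
  by move/eqP: eac; rewrite c0 mul0r eq_sym mulf_eq0 (negPf a2) orbF => /eqP.
apply: (span ((w - x) / (2 * a))); rewrite ?y0 ?z0 ?b0 ?c0 ?mulr0 //.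
by rewrite divfK.
Qed.

(** A member of the family that is not scalar has only the elements of its algebra
    for its centralizer; Z is its part of trace zero. *)
Lemma comm22_family (I : Type) (N : I -> 'M[K]_2) :
  (forall x y, comm_mx (N x) (N y)) ->
  exists Z, [/\ \tr Z = 0, Z != 0 & forall x, exists a b, N x = a%:M + b *: Z].
Proof.
move=> cN; pose tl M : 'M[K]_2 := M - (\tr M / 2)%:M.
have trtl M : \tr (tl M) = 0.
  rewrite /tl linearB /= mxtrace_scalar -[X in _ - X]mulr_natr divfK ?subrr //.
  by rewrite pnatr_eq0.
have tlE M : M = (\tr M / 2)%:M + tl M by rewrite addrC subrK.
case: (pselect (forall x, tl (N x) = 0)) => [tl0|].
  have [s00 s01 s10 s11] := scalar22 (1 : K).
  exists (1%:M - (2 *: delta_mx 1 1)); split=> [||x].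
  - by rewrite tr22 mxE s00 [in X in _ + X]mxE s11 !mxE /=; ring.
  - apply/eqP => /matrixP/(_ 0 0); rewrite mxE s00 !mxE /= => /eqP.
    by rewrite mulr0 subr0 oner_eq0.
  - by exists (\tr (N x) / 2), 0; rewrite scale0r addr0 {1}[N x]tlE tl0 addr0.
move=> /existsNP[x0 /eqP nz]; exists (tl (N x0)); split=> // x.
have cZ : comm_mx (tl (N x0)) (N x).
  rewrite /comm_mx /tl mulmxBl mulmxBr (cN x0 x); congr (_ - _).
  by rewrite scalar_mxC.
exact: comm22_span (trtl _) nz cZ.
Qed.

End Matrices22.

Section Spectral22.
Variable K : numClosedFieldType.

(** The spectral decomposition of Z, applied to a product of elements of the
    algebra generated by Z. *)
Lemma prod_spectral22 (Z : 'M[K]_2) : \tr Z = 0 -> \det Z != 0 ->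
  exists (zeta : K) (u0 u1 : 'cV[K]_2) (v0 v1 : 'rV[K]_2),
  forall (I : Type) (s : seq I) (P : pred I) (a b : I -> K),
    \prod_(q <- s | P q) ((a q)%:M + b q *: Z) =
    \prod_(q <- s | P q) (a q + b q * zeta) *: (u0 *m v0) +
    \prod_(q <- s | P q) (a q - b q * zeta) *: (u1 *m v1).
Proof.
move=> trZ dZ; pose zeta := sqrtC (- \det Z).
have zz : zeta * zeta = - \det Z by rewrite -expr2 sqrtCK.
have z0 : zeta != 0 by rewrite sqrtC_eq0 oppr_eq0.
have ZZ := traceless_sqr trZ.
pose proj (e : K) : 'M[K]_2 := 2^-1 *: (1%:M + (e / zeta) *: Z).
have projZ e : e * e = 1 -> Z *m proj e = (e * zeta) *: proj e.
  move=> ee; rewrite -scalemxAr mulmxDr mulmx1 -scalemxAr ZZ -zz.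
  rewrite [RHS]scalerA [_ * 2^-1]mulrC -[RHS]scalerA; congr (_ *: _).
  rewrite scalerDr scalerA mulrACA ee mul1r mulfV // scale1r addrC; congr (_ + _).
  by rewrite scalemx1 scale_scalar_mx (mulrA (e / zeta)) divfK.
have dproj e : e * e = 1 -> \det (proj e) = 0.
  move=> ee; rewrite detZ det22; set c := e / zeta.
  have [s00 s01 s10 s11] := scalar22 (1 : K).
  have ME m n : (1%:M + c *: Z) m n = (1%:M : 'M[K]_2) m n + c * Z m n.
    by rewrite mxE [in X in _ + X]mxE.
  rewrite !ME s00 s01 s10 s11; apply/eqP; rewrite mulf_eq0; apply/orP; right; apply/eqP.
  have -> : (1 + c * Z 0 0) * (1 + c * Z 1 1) - (0 + c * Z 0 1) * (0 + c * Z 1 0)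
      = 1 + c * \tr Z + (c * c) * \det Z by rewrite tr22 det22; ring.
  have -> : c * c = - (\det Z)^-1 by rewrite /c mulrACA ee mul1r -invfM zz invrN.
  by rewrite trZ mulr0 addr0 mulNr mulVf // subrr.
have ee1 : (1 : K) * 1 = 1 by rewrite mulr1.
have eeN : (- 1 : K) * - 1 = 1 by rewrite mulrNN mulr1.
have [u0 [v0 uv0]] := singular22 (dproj 1 ee1).
have [u1 [v1 uv1]] := singular22 (dproj (- 1) eeN).
have one : (1%:M : 'M[K]_2) = proj 1 + proj (- 1).
  rewrite -scalerDr addrACA -scalerDl -mulrDl subrr mul0r scale0r addr0.
  have h (M : 'M[K]_2) : M + M = 2 *: M by rewrite scaler_nat.
  by rewrite h scalerA mulVf ?scale1r // pnatr_eq0.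
exists zeta, u0, u1, v0, v1 => I s P a b; rewrite -uv0 -uv1.
rewrite -[LHS]mulmx1 one mulmxDr; congr (_ + _).
  elim/big_rec2: _ => [|q y1 y2 _ IH]; first by rewrite scale1r mul1mx.
  rewrite -mulmxA IH -scalemxAr mulmxDl mul_scalar_mx -scalemxAl projZ // mul1r.
  by rewrite [b q *: _]scalerA -scalerDl scalerA mulrC.
elim/big_rec2: _ => [|q y1 y2 _ IH]; first by rewrite scale1r mul1mx.
rewrite -mulmxA IH -scalemxAr mulmxDl mul_scalar_mx -scalemxAl projZ // mulN1r.
by rewrite [b q *: _]scalerA mulrN -scalerDl scalerA mulrC.
Qed.

End Spectral22.
(** * Evaluation of tensors *)

Section TensorEvaluation.
Variables (R : realType) (p : nat) (n : 'I_p -> nat).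
Local Notation C := R[i].
Local Notation family := (forall i, 'rV[C]_(n i)).
Local Notation tensor := (tensor R n).
Local Notation index := (multi_index n).
Implicit Types (T S : tensor) (x y xi o : family) (a b : index).

(** The multilinear form of T.  Minors are formed of its values at arbitrary
    vectors and not only of the entries of T, which are its values at the
    coordinate axes. *)
Definition ev T xi : C := \sum_(a : index) T a * \prod_i xi i 0 (a i).

Lemma evP (c : C) S T xi : ev (c *: S + T) xi = c * ev S xi + ev T xi.
Proof.
rewrite /ev mulr_sumr -big_split; apply: eq_bigr => a _ /=.
by rewrite !ffunE mulrDl -mulrA.
Qed.

Lemma ev0 xi : ev 0 xi = 0.
Proof. by rewrite /ev big1 // => a _; rewrite ffunE mul0r. Qed.

Definition axes a : family := fun i => delta_mx 0 (a i).

Lemma prod_axes a b : \prod_i axes a i 0 (b i) = (b == a)%:R.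
Proof.
case: eqP => [->|/eqP ba].
  by rewrite big1 // => i _; rewrite mxE !eqxx.
have [i bi] : exists i, b i != a i.
  apply/existsP; rewrite -negb_forall; apply: contra ba => /forallP h.
  by apply/eqP/ffunP => i; apply/eqP/h.
by rewrite (bigD1 i) //= mxE (negPf bi) andbF mul0r.
Qed.

Lemma ev_axes T a : ev T (axes a) = T a.
Proof.
rewrite /ev (bigD1 a) //= prod_axes eqxx mulr1 big1 ?addr0 // => b ba.
by rewrite prod_axes (negPf ba) mulr0.
Qed.

Lemma prod_dfwith xi i (v : 'rV[C]_(n i)) a :
  \prod_k dfwith xi v k 0 (a k) = v 0 (a i) * \prod_(k | k != i) xi k 0 (a k).
Proof.
rewrite (bigD1 i) //= dfwith_in; congr (_ * _); apply: eq_bigr => k ki.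
by rewrite dfwith_out // eq_sym.
Qed.

Lemma ev_dfwithP T xi i c (v w : 'rV[C]_(n i)) :
  ev T (dfwith xi (c *: v + w)) = c * ev T (dfwith xi v) + ev T (dfwith xi w).
Proof.
rewrite /ev mulr_sumr -big_split; apply: eq_bigr => a _ /=.
by rewrite !prod_dfwith !mxE; ring.
Qed.

Lemma dfwith_id xi i : dfwith xi (xi i) = xi.
Proof. by apply: functional_extensionality_dep => k; case: dfwithP. Qed.

Lemma dfwith2 xi i (v w : 'rV[C]_(n i)) : dfwith (dfwith xi v) w = dfwith xi w.
Proof.
apply: functional_extensionality_dep => k; case: (eqVneq i k) => [<-|ik].
  by rewrite !dfwith_in.
by rewrite !dfwith_out.
Qed.

Lemma dfwithC xi i j (v : 'rV[C]_(n i)) (w : 'rV[C]_(n j)) : i != j ->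
  dfwith (dfwith xi v) w = dfwith (dfwith xi w) v.
Proof.
move=> ij; apply: functional_extensionality_dep => k.
case: (eqVneq i k) => [ik|ik].
  by case: _ / ik; rewrite dfwith_in dfwith_out 1?eq_sym // dfwith_in.
rewrite [RHS]dfwith_out //; case: (eqVneq j k) => [<-|jk].
  by rewrite !dfwith_in.
by rewrite !dfwith_out.
Qed.

Lemma ev_dfwithZ T xi i c (v : 'rV[C]_(n i)) :
  ev T (dfwith xi (c *: v)) = c * ev T (dfwith xi v).
Proof.
have h0 : ev T (dfwith xi (0 : 'rV_(n i))) = 0.
  have := ev_dfwithP T xi 1 (0 : 'rV_(n i)) 0.
  by rewrite scaler0 addr0 mul1r => /(canLR (addrK _)); rewrite subrr.
by rewrite -[c *: v]addr0 ev_dfwithP h0 addr0.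
Qed.

Lemma ev_dfwithD T xi i (v w : 'rV[C]_(n i)) :
  ev T (dfwith xi (v + w)) = ev T (dfwith xi v) + ev T (dfwith xi w).
Proof. by rewrite -[v]scale1r ev_dfwithP mul1r scale1r. Qed.

Lemma ev_pure x xi : ev (pure x) xi = \prod_i \sum_k x i 0 k * xi i 0 k.
Proof.
rewrite -big_dffun_distr; apply: eq_bigr => a _.
by rewrite ffunE -big_split.
Qed.

Lemma pure_dfwith xi i (v : 'rV[C]_(n i)) a :
  pure (dfwith xi v) a = v 0 (a i) * \prod_(k | k != i) xi k 0 (a k).
Proof. by rewrite ffunE prod_dfwith. Qed.

Lemma pure_dfwithP xi i c (v w : 'rV[C]_(n i)) :
  pure (dfwith xi (c *: v + w)) = c *: pure (dfwith xi v) + pure (dfwith xi w).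
Proof.
apply/ffunP => a; rewrite !ffunE !prod_dfwith !mxE.
by rewrite [X in _ = X + _]mulrA -mulrDl.
Qed.

Lemma scale_pure c x i : c *: pure x = pure (dfwith x (c *: x i)).
Proof.
apply/ffunP => a; rewrite pure_dfwith ffunE -[in LHS](dfwith_id x i) pure_dfwith.
by rewrite [in RHS]mxE; apply: mulrA.
Qed.

Hypothesis p_gt0 : (0 < p)%N.

Lemma rank_one_scale c T : rank_one_cone T -> rank_one_cone (c *: T).
Proof.
by move=> [x _ <-]; rewrite (scale_pure c x (Ordinal p_gt0)); eexists.
Qed.

Lemma rank_one0 : rank_one_cone (0 : tensor).
Proof.
rewrite -(scale0r (pure (fun i => 0))); apply: rank_one_scale.
by eexists.
Qed.

(** ** Pure tensors *)

Local Open Scope set_scope.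

Definition two_slot_minors T : Prop :=
  forall xi i j (v : 'rV[C]_(n i)) (w : 'rV[C]_(n j)), i != j ->
    ev T xi * ev T (dfwith (dfwith xi v) w) =
    ev T (dfwith xi v) * ev T (dfwith xi w).

(** The minors give ev T xi as a product of functions of the separate xi i as
    soon as the intermediate evaluations are not zero; as ev T is affine
    along xi i + t o i, a vanishing factor f i (xi i) is handled by
    evaluating at xi i + o i and at o i instead. *)
Lemma two_slot_minors_pure T : two_slot_minors T -> rank_one_cone T.
Proof.
move=> T2; case: (pselect (exists a, T a != 0)) => [[a0 Ta0]|T0]; last first.
  suff -> : T = 0 by exact: rank_one0.
  apply/ffunP => a; rewrite ffunE; apply/eqP; apply: contraT => Ta.
  by case: T0; exists a.
pose o : family := axes a0.
have To : ev T o != 0 by rewrite ev_axes.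
pose f i (v : 'rV[C]_(n i)) := ev T (dfwith o v) / ev T o.
have fo i : f i (o i) = 1 by rewrite /f dfwith_id mulfV.
have fD i v w : f i (v + w) = f i v + f i w by rewrite /f ev_dfwithD mulrDl.
pose on (D : {set 'I_p}) xi : family := fun i => if i \in D then xi i else o i.
have onU (D : {set 'I_p}) xi i : i \in D -> on D xi = dfwith (on (D :\ i) xi) (xi i).
  move=> iD; apply: functional_extensionality_dep => k.
  case: (eqVneq i k) => [<-|ik]; first by rewrite dfwith_in /on iD.
  by rewrite dfwith_out // /on !inE eq_sym ik.
have evE (D : {set 'I_p}) xi : ev T (on D xi) = ev T o * \prod_(i in D) f i (xi i).
  have [m] := ubnP #|D|; elim: m => // m IHm in D xi *; rewrite ltnS => Dm.
  have IHD i xi' : i \in D ->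
      ev T (on (D :\ i) xi') = ev T o * \prod_(k in D :\ i) f k (xi' k).
    by move=> iD; apply: IHm; rewrite (cardsD1 i) iD in Dm.
  have [e] := ubnP #|[set i in D | f i (xi i) == 0]|.
  elim: e => // e IHe in xi *; rewrite ltnS => De.
  case: (set_0Vmem [set i in D | f i (xi i) == 0]) => [nz|[ i]]; last first.
    rewrite inE => /andP[iD /eqP fi0]; pose xi' := dfwith xi (xi i + o i).
    have xi'i : xi' i = xi i + o i by rewrite /xi' dfwith_in.
    have xi'k k : k != i -> xi' k = xi k by move=> ki; rewrite /xi' dfwith_out 1?eq_sym.
    have on' : on (D :\ i) xi' = on (D :\ i) xi.
      apply: functional_extensionality_dep => k; rewrite /on !inE.
      by case: eqP => //= /eqP ki; case: ifP => // _; rewrite xi'k.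
    have prod' : \prod_(k in D :\ i) f k (xi' k) = \prod_(k in D :\ i) f k (xi k).
      by apply: eq_bigr => k; rewrite !inE => /andP[ki _]; rewrite xi'k.
    have := IHe xi'; rewrite (big_setD1 i) //= xi'i fD fo fi0 add0r mul1r prod'.
    rewrite -IHD // -on' -/xi' (onU _ _ _ iD) xi'i ev_dfwithD on' -onU //.
    rewrite (_ : dfwith _ (o i) = on (D :\ i) xi); last first.
      by apply: functional_extensionality_dep => k; case: dfwithP => //;
        rewrite /on !inE eqxx.
    move=> H; rewrite (big_setD1 i) //= fi0 mul0r mulr0.
    apply: (addIr (ev T (on (D :\ i) xi))); rewrite add0r H //.
    apply: leq_trans De; apply: proper_card; apply/properP; split.
      apply/fintype.subsetP => k; rewrite !inE => /andP[-> /=].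
      case: (eqVneq k i) => [->|ki]; last by rewrite xi'k.
      by rewrite fi0 eqxx.
    exists i; rewrite !inE iD ?fi0 ?eqxx //=.
    by rewrite xi'i fD fo fi0 add0r oner_eq0.
  have fn0 k : k \in D -> f k (xi k) != 0.
    move=> kD; apply/negP => fk.
    have : k \in (finset.set0 : {set 'I_p}) by rewrite -nz inE kD.
    by rewrite inE.
  case: (set_0Vmem D) => [D0|[i iD]].
    rewrite D0 big_set0 mulr1; congr ev; apply: functional_extensionality_dep => k.
    by rewrite /on inE.
  case: (set_0Vmem (D :\ i)) => [D0|[j jD]].
    rewrite (onU _ _ _ iD) (big_setD1 i) //= D0 big_set0 mulr1 mulrC divfK //.
    congr ev; apply: functional_extensionality_dep => k; case: dfwithP => [|l il].
      by rewrite dfwith_in.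
    by rewrite dfwith_out // /on inE.
  have ij : i != j by move: jD; rewrite !inE => /andP[+ _]; rewrite eq_sym.
  have jD' : j \in D by move: jD; rewrite !inE => /andP[].
  have iDj : i \in D :\ j by rewrite !inE ij.
  have EE : ev T (on (D :\ i :\ j) xi) =
      ev T o * \prod_(k in D :\ i :\ j) f k (xi k).
    by apply: IHm; rewrite (cardsD1 i) iD (cardsD1 j) jD in Dm; apply: ltnW.
  have En0 : ev T (on (D :\ i :\ j) xi) != 0.
    rewrite EE mulf_neq0 //; apply/prodf_neq0 => k; rewrite !inE => /and3P[_ _ kD].
    exact: fn0.
  apply: (mulfI En0); have := T2 (on (D :\ i :\ j) xi) j i (xi j) (xi i).
  rewrite eq_sym ij -onU // -onU // => -> //.
  have -> : D :\ i :\ j = D :\ j :\ i by apply/setP => k; rewrite !inE andbCA.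
  rewrite -onU // !IHD // IHm; last first.
    by rewrite (cardsD1 j) jD' (cardsD1 i) iDj in Dm; apply: ltnW.
  rewrite [\prod_(k in D) _](big_setD1 i) //= [\prod_(k in D :\ j) _](big_setD1 i) //=.
  rewrite [\prod_(k in D :\ i) _](big_setD1 j) //=.
  have -> : D :\ i :\ j = D :\ j :\ i by apply/setP => k; rewrite !inE andbCA.
  by ring.
pose x : family := fun i => \row_k f i (delta_mx 0 k).
rewrite (_ : T = ev T o *: pure x); first by apply: rank_one_scale; exists x.
apply/ffunP => a; rewrite !ffunE -ev_axes.
have -> : axes a = on [set: 'I_p] (axes a).
  by apply: functional_extensionality_dep => k; rewrite /on inE.
rewrite evE [LHS]mulrC [RHS]mulrC; congr (_ * _).
by apply: eq_big => [k|k _]; rewrite ?inE // mxE.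
Qed.

End TensorEvaluation.
(** * Border rank two *)

Lemma cvg_horner (K : numFieldType) (q : {poly K}) (u : nat -> K^o) :
  u k @[k --> \oo] --> (0 : K^o) ->
  (q.[u k] : K^o) @[k --> \oo] --> (q.[0] : K^o).
Proof.
move=> u0; elim/poly_ind: q => [|q c IH].
  by under eq_cvg do rewrite horner0; rewrite horner0; apply: cvg_cst.
under eq_cvg do rewrite hornerMXaddC.
by rewrite hornerMXaddC; apply: cvgD (cvg_cst _); apply: cvgM.
Qed.

Section BorderRankTwo.
Variables (R : realType) (p : nat) (n : 'I_p -> nat).
Local Notation C := R[i].
Local Notation family := (forall i, 'rV[C]_(n i)).
Local Notation tensor := (tensor R n).
Local Notation index := (multi_index n).
Implicit Types (T : tensor) (xi o : family) (a b : index).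

Lemma polynomial_ev xi : polynomial_fun (fun T : tensor => ev T xi).
Proof. by apply: polynomial_linear => c S T; rewrite evP. Qed.

Lemma rank_le2P T : rank_le 2 T <-> exists x y, T = pure x + pure y.
Proof.
split=> [[x ->]|[x [y ->]]].
  by exists (x ord0), (x (lift ord0 ord0)); rewrite !big_ord_recl big_ord0 addr0.
exists (fun k => if k == ord0 then x else y).
by rewrite !big_ord_recl big_ord0 addr0.
Qed.

Lemma ev_pure_mix x (S : pred 'I_p) xi eta : ev (pure x) (mix S xi eta) =
  (\prod_(i | S i) \sum_k x i 0 k * xi i 0 k) *
  (\prod_(i | ~~ S i) \sum_k x i 0 k * eta i 0 k).
Proof.
rewrite ev_pure (bigID S) /=; congr (_ * _); apply: eq_bigr => i.
  by rewrite /mix => ->.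
by rewrite /mix => /negPf ->.
Qed.

(** Across any cut a pure tensor is the product of a function of the rows and a
    function of the columns. *)
Lemma rank_le2_flattening T : rank_le 2 T -> flattening_rank_le2 (ev T).
Proof.
move=> /rank_le2P[x [y ->]] S x0 x1 x2 y0 y1 y2.
have -> : pure x + pure y = 1 *: pure x + pure y by rewrite scale1r.
by rewrite /det3 !evP !ev_pure_mix; ring.
Qed.

Lemma polynomial_det3 (W : vectType C) (a b c d e f g h i : W -> C) :
  polynomial_fun a -> polynomial_fun b -> polynomial_fun c ->
  polynomial_fun d -> polynomial_fun e -> polynomial_fun f ->
  polynomial_fun g -> polynomial_fun h -> polynomial_fun i ->
  polynomial_fun (fun w => det3 (a w) (b w) (c w) (d w) (e w) (f w) (g w) (h w) (i w)).
Proof.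
move=> *; apply: polynomialD; first apply: polynomialB;
  by apply: polynomialM => //; apply: polynomialB; apply: polynomialM.
Qed.

Lemma zclosure_rank_le2_flattening T :
  zclosure (rank_le 2) T -> flattening_rank_le2 (ev T).
Proof.
move=> clT S x0 x1 x2 y0 y1 y2; move: T clT; apply: zclosure_fun => [|T'].
  by apply: polynomial_det3; apply: polynomial_ev.
by move=> /rank_le2_flattening; apply.
Qed.

(** ** A family of tensors of rank at most two *)

Section Pencil.
Variables (i j : 'I_p) (ij : i != j).
Variables (l r : forall q, 'I_(n q) -> 'I_2 -> C) (al be : forall q, 'I_(n q) -> C).

Definition train_tensor (Z : 'M[C]_2) : tensor :=
  [ffun a : index => ((\row_t l (a i) t) *m
    (\prod_(q | (q != i) && (q != j)) ((al (a q))%:M + be (a q) *: Z)) *m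
    (\col_t r (a j) t)) 0 0].

Lemma train_tensor_rank Z : \tr Z = 0 -> \det Z != 0 -> rank_le 2 (train_tensor Z).
Proof.
move=> trZ dZ; have [zeta [u0 [u1 [v0 [v1 H]]]]] := prod_spectral22 trZ dZ.
pose x (s : C) (u : 'cV[C]_2) (v : 'rV[C]_2) : family := fun q =>
  \row_k (if q == i then ((\row_t l k t) *m u) 0 0 else
          if q == j then (v *m (\col_t r k t)) 0 0 else al k + s * be k * zeta).
have xE s u v a : \prod_q x s u v q 0 (a q) =
    ((\row_t l (a i) t) *m u) 0 0 *
    (\prod_(q | (q != i) && (q != j)) (al (a q) + s * be (a q) * zeta)) *
    (v *m (\col_t r (a j) t)) 0 0.
  have ji : j != i by rewrite eq_sym.
  rewrite (bigD1 i) //= (bigD1 j) //= mulrA mulrAC.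
  rewrite [x s u v i 0 _]mxE eqxx [x s u v j 0 _]mxE (negPf ji) eqxx.
  congr (_ * _ * _); apply: eq_bigr => q /andP[qi qj].
  by rewrite mxE (negPf qi) (negPf qj).
apply/rank_le2P; exists (x 1 u0 v0), (x (-1) u1 v1); apply/ffunP => a.
have term (c : C) (L : 'rV[C]_2) (D u : 'cV[C]_2) (v : 'rV[C]_2) :
    (L *m (c *: (u *m v)) *m D) 0 0 = (L *m u) 0 0 * c * (v *m D) 0 0.
  rewrite -scalemxAr -scalemxAl mxE mulmxA -[_ *m v *m D]mulmxA.
  by rewrite [(_ *m _ *m _) 0 0]mxE big_ord1 mulrCA mulrA.
have pureE y : pure y a = \prod_q y q 0 (a q) by rewrite ffunE.
rewrite ffunE H mulmxDr mulmxDl mxE ffunE !pureE (xE 1) (xE (-1)).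
congr (_ + _); apply: (etrans (term _ _ _ _ _)); congr (_ * _ * _);
  by apply: eq_bigr => q _; rewrite ?mul1r // mulN1r mulNr.
Qed.

Lemma polynomial_train (Z E : 'M[C]_2) a :
  polynomial_fun (fun t : C^o => train_tensor (Z + (t : C) *: E) a).
Proof.
have Pmul m1 m2 m3 (A : C^o -> 'M[C]_(m1, m2)) (B : C^o -> 'M[C]_(m2, m3)) :
    (forall u v, polynomial_fun (fun t => A t u v)) ->
    (forall u v, polynomial_fun (fun t => B t u v)) ->
    forall u v, polynomial_fun (fun t => (A t *m B t) u v).
  move=> PA PB u v; apply: (@polynomial_ext _ _
    (fun t => \sum_w A t u w * B t w v)) => [t|]; first by rewrite mxE.
  by apply: polynomial_sum => w _; apply: polynomialM.
apply: (@polynomial_ext _ _ (fun t : C^o => ((\row_t l (a i) t) *m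
    (\prod_(q | (q != i) && (q != j)) ((al (a q))%:M + be (a q) *: (Z + t *: E))) *m
    (\col_t r (a j) t)) 0 0)) => [t|]; first by rewrite ffunE.
apply: (Pmul) => [|u v]; last exact: polynomial_cst.
apply: (Pmul) => [u v|]; first exact: polynomial_cst.
elim: (index_enum _) => [|q s IHs] u v.
  by apply: polynomial_ext (polynomial_cst _ ((1 : 'M[C]_2) u v)) => t; rewrite big_nil.
case: (boolP ((q != i) && (q != j))) => qij; last first.
  by apply: polynomial_ext (IHs u v) => t; rewrite big_cons (negPf qij).
apply: (@polynomial_ext _ _ (fun t : C^o =>
    (((al (a q))%:M + be (a q) *: (Z + t *: E)) *m
    \prod_(q <- s | (q != i) && (q != j)) ((al (a q))%:M + be (a q) *: (Z + t *: E)))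
    u v)) => [t|]; first by rewrite big_cons qij.
apply: (Pmul) => // {}u {}v; apply: (@polynomial_ext _ _ (fun t : C^o =>
  (al (a q))%:M u v + be (a q) * (Z u v + t * E u v))) => [t|].
  by rewrite !mxE.
apply: polynomialD; first exact: polynomial_cst.
apply: polynomialM; first exact: polynomial_cst.
apply: polynomialD; first exact: polynomial_cst.
by apply: polynomial_linear => c t t'; rewrite mulrDl mulrA.
Qed.

End Pencil.

Lemma cvg_inverse : (k.+1%:R^-1 : C^o) @[k --> \oo] --> (0 : C^o).
Proof.
apply/cvgrPdist_lt => /= e e0.
have [re0 eE] : 0 < complex.Re e /\ e = (complex.Re e)%:C%C.
  by case: e e0 => x y; rewrite ltcE /= => /andP[/eqP -> x0].
have /cvgrPdist_lt/(_ _ re0) := @cvg_harmonic R.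
apply: filterS => k; rewrite /= !sub0r !normrN => h.
rewrite eE; have -> : k.+1%:R^-1 = (k.+1%:R^-1)%:C%C :> C.
  by rewrite fmorphV rmorph_nat.
move: h; rewrite !ger0_norm ?ltcR // ?invr_ge0 //.
by rewrite lecR invr_ge0.
Qed.

Lemma cvg_polynomial (f : C^o -> C) (u : nat -> C^o) : polynomial_fun f ->
  u k @[k --> \oo] --> (0 : C^o) -> (f (u k) : C^o) @[k --> \oo] --> (f 0 : C^o).
Proof.
move=> Pf u0; have [q fq] := polynomial_line 0 (1 : C^o) Pf.
have -> : f = horner q.
  by apply: funext => t; rewrite -fq add0r [_ *: _]mulr1.
exact: cvg_horner.
Qed.

Hypothesis p_gt0 : (0 < p)%N.

Lemma rank_one_border T : rank_one_cone T -> border_rank_le 2 T.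
Proof.
move=> [x _ xT]; exists (fun=> T); split=> [_|a]; last exact: cvg_cst.
have [y _ y0] := @rank_one0 R p n p_gt0.
by apply/rank_le2P; exists x, y; rewrite y0 addr0.
Qed.

(** A pivot makes the train formula available, with all slots in the algebra
    generated by one matrix Z.  When Z is diagonalizable the formula has two
    terms; a nilpotent Z is the limit of diagonalizable matrices. *)
Lemma flattening_border T : flattening_rank_le2 (ev T) -> border_rank_le 2 T.
Proof.
move=> F3; case: (pselect (two_slot_minors T)) => [/two_slot_minors_pure pureT|].
  exact: rank_one_border (pureT p_gt0).
move=> /existsNP[o /existsNP[i /existsNP[j /existsNP[v /existsNP[w]]]]].
move=> /not_implyP[ij minor].
(* rows and columns of the minor; the rows are then recombined by the inverse of
   the block M in order to turn it into the identity *)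
pose B (r : 'I_2) := if r == 0 then o i else v.
pose Cf (s : 'I_2) : family := if s == 0 then o else dfwith o w.
pose M : 'M[C]_2 := \matrix_(r, s) ev T (dfwith (Cf s) (B r)).
have Munit : M \in unitmx.
  rewrite unitmxE unitfE det22 !mxE /B /Cf /= subr_eq0; apply/eqP => h; apply: minor.
  have dfo : dfwith (dfwith o w) (o i) = dfwith o w.
    by rewrite dfwithC 1?eq_sym // dfwith_id.
  rewrite dfwith_id dfo in h; rewrite -[RHS]mulrC -h; congr (_ * ev T _).
  by rewrite dfwithC.
pose Rf (r : 'I_2) : family := dfwith o (\sum_s invmx M r s *: B s).
have RC r s xi : ev T (pivot o i j Rf Cf r s pred0 xi) = (r == s)%:R.
  have -> : pivot o i j Rf Cf r s pred0 xi =
      dfwith (Cf s) (\sum_s invmx M r s *: B s).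
    apply: functional_extensionality_dep => k; rewrite /pivot /Rf /=.
    case: (eqVneq k i) => [->|ki]; first by rewrite !dfwith_in.
    rewrite dfwith_out 1?eq_sym //; case: (eqVneq k j) => // kj.
    by rewrite /Cf; case: ifP => // _; rewrite dfwith_out // eq_sym.
  transitivity ((invmx M *m M) r s); last by rewrite mulVmx // mxE.
  by rewrite sum_ord2 ev_dfwithD !ev_dfwithZ mxE sum_ord2 !mxE.
pose good (qk : {q : 'I_p & 'I_(n q)}) := (tag qk != i) && (tag qk != j).
pose N q (k : 'I_(n q)) := slot_matrix (ev T) o i j Rf Cf (delta_mx 0 k : 'rV[C]_(n q)).
have [|Z [trZ Z0 HZ]] := @comm22_family C {qk | good qk}
    (fun x => N (tag (val x)) (tagged (val x))).
  move=> [[q k] /= /andP[/= qi qj]] [[r l] /= /andP[/= ri rj]].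
  exact: slot_matrix_comm.
have /choice[c Hc] : forall qk : {q : 'I_p & 'I_(n q)}, exists c : C * C,
    good qk -> N (tag qk) (tagged qk) = c.1%:M + c.2 *: Z.
  move=> qk; case: (boolP (good qk)) => [gqk|_]; last by exists (0, 0).
  by have [a [b ab]] := HZ (exist _ qk gqk); exists (a, b).
pose l q (k : 'I_(n q)) := left_end (ev T) o i j Cf (dfwith o (delta_mx 0 k)) 0.
pose r q (k : 'I_(n q)) t :=
  right_end (ev T) o i j Rf (dfwith o (delta_mx 0 k)) t 0.
pose al q (k : 'I_(n q)) := (c (Tagged (fun q => 'I_(n q)) k)).1.
pose be q (k : 'I_(n q)) := (c (Tagged (fun q => 'I_(n q)) k)).2.
have TE : T = train_tensor i j l r al be Z.
  apply/ffunP => a; rewrite -ev_axes (tensor_train F3 ij RC) ffunE.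
  have -> : left_end (ev T) o i j Cf (axes R a) = \row_t l i (a i) t.
    apply/rowP => t; rewrite [RHS]mxE /l mxE [RHS]mxE; congr (ev T _).
    apply: functional_extensionality_dep => k; case: (eqVneq k i) => // ->.
    by rewrite dfwith_in.
  have -> : right_end (ev T) o i j Rf (axes R a) = \col_t r j (a j) t.
    apply/colP => t; rewrite [RHS]mxE /r mxE [RHS]mxE; congr (ev T _).
    apply: functional_extensionality_dep => k; case: (eqVneq k i) => // _.
    by case: (eqVneq k j) => // ->; rewrite dfwith_in.
  rewrite [X in _ *m X *m _](eq_bigr (fun q => (al q (a q))%:M + be q (a q) *: Z)) //.
  by move=> q qij; apply: (Hc (Tagged (fun q => 'I_(n q)) (a q))).
have [E trE detE] := traceless_perturb trZ Z0.
exists (fun k => train_tensor i j l r al be (Z + k.+1%:R^-1 *: E)); split=> [k|a].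
  apply: (train_tensor_rank ij).
    by rewrite linearD linearZ /= trZ trE mulr0 addr0.
  by apply: detE; rewrite invr_eq0 pnatr_eq0.
have := cvg_polynomial (polynomial_train i j l r al be Z E a) cvg_inverse.
by rewrite scale0r addr0 -TE.
Qed.

Lemma zclosure_rank_le2_border T : zclosure (rank_le 2) T -> border_rank_le 2 T.
Proof. by move=> /zclosure_rank_le2_flattening/flattening_border. Qed.

End BorderRankTwo.
(** * Symmetric forms of maximal rank *)

Section MaximalRank.
Variable K : numFieldType.

Lemma polynomial_eq0 (f : K^o -> K) : polynomial_fun f ->
  (forall t, t != 0 -> f t = 0) -> f 0 = 0.
Proof.
move=> Pf f0; apply/eqP; apply: contraT => nz.
have Pid : polynomial_fun (fun t : K^o => t : K) by apply: polynomial_linear.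
have [t] := generic_meet Pf Pid nz (oner_neq0 K : (1 : K^o) != 0).
by case: (eqVneq t 0) => [->|/f0 ->]; rewrite ?mulr0 ?mul0r eqxx.
Qed.

(** As the rank of H0 + t H1 is at most r, its minor on the rows of A, bordered by
    v, and the columns of B, bordered by v^T, vanishes for all t.  This minor is t
    times a polynomial with the constant term det (A H0 B) (v H1 v^T). *)
Lemma kernel_isotropic N r (H0 H1 : 'M[K]_N) (A : 'M[K]_(r, N)) (B : 'M[K]_(N, r))
    (v : 'rV[K]_N) :
  (forall t, \rank (H0 + t *: H1)%R <= r)%N -> \det (A *m H0 *m B) != 0 ->
  v *m H0 = 0 -> H0 *m v^T = 0 -> v *m H1 *m v^T = 0.
Proof.
move=> rk dA vH Hv.
pose bordered (t : K) : 'M[K]_(r + 1) := block_mx (A *m (H0 + t *: H1) *m B)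
   (A *m H1 *m v^T) (t *: (v *m H1 *m B)) (v *m H1 *m v^T).
have det0 (t : K) : t != 0 -> \det (bordered t) = 0.
  move=> t0; have E : bordered t *m block_mx 1%:M 0 0 (t%:M : 'M_1) =
      col_mx A v *m (H0 + t *: H1) *m row_mx B v^T.
    rewrite mulmx_block !mulmx1 !mulmx0 !addr0 !add0r !mul_mx_scalar.
    rewrite mul_col_mx mul_col_row.
    have -> : v *m (H0 + t *: H1) = t *: (v *m H1).
      by rewrite mulmxDr vH add0r scalemxAr.
    have -> : A *m (H0 + t *: H1) *m v^T = t *: (A *m H1 *m v^T).
      by rewrite -mulmxA mulmxDl Hv add0r -scalemxAl -scalemxAr mulmxA.
    by rewrite -!scalemxAl.
  have := congr1 (@determinant _ _) E.
  rewrite det_mulmx det_ublock det1 mul1r det_mx11 mxE mulr1n.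
  have -> : \det (col_mx A v *m (H0 + t *: H1) *m row_mx B v^T) = 0.
    apply/eqP; apply: contraT; rewrite -unitfE -unitmxE => /mxrank_unit rkE.
    have : (r + 1 <= r)%N.
      rewrite -[X in (X <= _)%N]rkE; apply: leq_trans (rk t).
      by rewrite (leq_trans (mxrankM_maxl _ _)) ?mxrankM_maxr.
    by rewrite addn1 ltnn.
  by move/eqP; rewrite mulf_eq0 (negPf t0) orbF => /eqP.
have Pdet : polynomial_fun (fun t : K^o => \det (bordered t)).
  apply: polynomial_det => a b.
  pose M0 := block_mx (A *m H0 *m B) (A *m H1 *m v^T) 0 (v *m H1 *m v^T).
  pose M1 := block_mx (A *m H1 *m B) 0 (v *m H1 *m B) (0 : 'M_1).
  have E (t : K) : bordered t = M0 + t *: M1.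
    rewrite /bordered /M0 /M1 scale_block_mx add_block_mx !scaler0 !addr0 add0r.
    by rewrite mulmxDr mulmxDl -scalemxAr -scalemxAl.
  apply: (@polynomial_ext _ _ (fun t : K^o => M0 a b + t * M1 a b)) => [t|].
    by rewrite E !mxE.
  apply: polynomialD; first exact: polynomial_cst.
  by apply: polynomial_linear => c t t'; rewrite mulrDl mulrA.
have := polynomial_eq0 Pdet det0.
rewrite /bordered !scale0r addr0 det_ublock => /eqP.
rewrite mulf_eq0 (negPf dA) det_mx11 => /eqP h.
by apply/matrixP => a b; rewrite !ord1 h mxE.
Qed.

End MaximalRank.
(** * The Bombieri-Weyl form *)

Section Actions.
Variables (R : realType) (p : nat) (n : 'I_p -> nat).
Local Notation C := R[i].
Local Notation family := (forall i, 'rV[C]_(n i)).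
Local Notation squares := (forall i, 'M[C]_(n i)).
Local Notation tensor := (tensor R n).
Local Notation index := (multi_index n).
Implicit Types (x z : tensor) (xi eta : family) (g h : squares) (a b : index).

Definition pairing x z : C := \sum_a x a * z a.

Lemma pairing_pure xi z : pairing (pure xi) z = ev z xi.
Proof. by apply: eq_bigr => a _; rewrite ffunE mulrC. Qed.

Lemma pairingPl c x x' z : pairing (c *: x + x') z = c * pairing x z + pairing x' z.
Proof.
rewrite /pairing mulr_sumr -big_split; apply: eq_bigr => a _ /=.
by rewrite !ffunE mulrDl -mulrA.
Qed.

Definition unit_tensor a : tensor := [ffun b => ((b == a)%:R : C^o)].

Lemma pairing_unit x a : pairing x (unit_tensor a) = x a.
Proof.
rewrite /pairing (bigD1 a) //= ffunE eqxx mulr1 big1 ?addr0 // => b ba.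
by rewrite ffunE (negPf ba) mulr0.
Qed.

Lemma pure_axes a : pure (axes R a) = unit_tensor a.
Proof. by apply/ffunP => b; rewrite !ffunE prod_axes. Qed.

Lemma ev_unit a xi : ev (unit_tensor a) xi = \prod_i xi i 0 (a i).
Proof. by rewrite -pure_axes -pairing_pure pure_axes pairing_unit ffunE. Qed.

Lemma tensor_ev_ext x z : ev x =1 ev z -> x = z.
Proof. by move=> xz; apply/ffunP => a; rewrite -!ev_axes. Qed.

Lemma linear_form_pairing (l : tensor -> C) :
  (forall c u v, l (c *: u + v) = c * l u + l v) ->
  forall u, l u = pairing [ffun a => (l (unit_tensor a) : C^o)] u.
Proof.
move=> llin u; have l0 : l 0 = 0.
  by have := llin (-1) 0 0; rewrite scaler0 addr0 mulN1r addNr.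
have uE : u = \sum_b (u b : C) *: unit_tensor b.
  apply/ffunP => b; rewrite sum_ffunE (bigD1 b) //= big1 => [|c cb].
    by rewrite !ffunE eqxx addr0 [_ *: _]mulr1.
  by rewrite !ffunE eq_sym (negPf cb) [_ *: _]mulr0.
transitivity (\sum_b (u b : C) * l (unit_tensor b)); last first.
  by apply: eq_bigr => b _; rewrite ffunE mulrC.
rewrite [in LHS]uE; elim/big_rec2: _ => [//|b y1 y2 _ <-].
by rewrite llin.
Qed.

(** The action is by the matrices on the dual side, so that the evaluation of
    act g z at xi is that of z at the vectors xi i *m g i. *)
Definition act g z : tensor :=
  [ffun a : index => ((\sum_(b : index) z b * \prod_i g i (a i) (b i)) : C^o)].

Lemma ev_act g z xi : ev (act g z) xi = ev z (fun i => xi i *m g i).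
Proof.
rewrite /ev; under eq_bigr do rewrite ffunE mulr_suml.
rewrite exchange_big; apply: eq_bigr => b _ /=.
under eq_bigr do rewrite -mulrA -big_split /=.
rewrite -mulr_sumr; congr (_ * _).
rewrite (big_dffun_distr (fun i k => g i k (b i) * xi i 0 k)).
by apply: eq_bigr => i _; rewrite mxE; apply: eq_bigr => k _; rewrite mulrC.
Qed.

Lemma act_linear g : linear (act g).
Proof.
move=> c x z; apply: tensor_ev_ext => xi.
by rewrite ev_act !evP !ev_act.
Qed.

Lemma actM g h z : act g (act h z) = act (fun i => g i *m h i) z.
Proof.
apply: tensor_ev_ext => xi; rewrite !ev_act; congr (ev z _).
by apply: functional_extensionality_dep => i; rewrite mulmxA.
Qed.

Lemma act1 z : act (fun i => 1%:M) z = z.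
Proof.
apply: tensor_ev_ext => xi; rewrite ev_act; congr (ev z _).
by apply: functional_extensionality_dep => i; rewrite mulmx1.
Qed.

Lemma actK g z : (forall i, g i \in unitmx) ->
  act g (act (fun i => invmx (g i)) z) = z.
Proof.
move=> gu; rewrite actM -[RHS]act1; congr (act _ z).
by apply: functional_extensionality_dep => i; rewrite mulmxV.
Qed.

Lemma actVK g z : (forall i, g i \in unitmx) ->
  act (fun i => invmx (g i)) (act g z) = z.
Proof.
move=> gu; rewrite actM -[RHS]act1; congr (act _ z).
by apply: functional_extensionality_dep => i; rewrite mulVmx.
Qed.

Lemma act_pure g xi : act g (pure xi) = pure (fun i => xi i *m (g i)^T).
Proof.
apply/ffunP => a; rewrite !ffunE.
transitivity (\sum_(b : index) \prod_i (xi i 0 (b i) * g i (a i) (b i))).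
  by apply: eq_bigr => b _; rewrite ffunE -big_split.
rewrite (big_dffun_distr (fun i k => xi i 0 k * g i (a i) k)).
by apply: eq_bigr => i _; rewrite mxE; apply: eq_bigr => k _; rewrite mxE.
Qed.

Lemma pairing_act g x z : pairing x (act g z) = pairing (act (fun i => (g i)^T) x) z.
Proof.
rewrite /pairing; under eq_bigr do rewrite ffunE mulr_sumr.
rewrite exchange_big; apply: eq_bigr => b _ /=; rewrite ffunE mulr_suml.
apply: eq_bigr => a _; rewrite [z b * _]mulrC mulrA; congr (_ * _ * _).
by apply: eq_bigr => i _; rewrite mxE.
Qed.

Section Form.
Variable g : forall i : 'I_p, {dot 'rV[R]_(n i) for idfun}.
Local Notation bw := (bombieri_weyl g).

Definition gram : squares := fun i =>
  \matrix_(k, l) complexify g (delta_mx 0 k : 'rV_(n i)) (delta_mx 0 l : 'rV_(n i)).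

Lemma bw_act x y : bw x y = pairing x (act gram y).
Proof.
apply: eq_bigr => a _; rewrite ffunE mulr_sumr; apply: eq_bigr => b _.
by rewrite mulrA; congr (_ * _); apply: eq_bigr => i _; rewrite mxE.
Qed.

Lemma bwC x y : bw x y = bw y x.
Proof.
rewrite /bombieri_weyl exchange_big; apply: eq_bigr => b _; apply: eq_bigr => a _ /=.
rewrite [x a * _]mulrC; congr (_ * _).
by apply: eq_bigr => i _; rewrite complexifyC.
Qed.

Lemma complexify_gram i (x y : 'rV[C]_(n i)) :
  complexify g x y = (x *m gram i *m y^T) 0 0.
Proof.
rewrite complexifyE mxE exchange_big; apply: eq_bigr => l _ /=.
rewrite mxE mulr_suml; apply: eq_bigr => k _; rewrite !mxE.
by rewrite mulrAC.
Qed.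

(** A kernel vector v is orthogonal to its conjugate, and the bilinear form takes
    on this pair the value g (Re v) (Re v) + g (Im v) (Im v). *)
Lemma gram_unit i : gram i \in unitmx.
Proof.
rewrite -row_free_unit; apply/inj_row_free => v vG.
pose w := map_mx (fun c : C => (c^*)%C) v.
have : complexify g v w = 0 by rewrite complexify_gram vG mul0mx mxE.
rewrite /complexify /=.
have -> : map_mx (@complex.Re R) w = map_mx (@complex.Re R) v.
  by apply/rowP => k; rewrite !mxE; case: (v 0 k).
have -> : map_mx (@complex.Im R) w = - map_mx (@complex.Im R) v.
  by apply/rowP => k; rewrite !mxE; case: (v 0 k).
rewrite linearN /= opprK => -[/eqP + _].
have gt0 (r : 'rV[R]_(n i)) : r != 0 -> 0 < g i r r by apply: neq0_dnorm_gt0.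
have pos (r : 'rV[R]_(n i)) : 0 <= g i r r.
  by case: (eqVneq r 0) => [->|/gt0/ltW //]; rewrite linear0l.
have pos0 (r : 'rV[R]_(n i)) : g i r r == 0 -> r = 0.
  by case: (eqVneq r 0) => // /gt0; rewrite lt_def => /andP[/negPf ->].
rewrite paddr_eq0; [move=> /andP[/pos0 re0 /pos0 im0] | exact: pos | exact: pos].
apply/rowP => k; rewrite mxE.
move/rowP/(_ k): re0; move/rowP/(_ k): im0; rewrite !mxE.
by case: (v 0 k) => a b /= -> ->.
Qed.

(** The Bombieri-Weyl dual of a tensor, through which normal vectors are turned
    into multilinear forms. *)
Definition sharp z : tensor := act (fun i => invmx (gram i)) z.

Lemma bw_sharp x z : bw x (sharp z) = pairing x z.
Proof. by rewrite bw_act actK //; apply: gram_unit. Qed.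

Lemma sharpK y : sharp (act gram y) = y.
Proof. by apply: actVK; apply: gram_unit. Qed.

End Form.

(** ** The annihilator of the annihilator *)

(** A subspace is the annihilator of its annihilator.  A is not given with a basis:
    a subspace of maximal dimension inside A is all of A. *)
Lemma subspace_separation (A : set tensor) x :
  A 0 -> (forall c u v, A u -> A v -> A (c *: u + v)) ->
  (forall z, (forall u, A u -> pairing u z = 0) -> pairing x z = 0) -> A x.
Proof.
move=> A0 Alin Hx.
pose inA d := exists2 U : {vspace tensor}, \dim U = d & forall u, u \in U -> A u.
have [||d [U <- UA] Umax] := @exists_max inA (\dim {: tensor}) 0.
- by exists 0%VS; rewrite ?dimv0 // => u; rewrite memv0 => /eqP ->.
- by move=> d [U <- _]; apply: dimvS; apply: subvf.
have AU u : A u -> u \in U.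
  move=> Au; apply: contraT => uU.
  have ltU : (\dim U < \dim (<[u]> + U))%N.
    rewrite ltn_neqAle dimvS ?addvSr // andbT; apply: contra uU => /eqP dU.
    suff -> : U = (<[u]> + U)%VS.
      by apply: subvP (addvSl _ _) _ _; apply: memv_line.
    by apply/eqP; rewrite eqEdim addvSr dU /=.
  have := Umax (\dim (<[u]> + U)%VS); rewrite leqNgt ltU => H.
  suff: false by []; apply: H; exists (<[u]> + U)%VS => // w.
  case/memv_addP => _ /vlineP[c ->] [u' /UA Au' ->].
  exact: Alin.
apply: UA; apply: contraT => xU.
pose proj (w : tensor) := w - projv U w.
have projP c u v : proj (c *: u + v) = c *: proj u + proj v.
  by rewrite /proj linearP scalerBr addrACA opprD.
have projU u : A u -> proj u = 0.
  by move=> /AU uU; rewrite /proj projv_id // subrr.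
have [a xa] : exists a, proj x a != 0.
  apply: contrapT => h; case/negP: xU; suff -> : x = projv U x by apply: memv_proj.
  apply/eqP; rewrite -subr_eq0; apply/eqP/ffunP => a; rewrite [RHS]ffunE.
  by apply/eqP; apply: contraT => xa; case: h; exists a.
pose z : tensor := [ffun b => (proj (unit_tensor b) a : C^o)].
have pairing_z u : pairing u z = proj u a.
  rewrite (@linear_form_pairing (fun u => proj u a)) /pairing.
    by apply: eq_bigr => b _; rewrite mulrC.
  by move=> c u' v; rewrite projP !ffunE.
move/eqP: xa; rewrite -pairing_z; case; apply: Hx => u /projU pu.
by rewrite pairing_z pu ffunE.
Qed.

End Actions.
(** * Generic normal vectors *)

Section GenericNormals.
Variable K : numFieldType.
Implicit Types U W : vectType K.

Lemma has_dcurve_linear_eq0 W (gamma : K -> W) w (l : W -> K) :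
  (forall c x y, l (c *: x + y) = c * l x + l y) ->
  has_dcurve gamma w -> (forall t, l (gamma t) = 0) -> l w = 0.
Proof.
move=> llin dg l0; have [P lP] := polynomial_linear llin.
have dl : pdiff P (gamma 0) w = l w.
  apply: has_dpath_uniq (has_dpath_line (gamma 0) w P) _.
  apply: has_dpath_ext (has_dpath_affine (l (gamma 0)) (l w)) => t.
  by rewrite -lP [gamma 0 + _]addrC llin addrC.
rewrite -dl; apply: has_dpath_uniq (has_dpath_curve P dg) _.
by exists 0; rewrite deriv0 horner0; split=> // t; rewrite -lP l0 horner0.
Qed.

(** At a generic point of the closure of the image of psi, a linear form kills the
    tangent space as soon as it vanishes on the images of the lines in enough
    directions, because the tangent space consists of velocities. *)
Lemma generic_normal U W (I : finType) (psi : U -> W) : polynomial_map psi ->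
  exists q : U -> K, [/\ polynomial_fun q, exists u, q u != 0 &
    forall u, q u != 0 -> regular_point (zclosure (range psi)) (psi u) /\
    forall l : W -> K, (forall c x y, l (c *: x + y) = c * l x + l y) ->
      (forall v, exists2 F : I -> U, v = \sum_i F i &
         forall i t, l (psi (u + t *: F i)) = 0) ->
      forall w, tangent_space (zclosure (range psi)) (psi u) w -> l w = 0].
Proof.
move=> Ppsi; have [D HD] := polynomial_diff Ppsi.
have [q [Pq qn0 Hq]] := generic_smoothness Ppsi HD; exists q; split=> // u qu.
have [reg tan] := Hq u qu; split=> // l llin dirs w /tan[v ->].
have l0 : l 0 = 0.
  by have := llin (-1) 0 0; rewrite scaler0 addr0 mulN1r addNr.
have [F -> F0] := dirs v; rewrite linear_sum.
elim/big_ind: _ => [//|x y x0 y0|i _].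
  by rewrite -[x]scale1r llin x0 y0 mulr0 addr0.
exact: has_dcurve_linear_eq0 llin (HD u (F i)) (F0 i).
Qed.

End GenericNormals.

(** * Normal vectors of the rank one cone at a coordinate axis *)

Section NormalAtAxis.
Variables (R : realType) (p : nat) (n : 'I_p -> nat).
Local Notation C := R[i].
Local Notation family := (forall i, 'rV[C]_(n i)).
Local Notation tensor := (tensor R n).
Local Notation index := (multi_index n).
Hypothesis p_gt0 : (0 < p)%N.
Implicit Types (x z : tensor) (xi eta v w : family) (a b : index).

(** For y = sharp z this is orthogonality of y to the tangent space of the rank one
    cone at the pure tensor of xi. *)
Definition normal_at xi z : Prop :=
  forall i (v : 'rV[C]_(n i)), ev z (dfwith xi v) = 0.

Variable o : index.
Local Notation e := (axes R o).

Definition far a := (1 < #|[pred i | a i != o i]|)%N.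

Lemma nearP a : reflect (exists i, forall k, k != i -> a k = o k) (~~ far a).
Proof.
rewrite /far -leqNgt; apply: (iffP card_le1_eqP) => [h|[i ai] k l].
  case: (pickP [pred i | a i != o i]) => [i ai|none].
    exists i => k ki; apply/eqP; apply: contraT => ak.
    by case/eqP: ki; apply: h.
  by exists (Ordinal p_gt0) => k _; apply/eqP; have := none k => /negbFE.
rewrite !inE => ak al.
have -> : k = i by apply/eqP; apply: contraT => /ai/eqP; rewrite (negPf ak).
by apply/eqP; apply: contraT => /ai/eqP; rewrite (negPf al).
Qed.

(** The tensors normal to the cone at the axis o are those without entries at the
    multi-indices that differ from o in at most one slot; mask is the projection
    onto them. *)
Definition mask z : tensor := [ffun a : index => (if far a then z a else 0 : C^o)].

Lemma mask_linear : linear mask.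
Proof.
move=> c y z; apply/ffunP => a; rewrite !ffunE.
by case: ifP => // _; rewrite scaler0 addr0.
Qed.

Lemma mask_vanish z i eta :
  (forall k, k != i -> exists s, eta k = s *: e k) -> ev (mask z) eta = 0.
Proof.
move=> he; rewrite /ev big1 // => a _; rewrite ffunE; case: ifP => [fa|]; last first.
  by rewrite mul0r.
have [k ki ak] : exists2 k, k != i & a k != o k.
  apply: contrapT => h; move/negP: fa; apply; apply/negP/nearP; exists i => k ki.
  by apply/eqP; apply: contraT => ak; case: h; exists k.
have [s hk] := he k ki.
by rewrite (bigD1 k) //= hk !mxE (negPf ak) andbF mulr0 mul0r mulr0.
Qed.

Lemma mask_normal z : normal_at e (mask z).
Proof.
move=> i v; apply: (@mask_vanish _ i) => k ki; exists 1.
by rewrite dfwith_out 1?eq_sym // scale1r.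
Qed.

Lemma mask_id z : normal_at e z -> mask z = z.
Proof.
move=> nz; apply/ffunP => a; rewrite ffunE; case: ifPn => // /nearP[i ai].
rewrite -ev_axes -(nz i (axes R a i)); congr ev.
apply: functional_extensionality_dep => k; case: (eqVneq i k) => [<-|ik].
  by rewrite dfwith_in.
by rewrite dfwith_out // /axes ai // eq_sym.
Qed.

Lemma mask_unit b : far b -> mask (unit_tensor R b) = unit_tensor R b.
Proof.
move=> fb; apply/ffunP => a; rewrite !ffunE.
by case: (eqVneq a b) => [->|_]; rewrite ?fb // if_same.
Qed.

Lemma ev_dfwith_sum z xi i (w : 'rV[C]_(n i)) :
  ev z (dfwith xi w) = \sum_k w 0 k * ev z (dfwith xi (delta_mx 0 k)).
Proof.
rewrite {1}[w]row_sum_delta; elim/big_rec2: _ => [|k y1 y2 _ <-].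
  by rewrite -(scale0r 0) ev_dfwithZ mul0r.
by rewrite ev_dfwithP.
Qed.

(** ** The Hessian of a normal vector *)

Definition slot_index := {i : 'I_p & 'I_(n i)}.

(** The second fundamental form of the cone of rank one tensors at the axis, in
    the normal direction z. *)
Definition hessian z : 'M[C]_#|{: slot_index}| := \matrix_(s, t)
  let: (k, l) := (enum_val s : slot_index, enum_val t : slot_index) in
  if tag k == tag l then 0 else
  ev z (dfwith (dfwith e (delta_mx 0 (tagged k) : 'rV[C]_(n (tag k))))
                         (delta_mx 0 (tagged l) : 'rV[C]_(n (tag l)))).

Definition coordinates v : 'rV[C]_#|{: slot_index}| :=
  \row_s v (tag (enum_val s : slot_index)) 0 (tagged (enum_val s : slot_index)).

Lemma hessian_sym z : (hessian z)^T = hessian z.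
Proof.
apply/matrixP => s t; rewrite !mxE eq_sym; case: eqP => // /eqP st.
by rewrite dfwithC // eq_sym.
Qed.

Lemma hessian_linear c y z : hessian (c *: y + z) = c *: hessian y + hessian z.
Proof.
apply/matrixP => s t; rewrite !mxE; case: eqP => _; last by rewrite evP.
by rewrite mulr0 addr0.
Qed.

Lemma sum_slot_index (F : forall i, 'I_(n i) -> C) :
  \sum_(s < #|{: slot_index}|)
    F (tag (enum_val s : slot_index)) (tagged (enum_val s : slot_index)) =
  \sum_i \sum_k F i k.
Proof.
rewrite (sig_big_dep (fun=> true) (fun _ _ => true)) /=.
by rewrite [RHS](reindex (enum_val : 'I_#|{: slot_index}| -> slot_index)) //;
  apply: onW_bij; apply: enum_val_bij.
Qed.

Lemma coordinates_hessian z v s : (coordinates v *m hessian z) 0 s =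
  \sum_(i | i != tag (enum_val s : slot_index)) ev z
    (dfwith (dfwith e (delta_mx 0 (tagged (enum_val s : slot_index)))) (v i)).
Proof.
rewrite mxE; pose t : slot_index := enum_val s.
transitivity (\sum_i \sum_k (v i 0 k * if i == tag t then 0 else
   ev z (dfwith (dfwith e (delta_mx 0 (tagged t) : 'rV[C]_(n (tag t))))
     (delta_mx 0 k : 'rV[C]_(n i))))).
  rewrite -sum_slot_index; apply: eq_bigr => r _; rewrite !mxE /=; congr (_ * _).
  by case: eqP => // /eqP rt; rewrite dfwithC.
rewrite [RHS]big_mkcond; apply: eq_bigr => i _; rewrite ev_dfwith_sum.
by case: eqP => _ //=; rewrite big1 // => k _; rewrite mulr0.
Qed.

Lemma hessian_quadratic z v : (coordinates v *m hessian z *m (coordinates v)^T) 0 0 =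
  \sum_j \sum_(i | i != j) ev z (dfwith (dfwith e (v j)) (v i)).
Proof.
rewrite mxE; pose F j k := \sum_(i | i != j)
  ev z (dfwith (dfwith e (delta_mx 0 k : 'rV[C]_(n j))) (v i)) * v j 0 k.
transitivity (\sum_j \sum_k F j k).
  rewrite -sum_slot_index; apply: eq_bigr => s _.
  by rewrite coordinates_hessian [X in _ * X]mxE [X in _ * X]mxE mulr_suml.
apply: eq_bigr => j _; rewrite exchange_big /=; apply: eq_bigr => i ij.
rewrite dfwithC 1?eq_sym // [RHS]ev_dfwith_sum; apply: eq_bigr => k _.
by rewrite mulrC dfwithC // eq_sym.
Qed.

(** At most one component of an isotropic v is off the axis, because the
    Hessian of the unit tensor at a multi-index b that differs from o in the
    slots i and j takes the value 2 v_i v_j. *)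
Lemma isotropic_support v : (forall i, v i 0 (o i) = 0) ->
  (forall z, coordinates v *m hessian (mask z) *m (coordinates v)^T = 0) ->
  exists i, forall j, j != i -> v j = 0.
Proof.
move=> vo Hv; case: (pselect (exists i, v i != 0)) => [[i vi]|v0]; last first.
  exists (Ordinal p_gt0) => j _; apply/eqP; apply: contraT => vj.
  by case: v0; exists j.
exists i => j ji; apply/rowP => l; rewrite mxE.
have [k vik] : exists k, v i 0 k != 0.
  apply: contrapT => h; case/eqP: vi; apply/rowP => k; rewrite mxE.
  by apply/eqP; apply: contraT => ?; case: h; exists k.
case: (eqVneq l (o j)) => [->//|lo].
have ko : k != o i by apply: contra vik => /eqP ->; rewrite vo.
pose b : index := finfun (dfwith (dfwith o k) l).
have bj : b j = l by rewrite ffunE dfwith_in.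
have bi : b i = k by rewrite ffunE dfwith_out // dfwith_in.
have bq q : q != i -> q != j -> b q = o q.
  by move=> qi qj; rewrite ffunE !dfwith_out // eq_sym.
have fb : far b.
  apply: contraT => /nearP[q bo].
  case: (eqVneq i q) => [iq|iq]; last by rewrite -bi (bo i) // eqxx in ko.
  by rewrite -bj (bo j) ?eqxx // -iq in lo.
have e0 q : b q != o q -> e q 0 (b q) = 0.
  by move=> bo; rewrite mxE (negPf bo) andbF.
have term q r : r != q -> ev (unit_tensor R b) (dfwith (dfwith e (v q)) (v r)) =
    if (q == i) && (r == j) || (q == j) && (r == i) then v i 0 k * v j 0 l else 0.
  move=> rq; rewrite ev_unit.
  have val s : dfwith (dfwith e (v q)) (v r) s 0 (b s) =
      if (s == r) || (s == q) then v s 0 (b s) else e s 0 (b s).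
    case: (eqVneq r s) => [<-|rs]; first by rewrite dfwith_in.
    rewrite dfwith_out //; case: (eqVneq q s) => [<-|qs].
      by rewrite dfwith_in.
    by rewrite dfwith_out.
  have zero s : s != r -> s != q -> b s != o s ->
      \prod_t dfwith (dfwith e (v q)) (v r) t 0 (b t) = 0.
    by move=> sr sq bs; rewrite (bigD1 s) //= val (negPf sr) (negPf sq) e0 ?mul0r.
  have bio : b i != o i by rewrite bi.
  have bjo : b j != o j by rewrite bj.
  have both : (i == r) || (i == q) -> (j == r) || (j == q) ->
      \prod_t dfwith (dfwith e (v q)) (v r) t 0 (b t) = v i 0 k * v j 0 l.
    move=> iE jE; rewrite (bigD1 i) //= (bigD1 j) //= !val iE jE bi bj big1 ?mulr1 //.
    move=> s /andP[si sj]; rewrite val; case: ifP => [sE|_].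
      move: iE jE sE si sj ji rq.
      by case/orP => /eqP ->; case/orP => /eqP ->; case/orP => /eqP ->;
        rewrite ?eqxx.
    by rewrite mxE bq ?eqxx.
  case: ifP => [qr|].
    by apply: both; case/orP: qr => /andP[/eqP -> /eqP ->]; rewrite !eqxx ?orbT.
  case: (boolP ((i == r) || (i == q))) => [iE|]; last first.
    by rewrite negb_or => /andP[ir iq] _; apply: (zero i).
  case: (boolP ((j == r) || (j == q))) => [jE|]; last first.
    by rewrite negb_or => /andP[jr jq] _; apply: (zero j).
  move: iE jE ji rq.
  by case/orP => /eqP ->; case/orP => /eqP ->; rewrite ?eqxx ?orbT.
have := Hv (unit_tensor R b); rewrite mask_unit // => /matrixP/(_ 0 0).
rewrite hessian_quadratic mxE.
under eq_bigr => q _ do under eq_bigr => r rq do rewrite term //.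
rewrite (bigD1 i) //= (bigD1 j) //= big1 => [|r /andP[ri rj]]; last first.
  by rewrite (negPf rj) eqxx /= eq_sym (negPf ji).
rewrite !eqxx /= addr0 (bigD1 j) //= (bigD1 i) //=; last by rewrite eq_sym.
rewrite big1 => [|r /andP[rj ri]]; last by rewrite (negPf ri) (negPf ji) andbF.
rewrite !eqxx andbT orbT addr0 big1 => [|q /andP[qi qj]]; last first.
  by rewrite big1 // => r _; rewrite (negPf qi) (negPf qj).
rewrite addr0 -mulr2n => /eqP; rewrite mulrn_eq0 /= mulf_eq0 (negPf vik) => /eqP.
by [].
Qed.

End NormalAtAxis.
(** * Vectors normal to the dual variety *)

Section Contact.
Variables (R : realType) (p : nat) (n : 'I_p -> nat).
Local Notation C := R[i].
Local Notation family := (forall i, 'rV[C]_(n i)).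
Local Notation squares := (forall i, 'M[C]_(n i)).
Local Notation tensor := (tensor R n).
Local Notation index := (multi_index n).
Hypothesis p_gt0 : (0 < p)%N.
Variable o : index.
Local Notation e := (axes R o).
Local Notation far := (far o).
Local Notation mask := (@mask R p n o).
Local Notation hessian := (@hessian R p n o).
Implicit Types (x z : tensor) (a b : index).

Definition off_axis x : family := fun j =>
  \row_k if k == o j then 0 else x (finfun (dfwith o k)).

(** A tensor supported near o is tangent to the cone at the axis. *)
Lemma axis_decomposition x : (forall a, far a -> x a = 0) ->
  x = (x o : C) *: pure e + \sum_j pure (dfwith e (off_axis x j)).
Proof.
move=> x0; apply/ffunP => a; rewrite pure_axes !ffunE sum_ffunE.
under eq_bigr => j _ do rewrite pure_dfwith.
have term j : j \in predT -> (exists2 k, k != j & a k != o k) ->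
    off_axis x j 0 (a j) * \prod_(k | k != j) e k 0 (a k) = 0.
  by move=> _ [k kj ak]; rewrite (bigD1 k) //= [e k 0 _]mxE (negPf ak) andbF mul0r mulr0.
case: (boolP (far a)) => [fa|/(nearP p_gt0)[i ai]].
  rewrite [X in _ = _ + X]big1 => [|j _]; last first.
    apply: term => //; apply: contrapT => h; move/negP: fa; apply.
    apply/negP/(nearP p_gt0); exists j => k kj; apply/eqP.
    by apply: contraT => ak; case: h; exists k.
  case: (eqVneq a o) => [ao|_]; last by rewrite (x0 a fa) [_ *: _]mulr0 addr0.
  move: fa; rewrite ao; suff /negPf -> : ~~ far o by [].
  by apply/(nearP p_gt0); exists (Ordinal p_gt0).
have prod1 : \prod_(k | k != i) e k 0 (a k) = 1.
  by rewrite big1 // => k ki; rewrite mxE ai ?eqxx.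
rewrite (bigD1 i) //= prod1 mulr1 mxE.
case: (eqVneq (a i) (o i)) => [aio|aio].
  have -> : a = o by apply/ffunP => k; case: (eqVneq k i) => [->//|/ai].
  rewrite eqxx [_ *: _]mulr1 add0r big1 ?addr0 // => j ji.
  by rewrite mxE eqxx mul0r.
rewrite big1 => [|j ji]; last by apply: term => //; exists i; rewrite // eq_sym.
case: (eqVneq a o) => [ao|_]; first by rewrite ao eqxx in aio.
rewrite [_ *: _]mulr0 add0r addr0; congr (x _); apply/ffunP => k; rewrite ffunE.
case: (eqVneq i k) => [<-|ik]; first by rewrite dfwith_in.
by rewrite dfwith_out // ai // eq_sym.
Qed.

Lemma rank_one_off_axis x i : (forall a, far a -> x a = 0) ->
  (forall j, j != i -> off_axis x j = 0) -> rank_one_cone x.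
Proof.
move=> x0 v0; rewrite (axis_decomposition x0) (bigD1 i) //= big1 => [|j ji].
  rewrite addr0 -{1}(dfwith_id e i) -pure_dfwithP.
  by exists (dfwith e ((x o : C) *: e i + off_axis x i)).
rewrite v0 //; apply/ffunP => a; rewrite pure_dfwith !mxE mul0r.
by rewrite ffunE.
Qed.

(** Only the elementary matrices M with row o i matter: they replace the vector of
    the axis in the slot i by any other vector. *)
Lemma off_axis_kernel x z : (forall a, far a -> x a = 0) -> normal_at e z ->
  (forall i (M : 'M[C]_(n i)), pairing x (act (dfwith (fun=> 1%:M) M) z) = 0) ->
  coordinates (off_axis x) *m hessian z = 0.
Proof.
move=> x0 nz Hx; apply/rowP => s; rewrite coordinates_hessian mxE.
set t : slot_index n := enum_val s; set i := tag t.
pose M : 'M[C]_(n i) := delta_mx (o i) (tagged t).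
have shift eta : (fun q => eta q *m dfwith (fun=> 1%:M) M q) =
    dfwith eta (eta i *m M).
  apply: functional_extensionality_dep => q; case: (eqVneq i q) => [<-|iq].
    by rewrite !dfwith_in.
  by rewrite !dfwith_out // mulmx1.
have eM : e i *m M = delta_mx 0 (tagged t) by rewrite mul_delta_mx.
transitivity (pairing x (act (dfwith (fun=> 1%:M) M) z)); last exact: Hx.
rewrite [in RHS](axis_decomposition x0) pairingPl pairing_pure ev_act shift nz mulr0 add0r.
rewrite big_mkcond.
have pairing_sum (F : 'I_p -> tensor) (w : tensor) :
    pairing (\sum_j F j) w = \sum_j pairing (F j) w.
  elim/big_rec2: _ => [|j y1 y2 _ <-].
    by rewrite /pairing big1 // => a _; rewrite ffunE mul0r.
  by rewrite -[F j]scale1r pairingPl mul1r scale1r.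
rewrite pairing_sum; apply: eq_bigr => j _; rewrite pairing_pure ev_act shift.
case: (eqVneq j i) => [->|ji] /=; first by rewrite dfwith2 nz.
by rewrite (dfwith_out _ _ ji) eM dfwithC // eq_sym.
Qed.

(** For a normal vector z0 whose Hessian has maximal rank, a tangent vector x that
    is orthogonal to the orbit of z0 is a kernel vector of the Hessian of z0; by
    maximality it is isotropic for all Hessians, hence of rank one. *)
Lemma contact_rank_one r (A : 'M[C]_(r, #|{: slot_index n}|))
    (B : 'M[C]_(#|{: slot_index n}|, r)) x z0 :
  (forall z, \rank (hessian (mask z)) <= r)%N ->
  \det (A *m hessian (mask z0) *m B) != 0 ->
  (forall z, pairing x (mask z) = 0) ->
  (forall i (M : 'M[C]_(n i)), pairing x (act (dfwith (fun=> 1%:M) M) (mask z0)) = 0) ->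
  rank_one_cone x.
Proof.
move=> rk dA xL xg.
have x0 a : far a -> x a = 0 by move=> fa; rewrite -pairing_unit -(mask_unit R fa).
have ker := off_axis_kernel x0 (@mask_normal _ _ _ p_gt0 _ _) xg.
have [i vi] : exists i, forall j, j != i -> off_axis x j = 0.
  apply: (isotropic_support p_gt0 (o := o)) => [j|z]; first by rewrite mxE eqxx.
  apply: (kernel_isotropic (H0 := hessian (mask z0)) _ dA ker) => [t|].
    rewrite addrC -hessian_linear -(mask_linear o); exact: rk.
  by apply: trmx_inj; rewrite trmx_mul trmxK hessian_sym ker trmx0.
exact: rank_one_off_axis vi.
Qed.

(** The statement is carried from the axis to the other points of the cone by an
    invertible g. *)
Lemma contact_rank_one_orbit r (A : 'M[C]_(r, #|{: slot_index n}|))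
    (B : 'M[C]_(#|{: slot_index n}|, r)) (g : squares) x z0 :
  (forall z, \rank (hessian (mask z)) <= r)%N ->
  \det (A *m hessian (mask z0) *m B) != 0 -> (forall i, g i \in unitmx) ->
  (forall z, pairing x (act g (mask z)) = 0) ->
  (forall i (M : 'M[C]_(n i)), pairing x (act (dfwith g M) (mask z0)) = 0) ->
  rank_one_cone x.
Proof.
move=> rk dA gu xL xg.
have gTu i : (g i)^T \in unitmx by rewrite unitmx_tr.
have [xi _ xiE] : rank_one_cone (act (fun i => (g i)^T) x).
  apply: (contact_rank_one rk dA) => [z|i M]; rewrite -pairing_act; first exact: xL.
  rewrite actM -(xg i (g i *m M)); congr (pairing x (act _ _)).
  apply: functional_extensionality_dep => q; case: (eqVneq i q) => [<-|iq].
    by rewrite !dfwith_in.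
  by rewrite !dfwith_out // mulmx1.
by rewrite -(actVK x gTu) -xiE act_pure; eexists.
Qed.

(** The choice of a minor makes maximality of the rank a polynomial condition. *)
Lemma exists_maximal_minor : exists r (A : 'M[C]_(r, #|{: slot_index n}|))
    (B : 'M[C]_(#|{: slot_index n}|, r)),
  (forall z, \rank (hessian (mask z)) <= r)%N /\
  exists z0, \det (A *m hessian (mask z0) *m B) != 0.
Proof.
pose has_rank r := exists z, \rank (hessian (mask z)) = r.
have [||r [z0 <-] rmax] := @exists_max has_rank #|{: slot_index n}|
  (\rank (hessian (mask 0))).
- by exists 0.
- by move=> r [z <-]; apply: rank_leq_row.
set H := hessian (mask z0).
have [A HA] := row_fullP (col_base_full H); have [B HB] := row_freeP (row_base_free H).
exists (\rank H), A, B; split=> [z|]; first by apply: rmax; exists z.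
have AHB : A *m H *m B = 1%:M.
  by rewrite -[X in A *m X](mulmx_base H) mulmxA HA mul1mx.
by exists z0; rewrite -/H AHB det1 oner_neq0.
Qed.

End Contact.
(** * The conormal varieties *)

Section RankOneClosed.
Variables (R : realType) (p : nat) (n : 'I_p -> nat).
Local Notation C := R[i].
Local Notation tensor := (tensor R n).
Local Notation X := (@rank_one_cone R p n).
Hypothesis p_gt0 : (0 < p)%N.

Lemma rank_one_two_slot_minors (T : tensor) : X T -> two_slot_minors T.
Proof.
move=> [x _ <-] xi i j v w ij; rewrite !ev_pure.
pose f (eta : forall k, 'rV[C]_(n k)) k := \sum_l x k 0 l * eta k 0 l.
have split eta : \prod_k f eta k = f eta i *
    (f eta j * \prod_(k | (k != i) && (k != j)) f eta k).
  by rewrite (bigD1 i) //= (bigD1 j) // eq_sym.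
have rest eta eta' : (forall k, k != i -> k != j -> eta' k = eta k) ->
    \prod_(k | (k != i) && (k != j)) f eta' k =
    \prod_(k | (k != i) && (k != j)) f eta k.
  by move=> ee; apply: eq_bigr => k /andP[ki kj]; rewrite /f ee.
rewrite -!/(f _ _) (split xi) (split (dfwith _ v)) (split (dfwith xi w)).
rewrite (split (dfwith (dfwith xi v) w)).
rewrite (rest xi (dfwith xi v)) => [|k ki kj]; last by rewrite dfwith_out // eq_sym.
rewrite (rest xi (dfwith xi w)) => [|k ki kj]; last by rewrite dfwith_out // eq_sym.
rewrite (rest xi (dfwith (dfwith xi v) w)) => [|k ki kj]; last first.
  by rewrite !dfwith_out // eq_sym.
have -> : f (dfwith (dfwith xi v) w) i = f (dfwith xi v) i.
  by rewrite /f dfwith_out // eq_sym.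
have -> : f (dfwith (dfwith xi v) w) j = f (dfwith xi w) j by rewrite /f !dfwith_in.
have -> : f (dfwith xi v) j = f xi j by rewrite /f dfwith_out.
have -> : f (dfwith xi w) i = f xi i by rewrite /f dfwith_out // eq_sym.
by ring.
Qed.

(** The minors in two slots are equations of the cone by [two_slot_minors_pure]. *)
Lemma rank_one_zclosed : zclosed X.
Proof.
apply/seteqP; split; last exact: zclosure_sub.
move=> T clT; apply: two_slot_minors_pure => // xi i j v w ij.
apply/eqP; rewrite -subr_eq0; apply/eqP; move: T clT.
apply: zclosure_fun => [|T XT]; last by rewrite (rank_one_two_slot_minors XT) // subrr.
by apply: polynomialB; apply: polynomialM; apply: polynomial_ev.
Qed.

End RankOneClosed.

Section ConormalVarieties.
Variables (R : realType) (p : nat) (n : 'I_p -> nat).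
Variable g : forall i : 'I_p, {dot 'rV[R]_(n i) for idfun}.
Local Notation C := R[i].
Local Notation family := (forall i, 'rV[C]_(n i)).
Local Notation squares := (forall i, 'M[C]_(n i)).
Local Notation tensor := (tensor R n).
Local Notation index := (multi_index n).
Local Notation X := (@rank_one_cone R p n).
Local Notation bw := (bombieri_weyl g).
Local Notation sharp := (sharp g).
Local Notation gram := (gram g).
Hypothesis p_gt0 : (0 < p)%N.
Implicit Types (x y z : tensor) (xi : family).

Lemma bwPl y c u v : bw (c *: u + v) y = c * bw u y + bw v y.
Proof. by rewrite !bw_act pairingPl. Qed.

Lemma bwPr y c u v : bw y (c *: u + v) = c * bw y u + bw y v.
Proof. by rewrite ![bw y _]bwC bwPl. Qed.

Lemma bw_pure xi y : bw (pure xi) y = ev (act gram y) xi.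
Proof. by rewrite bw_act pairing_pure. Qed.

(** ** Tangent vectors of the rank one cone *)

Lemma tangent_rank_one xi i (v : 'rV[C]_(n i)) :
  tangent_space X (pure xi) (pure (dfwith xi v)).
Proof.
move=> P PX; apply: pdiff_eq0 => t; apply: PX.
rewrite -{1}(dfwith_id xi i) addrC -pure_dfwithP.
by eexists.
Qed.

Lemma tangent_rank_one0 xi : tangent_space X 0 (pure xi).
Proof.
move=> P PX; apply: pdiff_eq0 => t; rewrite add0r; apply: PX.
by apply: rank_one_scale => //; eexists.
Qed.

Lemma normal_space_pure xi y : Defs.normal_space bw X (pure xi) y ->
  normal_at xi (act gram y).
Proof. by move=> Ny i v; rewrite -bw_pure; apply: Ny; apply: tangent_rank_one. Qed.

Lemma normal_space0 y : Defs.normal_space bw X 0 y -> y = 0.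
Proof.
move=> Ny; rewrite -(sharpK g y); suff -> : act gram y = 0.
  have := act_linear (fun i => invmx (gram i)) (-1) (0 : tensor) 0.
  by rewrite scaler0 addr0 scaleN1r addNr.
apply: tensor_ev_ext => xi; rewrite ev0 -bw_pure.
by apply: Ny; apply: tangent_rank_one0.
Qed.

(** ** A parametrization of the conormal variety *)

Variable o : index.
Local Notation e := (axes R o).
Local Notation mask := (@mask R p n o).

Definition entries := {i : 'I_p & ('I_(n i) * 'I_(n i))%type}.
Definition params : vectType C :=
  ({ffun entries -> C^o} * tensor * {ffun 'I_p -> C^o})%type.
Implicit Types u : params.

Definition squares_of u : squares := fun i =>
  \matrix_(k, l) (u.1.1 (Tagged (fun i => ('I_(n i) * 'I_(n i))%type) (k, l)) : C).

Definition params_of (h : squares) z (c : 'I_p -> C) : params :=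
  ([ffun t : entries => (h (tag t) (tagged t).1 (tagged t).2 : C^o)], z,
   [ffun i => (c i : C^o)]).

Lemma squares_ofK h z c : squares_of (params_of h z c) = h.
Proof.
apply: functional_extensionality_dep => i; apply/matrixP => k l.
by rewrite mxE ffunE.
Qed.

(** The vectors are mapped to multiples of the axes by the matrices that act on the
    masked tensor ([vectors_ofM]).  The adjugate stands for the inverse, which is
    not polynomial; the scalars make up for the determinant. *)
Definition vectors_of u : family := fun i =>
  (u.2 i : C) *: row (o i) (\adj (squares_of u i)).

Definition conormal_point u : tensor := pure (vectors_of u).
Definition conormal_vector u : tensor := sharp (act (squares_of u) (mask u.1.2)).

Lemma vectors_ofM u i :
  vectors_of u i *m squares_of u i = (u.2 i * \det (squares_of u i)) *: e i.
Proof.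
rewrite -scalemxAl -row_mul mul_adj_mx -scalemx1 linearZ /= row1 scalerA.
by [].
Qed.

Lemma param_normal u (h : squares) z i :
  (forall k, k != i -> h k = squares_of u k) ->
  ev (act h (mask z)) (vectors_of u) = 0.
Proof.
move=> hu; rewrite ev_act; apply: (@mask_vanish _ _ _ p_gt0 o z i) => k ki.
by exists (u.2 k * \det (squares_of u k)); rewrite hu // vectors_ofM.
Qed.

Lemma param_normal_at u : normal_at (vectors_of u) (act (squares_of u) (mask u.1.2)).
Proof.
move=> i v; rewrite ev_act; apply: (@mask_vanish _ _ _ p_gt0 o _ i) => k ki.
exists (u.2 k * \det (squares_of u k)).
by rewrite dfwith_out 1?eq_sym // vectors_ofM.
Qed.

Lemma exists_unit_row m (k : 'I_m) (v : 'rV[C]_m) : v != 0 ->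
  exists2 G : 'M[C]_m, G \in unitmx & row k G = v.
Proof.
move=> v0; have H : delta_mx 0 k *m (delta_mx k 0 *m v) = v.
  rewrite mulmxA mul_delta_mx (_ : delta_mx 0 0 = 1%:M) ?mul1mx //.
  by apply/matrixP => a b; rewrite !ord1 !mxE.
have [|G Gu GE] := @complete_unitmx C 1 m (delta_mx 0 k) (delta_mx k 0 *m v).
  by rewrite H rank_rV v0 rank_rV; case: eqP => // /rowP/(_ k)/eqP;
    rewrite !mxE !eqxx oner_eq0.
by exists G => //; rewrite rowE -GE.
Qed.

(** The group of the invertible squares is transitive on the vectors xi, so normal
    vectors at xi are transported from the axes. *)
Lemma param_surjective xi z : (forall i, xi i != 0) -> normal_at xi z ->
  exists u, [/\ vectors_of u = xi, act (squares_of u) (mask u.1.2) = z &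
    forall i, squares_of u i \in unitmx].
Proof.
move=> xi0 nz.
have exG i : exists G : 'M[C]_(n i), G \in unitmx /\ row (o i) G = xi i.
  by have [G Gu GE] := exists_unit_row (o i) (xi0 i); exists G.
pose G i := projT1 (cid (exG i)).
have Gu i : G i \in unitmx by rewrite /G; case: cid => ? [].
have GE i : row (o i) (G i) = xi i by rewrite /G; case: cid => ? [].
pose u := params_of (fun i => invmx (G i)) (act G z) (fun i => \det (G i)).
have sq : squares_of u = fun i => invmx (G i) by apply: squares_ofK.
exists u; rewrite sq; split=> [||i]; last by rewrite unitmx_inv.
  apply: functional_extensionality_dep => i; rewrite /vectors_of sq -GE.
  have {2}<- : \det (G i) *: \adj (invmx (G i)) = G i.
    by have := invmxK (G i); rewrite {1}/invmx unitmx_inv Gu det_inv invrK.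
  by rewrite /u /params_of /= ffunE linearZ.
rewrite mask_id ?actVK // => i v; rewrite ev_act.
rewrite (_ : (fun k => _) = dfwith xi (v *m G i)) ?nz //.
apply: functional_extensionality_dep => k; case: (eqVneq i k) => [<-|ik].
  by rewrite !dfwith_in.
by rewrite !dfwith_out // -GE rowE.
Qed.

(** *** The parametrization is polynomial *)

Lemma polynomial_squares_of i k l : polynomial_fun (fun u => squares_of u i k l).
Proof.
apply: polynomial_linear => c u v; rewrite !mxE /=.
by rewrite !ffunE.
Qed.

Lemma polynomial_vectors_of i k : polynomial_fun (fun u => vectors_of u i 0 k).
Proof.
apply: (@polynomial_ext _ _ (fun u => u.2 i * ((-1) ^+ (k + o i) *
    \det (row' k (col' (o i) (squares_of u i)))))) => [u|].
  by rewrite !mxE.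
apply: polynomialM; first by apply: polynomial_linear => c u v; rewrite /= !ffunE.
apply: polynomialM (polynomial_cst _ _) _; apply: polynomial_det => a b.
apply: (@polynomial_ext _ _ (fun u => squares_of u i (lift k a) (lift (o i) b))).
  by move=> u; rewrite !mxE.
exact: polynomial_squares_of.
Qed.

Lemma polynomial_conormal_point : polynomial_map conormal_point.
Proof.
apply: polynomial_map_ffun => a.
apply: (@polynomial_ext _ _ (fun u => \prod_i vectors_of u i 0 (a i))) => [u|].
  by rewrite ffunE.
by apply: polynomial_prod => i _; apply: polynomial_vectors_of.
Qed.

Lemma polynomial_conormal_vector : polynomial_map conormal_vector.
Proof.
apply: (@polynomial_map_comp _ _ _ _ (fun u => act (squares_of u) (mask u.1.2)));
  last by apply: polynomial_map_linear; apply: act_linear.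
apply: polynomial_map_ffun => a; apply: (@polynomial_ext _ _
  (fun u => \sum_b (mask u.1.2 b : C) * \prod_i squares_of u i (a i) (b i))) => [u|].
  by rewrite ffunE.
apply: polynomial_sum => b _; apply: polynomialM.
  by apply: polynomial_linear => c u v; rewrite /= mask_linear !ffunE.
by apply: polynomial_prod => i _; apply: polynomial_squares_of.
Qed.

(** ** The conormal variety of the rank one cone *)

Definition flat := {ffun slot_index n -> C^o}.

Definition family_of (w : flat) : family := fun i =>
  \row_k (w (Tagged (fun i => 'I_(n i)) k) : C).

Definition flat_of xi : flat :=
  [ffun t : slot_index n => (xi (tag t) 0 (tagged t) : C^o)].

Lemma flat_ofK xi : family_of (flat_of xi) = xi.
Proof.
by apply: functional_extensionality_dep => i; apply/rowP => k; rewrite mxE ffunE.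
Qed.

Lemma polynomial_family_of i k : polynomial_fun (fun w => family_of w i 0 k).
Proof.
by apply: polynomial_linear => c v w; rewrite !mxE !ffunE.
Qed.

Lemma polynomial_pure_family : polynomial_map (fun w => pure (family_of w) : tensor).
Proof.
apply: polynomial_map_ffun => a.
apply: (@polynomial_ext _ _ (fun w => \prod_i family_of w i 0 (a i))) => [w|].
  by rewrite ffunE.
by apply: polynomial_prod => i _; apply: polynomial_family_of.
Qed.

Lemma range_pure_family : range (fun w => pure (family_of w) : tensor) = X.
Proof.
apply/seteqP; split=> [_ [w _ <-]|_ [xi _ <-]]; first by eexists.
by exists (flat_of xi) => //; rewrite flat_ofK.
Qed.

Lemma flat_direction_sum (v : flat) :
  v = \sum_i [ffun t => if tag t == i then v t else 0].
Proof.
apply/ffunP => t; rewrite sum_ffunE (bigD1 (tag t)) //= ffunE eqxx big1 ?addr0 //.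
by move=> i it; rewrite ffunE eq_sym (negPf it).
Qed.

(** At a generic point of X, the tangent space is spanned by the velocities of
    moving one factor of the pure tensor. *)
Lemma conormal_rank_one u :
  conormal bw X (conormal_point u, conormal_vector u).
Proof.
have [q [Pq [w0 qw0] Hq]] := generic_normal 'I_p polynomial_pure_family.
rewrite range_pure_family rank_one_zclosed // in Hq.
have Pprod : polynomial_fun (fun w => \prod_i family_of w i 0 (o i)).
  by apply: polynomial_prod => i _; apply: polynomial_family_of.
have Pflat : polynomial_map (fun u => flat_of (vectors_of u)).
  apply: polynomial_map_ffun => t.
  apply: (@polynomial_ext _ _ (fun u => vectors_of u (tag t) 0 (tagged t))) => [v|].
    by rewrite ffunE.
  exact: polynomial_vectors_of.
have [w] : exists w, q w * \prod_i family_of w i 0 (o i) != 0.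
  apply: (generic_meet Pq Pprod qw0 (v := flat_of e)); rewrite flat_ofK.
  by rewrite big1 ?oner_neq0 // => i _; rewrite mxE !eqxx.
rewrite mulf_eq0 negb_or => /andP[qw /prodf_neq0 wn0].
have [u1 [u1w _ _]] : exists u1, [/\ vectors_of u1 = family_of w,
    act (squares_of u1) (mask u1.1.2) = 0 & forall i, squares_of u1 i \in unitmx].
  apply: param_surjective => [i|i v]; last by rewrite ev0.
  by apply: contraTneq (wn0 i isT) => ->; rewrite mxE eqxx.
apply: (generic_closure (q := fun u => q (flat_of (vectors_of u))) (u0 := u1)
  (phi := fun u => (conormal_point u, conormal_vector u))).
- exact: polynomial_map_pair polynomial_conormal_point polynomial_conormal_vector.
- exact: polynomial_comp Pflat Pq.
- rewrite u1w; suff -> : flat_of (family_of w) = w by [].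
  by apply/ffunP => -[i k]; rewrite ffunE mxE.
move=> {}u qu; apply: zclosure_sub; have [reg normal] := Hq _ qu.
rewrite flat_ofK in reg normal; split=> //= v Tv.
rewrite bwC -[bw _ _]/((fun v => bw (conormal_vector u) v) v).
apply: normal Tv => [c x y|v']; first exact: bwPr.
exists (fun i => [ffun t => if tag t == i then v' t else 0]) => [|i t].
  exact: flat_direction_sum.
rewrite bwC bw_act pairing_pure actK; last by move=> j; apply: gram_unit.
have -> : family_of (flat_of (vectors_of u) +
      t *: [ffun t => if tag t == i then v' t else 0]) =
    dfwith (vectors_of u) (vectors_of u i + t *: family_of v' i).
  apply: functional_extensionality_dep => j.
  case: (eqVneq i j) => [<-|ij]; apply/rowP => k; rewrite mxE !ffunE /=.
    by rewrite dfwith_in eqxx !mxE.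
  by rewrite dfwith_out // eq_sym (negPf ij) [_ *: _]mulr0 addr0.
exact: param_normal_at.
Qed.

Lemma pair_sum (V W : nmodType) (I : finType) (F : I -> V) (G : I -> W) :
  \sum_i (F i, G i) = (\sum_i F i, \sum_i G i).
Proof. by elim/big_rec3: _ => // i x y z _ ->. Qed.

(** ** The dual variety *)

(** The origin may or may not be a regular point of X; in either case its tangent
    space contains X, so that only the zero vector is normal there. *)
Lemma conormal_pair x y : regular_point X x -> Defs.normal_space bw X x y ->
  range conormal_vector y.
Proof.
move=> [[xi _ <-] _] Ny.
case: (pselect (forall i, xi i != 0)) => [xi0|].
  have [u [_ uE _]] := param_surjective xi0 (normal_space_pure Ny).
  by exists u => //; rewrite /conormal_vector uE sharpK.
move=> /existsNP[i /negP]; rewrite negbK => /eqP xi0.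
have x0 : pure xi = 0 :> tensor.
  by apply/ffunP => a; rewrite !ffunE (bigD1 i) //= xi0 mxE mul0r.
exists (params_of (fun=> 0) 0 (fun=> 0)) => //; rewrite x0 in Ny.
rewrite (normal_space0 Ny) /conormal_vector /sharp.
have zero h (z : tensor) : z = 0 -> act h z = 0.
  by move=> ->; apply: tensor_ev_ext => eta; rewrite ev_act !ev0.
rewrite !zero //; apply/ffunP => a; rewrite !ffunE.
by case: ifP.
Qed.

Lemma dual_rank_one : dual_variety bw X = zclosure (range conormal_vector).
Proof.
apply/seteqP; split.
  rewrite -[X in _ `<=` X]zclosureK; apply: zclosure_mono => _ [[x y] Cxy <-].
  apply: (zclosure_map (psi := snd)) Cxy => [|[x' y'] /= [rx Ny]].
    exact: polynomial_map_linear.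
  by apply: zclosure_sub; apply: conormal_pair Ny.
apply: zclosure_mono => _ [u _ <-].
by exists (conormal_point u, conormal_vector u) => //; apply: conormal_rank_one.
Qed.

Lemma range_conormal_vector h z :
  range conormal_vector (sharp (act h (mask z))).
Proof.
exists (params_of h z (fun=> 0)) => //.
by rewrite /conormal_vector squares_ofK.
Qed.

(** One half of biduality.  By generic smoothness only the velocities of the
    conormal vector have to be orthogonal to the conormal point, and they may be
    taken in one slot at a time. *)
Lemma conormal_dual u : conormal bw (dual_variety bw X)
  (conormal_vector u, conormal_point u).
Proof.
rewrite dual_rank_one.
have [q [Pq [u1 qu1] Hq]] := generic_normal 'I_p polynomial_conormal_vector.
apply: (generic_closure (q := q) (u0 := u1)
  (phi := fun u => (conormal_vector u, conormal_point u))) => //.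
  exact: polynomial_map_pair polynomial_conormal_vector polynomial_conormal_point.
move=> {}u qu; apply: zclosure_sub; have [reg normal] := Hq _ qu.
split=> //= v Tv; rewrite bwC -[bw _ _]/((fun v => bw (conormal_point u) v) v).
apply: normal Tv => [c x y|v']; first exact: bwPr.
pose i0 := Ordinal p_gt0.
(* the motion of the masked tensor and of the scalars is joined to that of the
   first slot *)
exists (fun i => ([ffun t => if tag t == i then v'.1.1 t else 0],
  (if i == i0 then v'.1.2 else 0), (if i == i0 then v'.2 else 0))) => [|i t].
  case: v' => [[h z] c]; rewrite !pair_sum /= -!big_mkcond !big_pred1_eq.
  congr (_, _, _); apply/ffunP => t; rewrite sum_ffunE (bigD1 (tag t)) //= ffunE eqxx.
  by rewrite big1 ?addr0 // => i it; rewrite ffunE eq_sym (negPf it).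
rewrite bw_pure actK; last by move=> j; apply: gram_unit.
apply: (@param_normal u _ _ i) => k ki; apply/matrixP => a b; rewrite !mxE /=.
by rewrite !ffunE /= (negPf ki) [_ *: _]mulr0 addr0.
Qed.

(** The gradient of P at y, identified with a tensor by the Bombieri-Weyl form. *)
Definition gradient (P : polyfun tensor) y : tensor :=
  [ffun a => (pdiff P y (sharp (unit_tensor R a)) : C^o)].

Lemma gradient_linear c P Q y :
  gradient (c *: P + Q) y = c *: gradient P y + gradient Q y.
Proof.
apply/ffunP => a; have E P' : gradient P' y a = pdiff P' y (sharp (unit_tensor R a)).
  by rewrite ffunE.
by rewrite E pdiffD pdiffZ -!E [RHS]ffunE [in RHS]ffunE.
Qed.

Lemma gradientE P y w : pairing (gradient P y) w = pdiff P y (sharp w).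
Proof.
rewrite (@linear_form_pairing _ _ _ (fun w => pdiff P y (sharp w))) //.
by move=> c u v; rewrite /sharp act_linear pdiffP.
Qed.

(** The gradient of P is a polynomial map and X is closed, so the claim has to be
    checked at generic points only, where [contact_rank_one_orbit] applies: P
    vanishes on the lines in which the masked tensor or one slot moves. *)
Lemma gradient_rank_one P y : vanishing_ideal (zclosure (range conormal_vector)) P ->
  zclosure (range conormal_vector) y -> X (gradient P y).
Proof.
move=> PY; rewrite -(@rank_one_zclosed R p n p_gt0); move: y.
have Pgrad : polynomial_map (gradient P).
  apply: polynomial_map_ffun => a.
  apply: polynomial_ext (polynomial_pdiff P (sharp (unit_tensor R a))) => y.
  by rewrite ffunE.
apply: (zclosure_map Pgrad) => _ [u _ <-]; move: u.
have [r [A [B [rk [z0 dA]]]]] := exists_maximal_minor R o.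
pose q u := \det (A *m hessian o (mask u.1.2) *m B) * \prod_i \det (squares_of u i).
apply: (generic_closure (q := q) (u0 := params_of (fun=> 1%:M) z0 (fun=> 0))).
- exact: polynomial_map_comp polynomial_conormal_vector Pgrad.
- apply: polynomialM.
    apply: polynomial_det => a b; apply: polynomial_linear => c v w /=.
    by rewrite mask_linear hessian_linear mulmxDr mulmxDl -scalemxAr -scalemxAl !mxE.
  apply: polynomial_prod => i _; apply: polynomial_det => a b.
  exact: polynomial_squares_of.
- rewrite /q squares_ofK mulf_neq0 //; apply/prodf_neq0 => i _.
  by rewrite det1 oner_neq0.
move=> u; rewrite mulf_eq0 negb_or => /andP[du /prodf_neq0 gu].
apply: zclosure_sub.
apply: (contact_rank_one_orbit p_gt0 rk du (g := squares_of u)) => [i|z|i M].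
- by rewrite unitmxE unitfE gu.
- rewrite gradientE; apply: pdiff_eq0 => t; apply: PY; apply: zclosure_sub.
  have -> : conormal_vector u + t *: sharp (act (squares_of u) (mask z)) =
      sharp (act (squares_of u) (mask (t *: z + u.1.2))).
    by rewrite /conormal_vector /sharp mask_linear !act_linear addrC.
  exact: range_conormal_vector.
rewrite gradientE; apply: pdiff_eq0 => t; apply: PY; apply: zclosure_sub.
have -> : conormal_vector u + t *: sharp (act (dfwith (squares_of u) M) (mask u.1.2)) =
    sharp (act (dfwith (squares_of u) (t *: M + squares_of u i)) (mask u.1.2)).
  rewrite addrC /conormal_vector /sharp -act_linear; congr act.
  apply: tensor_ev_ext => xi; rewrite evP !ev_act.
  have shift N : (fun k => xi k *m dfwith (squares_of u) N k) =
      dfwith (fun k => xi k *m squares_of u k) (xi i *m N : 'rV_(n i)).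
    apply: functional_extensionality_dep => k; case: (eqVneq i k) => [<-|ik].
      by rewrite !dfwith_in.
    by rewrite !dfwith_out.
  rewrite !shift mulmxDr -scalemxAr ev_dfwithP.
  by rewrite (dfwith_id (fun k => xi k *m squares_of u k)).
exact: range_conormal_vector.
Qed.

(** The other half of biduality.  The gradients at y of the equations of the dual
    variety form a subspace with annihilator the tangent space, so every normal
    vector is a gradient. *)
Lemma conormal_dual_rank_one y x : conormal bw (dual_variety bw X) (y, x) -> X x.
Proof.
rewrite dual_rank_one -(@rank_one_zclosed R p n p_gt0).
apply: (zclosure_map (psi := snd)) => [|{y x}[y x] /= [[Yy _] Ny]].
  exact: polynomial_map_linear.
pose A : set tensor := [set w | exists2 P,
  vanishing_ideal (zclosure (range conormal_vector)) P & w = gradient P y].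
have [P PY ->] : A x.
  apply: subspace_separation => [|c v w [P PY ->] [Q QY ->]|z Hz].
  - exists 0 => [w _|]; first by rewrite /peval meval0.
    by apply/ffunP => a; rewrite !ffunE pdiff0.
  - exists (c *: P + Q) => [v' Yv|]; first by
      rewrite /peval mevalD mevalZ [meval _ P](PY v' Yv) [meval _ Q](QY v' Yv)
        mulr0 addr0.
    by rewrite gradient_linear.
  rewrite -(bw_sharp g) bwC; apply: Ny => P PY.
  by rewrite -gradientE; apply: Hz; exists P.
exact: zclosure_sub (gradient_rank_one PY Yy).
Qed.

End ConormalVarieties.
(** * The data locus *)

Section DataLocus.
Variables (R : realType) (p : nat) (n : 'I_p -> nat).
Variable g : forall i : 'I_p, {dot 'rV[R]_(n i) for idfun}.
Local Notation C := R[i].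
Local Notation tensor := (tensor R n).
Local Notation index := (multi_index n).
Local Notation X := (@rank_one_cone R p n).
Local Notation bw := (bombieri_weyl g).
Hypothesis p_gt0 : (0 < p)%N.

(** The correspondence is the graph of a linear map over a closed set, hence it is
    closed. *)
Lemma joint_EDP (y x T : tensor) : joint_ED bw X (y, x, T) ->
  conormal bw (dual_variety bw X) (y, x) /\ T = x + y.
Proof.
move=> E; split.
  rewrite /conormal -zclosureK.
  apply: (zclosure_map (psi := fst)) E => [|[[y' x'] T'] [/= + _]].
    exact: polynomial_map_linear.
  exact: zclosure_sub.
apply/ffunP => a; apply/eqP; rewrite -subr_eq0; apply/eqP.
pose f (u : tensor * tensor * tensor) : C := u.2 a - (u.1.2 + u.1.1) a.
apply: (zclosure_fun (f := f)) E => [|[[y' x'] T'] [/= _ ->]]; last first.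
  by rewrite /f /= subrr.
apply: polynomial_linear => c u v; rewrite /f /= !ffunE.
have key (s1 s2 s3 t1 t2 t3 : C) : c * s1 + t1 - (c * s2 + t2 + (c * s3 + t3)) =
  c * (s1 - (s2 + s3)) + (t1 - (t2 + t3)) by ring.
exact: key.
Qed.

Lemma DL2_intro (y x : tensor) : conormal bw (dual_variety bw X) (y, x) -> X y ->
  dual_variety bw X y -> DL2 g (x + y).
Proof.
move=> Cyx Xy Dy; apply: zclosure_sub; exists (y, x, x + y) => //.
by split; first exact: zclosure_sub.
Qed.

(** If some factor has dimension zero, then there is a single tensor and it is
    enough that the data locus is not empty, which requires a regular point. *)
Lemma DL2_empty : (index -> False) -> forall T, DL2 g T.
Proof.
move=> none; have all_eq (S T : tensor) : S = T by apply/ffunP => a; case: (none a).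
have XT : X = zclosure (range (@id tensor)).
  apply/seteqP; split=> [S _|S _]; first by apply: zclosure_sub; exists S.
  by exists (fun i => 0).
have [q [_ [S0 qS0] Hq]] := generic_normal 'I_p (@polynomial_map_id C tensor).
have bw0 (S T : tensor) : bw S T = 0.
  by rewrite /bombieri_weyl big1 // => a; case: (none a).
have con : conormal bw X (0, 0).
  apply: zclosure_sub; split=> [|v _]; last exact: bw0.
  by rewrite XT /= [X in regular_point _ X](all_eq _ S0); apply: (Hq S0 qS0).1.
have dual : dual_variety bw X = X.
  apply/seteqP; split=> [S _|S _]; first by exists (fun i => 0).
  by apply: zclosure_sub; exists (0, 0).
move=> T; rewrite (all_eq T (0 + 0)).
by apply: DL2_intro; rewrite ?dual //; exists (fun i => 0).
Qed.

Lemma DL2_rank_one : X `<=` DL2 g.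
Proof.
move=> T [xi _ <-]; case: (pselect (exists _ : index, True)) => [[o _]|none]; last first.
  by apply: DL2_empty => a; case: none; exists a.
have [u [ux uy]] : exists u, conormal_point o u = pure xi /\ conormal_vector g o u = 0.
  have zero (h : forall i, 'M[C]_(n i)) : act h (0 : tensor) = 0.
    by apply: tensor_ev_ext => eta; rewrite ev_act !ev0.
  case: (pselect (forall i, xi i != 0)) => [xi0|].
    have [|u [ux uy _]] := param_surjective p_gt0 o xi0 (z := 0).
      by move=> i v; rewrite ev0.
    by exists u; rewrite /conormal_point /conormal_vector ux uy /sharp zero.
  move=> /existsNP[i /negP]; rewrite negbK => /eqP xi0.
  exists (params_of (fun=> 0) 0 (fun=> 0)); split.
    apply/ffunP => a; rewrite !ffunE (bigD1 i) //= [RHS](bigD1 i) //= xi0.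
    by rewrite /vectors_of ffunE scale0r !mxE !mul0r.
  have mask0 : mask o (0 : tensor) = 0.
    by apply/ffunP => a; rewrite !ffunE if_same.
  by rewrite /conormal_vector mask0 /sharp !zero.
rewrite -[pure xi]addr0 -ux -uy; apply: DL2_intro.
- exact: conormal_dual.
- by rewrite uy; apply: rank_one0.
- by rewrite (dual_rank_one g p_gt0 o); apply: zclosure_sub; exists u.
Qed.

Lemma DL2_border_rank : DL2 g `<=` @border_rank_le R p n 2.
Proof.
move=> T DT; case: (pselect (exists _ : index, True)) => [[o _]|none]; last first.
  apply: rank_one_border => //; exists (fun i => 0) => //.
  by apply/ffunP => a; case: none; exists a.
apply: zclosure_rank_le2_border => //; apply: zclosure_mono DT.
move=> _ [[[y x] S] [/joint_EDP[Cyx ->] [[[Xy _] _] _]] <-].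
have [xi _ <-] := conormal_dual_rank_one p_gt0 o Cyx.
by have [eta _ /= <-] := Xy; apply/rank_le2P; exists xi, eta.
Qed.

Lemma DL2_weakly_odeco : weakly_odeco_le g 2 `<=` DL2 g.
Proof.
move=> T [m [x [m2 x0 xorth ->]]].
case: m m2 x x0 xorth => [|[|[|//]]] _ x x0 xorth.
- by rewrite big_ord0; apply: DL2_rank_one; apply: rank_one0.
- by rewrite big_ord1; apply: DL2_rank_one; eexists.
rewrite sum_ord2; have [p1|p1] := eqVneq p 1%N.
  apply: DL2_rank_one; pose i0 := Ordinal p_gt0.
  have only (k : 'I_p) : i0 = k.
    by apply: val_inj => /=; case: k => k /=; rewrite p1; case: k.
  have -> : x 1 = dfwith (x 0) (x 1 i0).
    by apply: functional_extensionality_dep => k; case: _ / (only k); rewrite dfwith_in.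
  rewrite -{1}(dfwith_id (x 0) i0) -[pure (dfwith _ (x 0 i0))]scale1r -pure_dfwithP.
  by eexists.
case: (pselect (exists _ : index, True)) => [[o _]|none]; last first.
  by apply: DL2_empty => a; case: none; exists a.
have normal : normal_at (x 0) (act (gram g) (pure (x 1))).
  move=> i v; have [k ik] : exists k, i != k.
    apply: contrapT => h; case/eqP: p1.
    have only k : k = i.
      by apply/eqP; apply: contraT; rewrite eq_sym => ik; case: h; exists k.
    apply/eqP; rewrite eqn_leq p_gt0 andbT leqNgt; apply/negP => p2.
    by have := only (Ordinal p2); rewrite -(only (Ordinal p_gt0)) => /(congr1 val).
  rewrite -bw_pure bombieri_weyl_pure (bigD1 k) //= dfwith_out //.
  by rewrite xorth ?mul0r.
have [u [ux uy _]] := param_surjective p_gt0 o (x0 0) normal.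
have xu : pure (x 0) = conormal_point o u by rewrite /conormal_point ux.
have yu : pure (x 1) = conormal_vector g o u by rewrite /conormal_vector uy sharpK.
rewrite xu yu; apply: DL2_intro; first exact: conormal_dual.
- by rewrite -yu; eexists.
- by rewrite (dual_rank_one g p_gt0 o); apply: zclosure_sub; exists u.
Qed.

End DataLocus.

Theorem proposition3p7 (R : realType) (p : nat) (n : 'I_p -> nat)
    (g : forall i : 'I_p, {dot 'rV[R]_(n i) for idfun}) (hp : (0 < p)%N) :
  [/\ @rank_one_cone R p n `<=` DL2 g,
      DL2 g `<=` @border_rank_le R p n 2
    & weakly_odeco_le g 2 `<=` DL2 g].
Proof.
split; [exact: DL2_rank_one | exact: DL2_border_rank | exact: DL2_weakly_odeco].
Qed.
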